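(* Let $d\ge2$, $N\geq1$ and let $\Omega\subset\mathbb{R}^N$ be an open set. For any $u\in BV(\Omega;\mathbb{RP}^{d-1})$, there exists a lifting $n\in BV(\Omega;\mathbb{S}^{d-1})$ with $u=[n]$ a.e. in $\Omega$ and $$|||n|||_{BV,\mathbb{R}^d}\leq\Big(1+\frac2\pi\Big)|||u|||_{BV,\mathbb{R}^{d\times d}}.$$
   Context: For $n\in\mathbb{S}^{d-1}$ (the unit sphere of $\mathbb{R}^d$), $[n]=\{\pm n\}$ denotes the corresponding element of $\mathbb{RP}^{d-1}=\mathbb{S}^{d-1}/\mathbb{Z}_2$, which carries the Riemannian metric induced from $\mathbb{S}^{d-1}$. Maps into $\mathbb{RP}^{d-1}$ are identified with maps into $\mathbb{R}^{d\times d}$ through the isometric embedding $\Phi([n])=\frac1{\sqrt2}n\otimes n$, and maps into $\mathbb{S}^{d-1}$ are regarded as maps into $\mathbb{R}^d$. For $\mathcal N\subset\mathbb{R}^D$, $BV(\Omega;\mathcal N)$ is the set of maps $u\in L^1_{loc}(\Omega;\mathbb{R}^D)$ such that $u(x)\in\mathcal N$ a.e. and $Du$ is a finite Radon measure. For a $BV$ map $u$ with values in a Euclidean space $\mathbb{R}^D$ (here $\mathbb{R}^D=\mathbb{R}^d$ or $\mathbb{R}^{d\times d}$ with the Frobenius norm), with $D_\omega u=(Du)\omega$ the partial derivative measure in direction $\omega\in\mathbb{S}^{N-1}$, set $$|||u|||_{BV,\mathbb{R}^D}=\frac{1}{\mathcal H^{N-1}(\mathbb{S}^{N-1})}\int_{\mathbb{S}^{N-1}}|D_\omega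 u|(\Omega)\,d\mathcal H^{N-1}(\omega).$$ Equivalently, $$|||u|||_{BV,\mathbb{R}^D}=\int_\Omega\frac{1}{\mathcal H^{N-1}(\mathbb{S}^{N-1})}\int_{\mathbb{S}^{N-1}}|\nabla_\omega u|\,d\mathcal H^{N-1}(\omega)\,dx+K_N|D^cu|(\Omega)+K_N\int_{J_u}|u^+-u^-|_{\mathbb{R}^D}\,d\mathcal H^{N-1},$$ where $\nabla_\omega u=(\nabla u)\omega$ with $\nabla u$ the approximate gradient, $D^cu$ is the Cantor part of $Du$, $J_u$ is the jump set with traces $u^\pm$, and $K_N=\frac{1}{\mathcal H^{N-1}(\mathbb{S}^{N-1})}\int_{\mathbb{S}^{N-1}}|\omega\cdot e|\,d\mathcal H^{N-1}(\omega)$ for any $e\in\mathbb{S}^{N-1}$. *)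

(* Defs.v *)
From HB Require Import structures.
From mathcomp Require Import all_boot all_order all_algebra.
From mathcomp Require Import all_classical all_reals all_analysis.
From mathcomp Require Import measurable_realfun.

Set Implicit Arguments.
Unset Strict Implicit.
Unset Printing Implicit Defensive.
Import Order.TTheory GRing.Theory Num.Theory.
Import numFieldNormedType.Exports.
Local Open Scope classical_set_scope.
Local Open Scope ring_scope.

(* Points of R^N are row vectors ['rV[R]_N] with the library topology, which is
   the Euclidean one. The library norm on matrices is the sup norm, so every
   metric quantity below goes through [frob]: the Euclidean norm on row
   vectors, the Frobenius norm on square matrices. *)

Section euclidean.
Context {R : realType}.

Definition frob p q (A : 'M[R]_(p, q)) : R :=
  Num.sqrt (\sum_i \sum_j A i j ^+ 2).

Definition unit_sphere n : set 'rV[R]_n := [set v | frob v = 1].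

(* The embedding [n] |-> (n (x) n) / sqrt 2 on representatives; it is even, and
   [RP d] is the embedded projective space. *)
Definition rp_embed d (n : 'rV[R]_d) : 'M[R]_d :=
  (Num.sqrt 2)^-1 *: (n^T *m n).

Definition RP d : set 'M[R]_d := @rp_embed d @` @unit_sphere d.

End euclidean.

Definition borel (R : realType) (N : nat) := g_sigma_algebraType (@open 'rV[R]_N).
HB.instance Definition _ (R : realType) N := Measurable.on (borel R N).

Section lebesgue.
Context {R : realType}.

Lemma measurable_coord n (i : 'I_n) :
  measurable_fun [set: borel R n]
    (fun v => (v : 'rV[R]_n) ord0 i : measurableTypeR R).
Proof.
apply: (measurability _ (RGenOpens.measurableE R)).
move=> _ [_ [a [b ->] <-]]; rewrite setTI; apply: sub_sigma_algebra.
have /continuousP := @coord_continuous R 1 n ord0 i.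
by apply; exact: interval_open.
Qed.

Lemma measurable_rowP d (T : measurableType d) n (f : T -> borel R n) :
  (forall i, measurable_fun [set: T]
     (fun t => (f t : 'rV[R]_n) ord0 i : measurableTypeR R)) ->
  measurable_fun [set: T] f.
Proof.
move=> mf; apply: (@measurability _ _ _ (borel R n) _ _ (@open 'rV[R]_n)); first by [].
move=> _ [U oU <-]; rewrite setTI.
pose box (qk : 'rV[rat]_n * nat) : set 'rV[R]_n :=
  [set v | forall i, `|v ord0 i - ratr (qk.1 ord0 i)| < qk.2.+1%:R^-1].
pose F qk : set T := if `[< box qk `<=` U >] then f @^-1` (box qk) else set0.
have -> : f @^-1` U = \bigcup_qk F qk.
  apply/seteqP; split => t /=; last first.
    by move=> [qk _]; rewrite /F; case: asboolP => // + ft; apply.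
  move=> Uft; have /nbhs_ballP[e e0 eU] : nbhs (f t : 'rV[R]_n) U.
    exact: open_nbhs_nbhs.
  have e20 : 0 < e / 2 by rewrite divr_gt0.
  pose k := Num.bound (e / 2)^-1.
  have ke : k.+1%:R^-1 < e / 2.
    rewrite invf_plt ?posrE// (lt_trans (archi_boundP _)) ?ltr_nat//.
    by rewrite invr_ge0 ltW.
  have k0 : 0 < k.+1%:R^-1 :> R by rewrite invr_gt0.
  have /choice[q qP] : forall i : 'I_n, exists q : rat,
      `|(f t : 'rV[R]_n) ord0 i - ratr q| < k.+1%:R^-1.
    move=> i; set x := (_ : 'rV[R]_n) _ _.
    have xx : x - k.+1%:R^-1 < x + k.+1%:R^-1 by rewrite ltrD2l gtrN.
    have [q] := rat_in_itvoo xx; rewrite in_itv /= => /andP[q1 q2].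
    by exists q; rewrite ltr_distlC; apply/andP.
  exists (\row_i q i, k) => //; rewrite /F; case: asboolP => [_ i|].
    by rewrite mxE; exact: qP.
  case => v vq; apply: eU; split => // i j; rewrite (ord1 i).
  rewrite /ball /= (le_lt_trans (ler_distD (ratr (q j)) _ _))//.
  rewrite (splitr e) ltrD//; apply: lt_trans ke; first exact: qP.
  by have := vq j; rewrite mxE distrC.
apply: countable_bigcupT_measurable => // qk.
rewrite /F; case: asboolP => // _.
have -> : f @^-1` box qk = \big[setI/setT]_(i < n)
    ((fun t => (f t : 'rV[R]_n) ord0 i : measurableTypeR R) @^-1`
       ball (ratr (qk.1 ord0 i) : R) qk.2.+1%:R^-1).
  rewrite -bigcap_seq; apply/seteqP; split => t /= tP i.
    by move=> _; rewrite /ball/= distrC; exact: tP.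
  by rewrite distrC; apply: tP; rewrite /= mem_index_enum.
apply: bigsetI_measurable => i _; rewrite -[X in measurable X]setTI.
by apply: mf => //; apply: open_measurable; exact: ball_open.
Qed.

Definition consv n (p : measurableTypeR R * borel R n) : borel R n.+1 :=
  \row_(i < n.+1) oapp (fun j => (p.2 : 'rV[R]_n) ord0 j) p.1 (unlift ord0 i).

Definition unconsv n (v : borel R n.+1) : measurableTypeR R * borel R n :=
  ((v : 'rV[R]_n.+1) ord0 ord0,
   \row_(i < n) (v : 'rV[R]_n.+1) ord0 (lift ord0 i)).

Lemma consvK n : cancel (@consv n) (@unconsv n).
Proof.
move=> [x v]; congr pair; first by rewrite mxE unlift_none.
by apply/rowP => i; rewrite !mxE liftK.
Qed.

Lemma measurable_consv n : measurable_fun setT (@consv n).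
Proof.
apply: measurable_rowP => i; rewrite /consv.
under eq_fun do rewrite mxE.
case: (unliftP ord0 i) => [j|] _ /=; last exact: measurable_fst.
exact: (measurableT_comp (@measurable_coord n j) measurable_snd).
Qed.

Lemma measurable_unconsv n : measurable_fun setT (@unconsv n).
Proof.
apply/measurable_fun_pairP; split; first exact: measurable_coord.
apply: measurable_rowP => i /=; under eq_fun do rewrite mxE.
exact: measurable_coord.
Qed.

Section lebS.
Variables (n : nat) (m : {sigma_finite_measure set (borel R n) -> \bar R}).

Definition lebS : set (borel R n.+1) -> \bar R :=
  pushforward (@lebesgue_measure R \x m)%E (@consv n).

Let lebS0 : lebS set0 = 0%E.
Proof. by rewrite /lebS /pushforward preimage_set0 measure0. Qed.

Let lebS_ge0 A : (0 <= lebS A)%E.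
Proof. by rewrite /lebS /pushforward; exact: measure_ge0. Qed.

Let measurable_consv_preimage A : measurable A -> measurable (@consv n @^-1` A).
Proof.
by move=> mA; rewrite -[X in measurable X]setTI; exact: measurable_consv.
Qed.

Let lebS_sigma_additive : semi_sigma_additive lebS.
Proof.
move=> F mF tF mUF; rewrite /lebS /pushforward preimage_bigcup.
apply: measure_semi_sigma_additive.
- by move=> k; exact: measurable_consv_preimage.
- apply/trivIsetP => /= i j _ _ ij; rewrite -preimage_setI.
  by move/trivIsetP : tF => /(_ _ _ _ _ ij) ->//; rewrite preimage_set0.
- by rewrite -preimage_bigcup; exact: measurable_consv_preimage.
Qed.

HB.instance Definition _ := isMeasure.Build _ _ _ lebS
  lebS0 lebS_ge0 lebS_sigma_additive.

Let lebS_sigma_finite : sigma_finite setT lebS.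
Proof.
have /sigma_finiteP[F [FT ndF Foo]] := sigma_finiteT (@lebesgue_measure R).
have /sigma_finiteP[G [GT ndG Goo]] := sigma_finiteT m.
exists (fun k => @unconsv n @^-1` (F k `*` G k)).
  apply/esym; rewrite -preimage_bigcup -subTset => v _ /=.
  have [i _ Fi] : (\bigcup_k F k) (unconsv v).1 by rewrite -FT.
  have [j _ Gj] : (\bigcup_k G k) (unconsv v).2 by rewrite -GT.
  exists (maxn i j) => //; split.
    by move: Fi; exact/subsetPset/ndF/leq_maxl.
  by move: Gj; exact/subsetPset/ndG/leq_maxr.
move=> k; have [mF Fk] := Foo k; have [mG Gk] := Goo k; split.
  rewrite -[X in measurable X]setTI; apply: measurable_unconsv => //.
  exact: measurableX.
rewrite /lebS /pushforward (_ : _ @^-1` _ = F k `*` G k).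
  by rewrite product_measure1E// lte_mul_pinfty// ge0_fin_numE.
by apply/funext => x; rewrite /preimage/= -[in RHS](consvK x).
Qed.

HB.instance Definition _ := Measure_isSigmaFinite.Build _ _ _ lebS
  lebS_sigma_finite.

End lebS.

(* Lebesgue measure on the Borel sets of R^N, as an iterated product. *)
Fixpoint leb N : {sigma_finite_measure set (borel R N) -> \bar R} :=
  match N return {sigma_finite_measure set (borel R N) -> \bar R} with
  | 0 => \d_((0 : 'rV[R]_0) : borel R 0)
  | n.+1 => lebS (leb n)
  end.

End lebesgue.
Arguments leb R N : clear implicits.

Section hausdorff.
Context {R : realType} {N : nat} (s : nat).
Implicit Types (A E : set 'rV[R]_N) (delta : R).
Local Open Scope ereal_scope.

Definition diam E : \bar R :=
  ereal_sup [set (frob (x - y))%:E | x in E & y in E].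

(* For s = 0 a nonempty set has weight 1, so [hausdorff] is then the counting
   measure. *)
Definition diam_pow E : \bar R := if E == set0 then 0 else diam E ^+ s.

(* Hausdorff s-measure without the constant omega_s / 2^s, which cancels in the
   spherical average of [bv_seminorm]. *)
Definition hausdorff_pre delta A : \bar R :=
  ereal_inf [set \sum_(k <oo) diam_pow (F k) |
    F in [set F : (set 'rV[R]_N)^nat |
      A `<=` \bigcup_k F k /\ forall k, diam (F k) <= delta%:E]].

Definition hausdorff A : \bar R :=
  ereal_sup [set hausdorff_pre delta A | delta in [set delta | (0 < delta)%R]].

Let all_sets := g_sigma_algebraType [set: set 'rV[R]_N].

Let measurable_all_sets (A : set all_sets) : measurable A.
Proof. exact: sub_sigma_algebra. Qed.

Lemma diam0 : diam set0 = -oo.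
Proof.
rewrite /diam (_ : [set _ | _ in _ & _ in _] = set0) ?ereal_sup0//.
by rewrite -subset0 => e [x []].
Qed.

Lemma diam_ge0 E : E !=set0 -> 0 <= diam E.
Proof.
move=> [x Ex]; apply: ereal_sup_ubound; exists x => //; exists x => //.
rewrite subrr /frob big1 ?sqrtr0// => i _.
by rewrite big1// => j _; rewrite mxE expr0n.
Qed.

Lemma diam_pow_ge0 E : 0 <= diam_pow E.
Proof.
rewrite /diam_pow; case: ifPn => // /set0P E0.
by rewrite expe_ge0// diam_ge0.
Qed.

Let gauge delta (E : set all_sets) : \bar R :=
  if diam E <= delta%:E then diam_pow E else +oo.

Let gauge_ge0 delta E : 0 <= gauge delta E.
Proof. by rewrite /gauge; case: ifPn => // _; exact: diam_pow_ge0. Qed.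

Let gauge0 delta : gauge delta set0 = 0.
Proof. by rewrite /gauge diam0 leNye /diam_pow eqxx. Qed.

Let hausdorff_preE delta : hausdorff_pre delta = mu_ext (gauge delta).
Proof.
apply/funext => A; apply/eqP; rewrite eq_le; apply/andP; split.
  apply: le_ereal_inf_tmp => _ [F [_ AF] <-].
  have [Fd|] := pselect (forall k, diam (F k) <= delta%:E).
    apply: ereal_inf_lbound; exists F => //.
    by apply: eq_eseriesr => k _; rewrite /gauge Fd.
  move=> /existsNP[k /negP Fk]; rewrite (eseries_pinfty (k := k))// ?leey//.
    by move=> i _; rewrite -ltNye (lt_le_trans _ (gauge_ge0 _ _)).
  by rewrite /gauge (negbTE Fk).
apply: le_ereal_inf_tmp => _ [F [AF Fd] <-].
apply: ereal_inf_lbound; exists F; first by split.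
by apply: eq_eseriesr => k _; rewrite /gauge Fd.
Qed.

Let hausdorff0 : hausdorff set0 = 0.
Proof.
rewrite /hausdorff (_ : [set _ | _ in _] = [set 0]) ?ereal_sup1//.
apply/seteqP; split => [_ [e e0 <-]/=|_ ->].
  by rewrite hausdorff_preE mu_ext0.
by exists 1%R => //=; rewrite hausdorff_preE mu_ext0.
Qed.

Let hausdorff_ge0 A : 0 <= hausdorff A.
Proof.
apply: (@le_trans _ _ (hausdorff_pre 1 A)).
  by rewrite hausdorff_preE mu_ext_ge0.
by apply: ereal_sup_ubound; exists 1%R => //=.
Qed.

Let le_hausdorff : {homo hausdorff : A B / A `<=` B >-> A <= B}.
Proof.
move=> A B AB; apply: ge_ereal_sup => _ [e e0 <-].
apply: (@le_trans _ _ (hausdorff_pre e B)).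
  by rewrite hausdorff_preE le_mu_ext.
by apply: ereal_sup_ubound; exists e.
Qed.

Let hausdorff_sigma_subadditive : sigma_subadditive hausdorff.
Proof.
move=> F; apply: ge_ereal_sup => _ [e e0 <-].
apply: (@le_trans _ _ (\sum_(i <oo) hausdorff_pre e (F i))).
  by rewrite hausdorff_preE mu_ext_sigma_subadditive.
apply: lee_nneseries => i _; first by rewrite hausdorff_preE mu_ext_ge0.
by apply: ereal_sup_ubound; exists e.
Qed.

HB.instance Definition _ := isOuterMeasure.Build R 'rV[R]_N hausdorff
  hausdorff0 hausdorff_ge0 le_hausdorff hausdorff_sigma_subadditive.

Let hausdorff_outer : {outer_measure set 'rV[R]_N -> \bar R} := hausdorff.

Definition hausdorff_measure :
    {measure set (caratheodory_type hausdorff) -> \bar R} :=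
  (hausdorff_outer : set (caratheodory_type hausdorff_outer) -> \bar R).

End hausdorff.
Arguments hausdorff_measure R N s : clear implicits.
Arguments hausdorff R N s : clear implicits.

Section bv.
Context {R : realType} {N : nat}.
Implicit Types (Omega : set 'rV[R]_N).
Local Notation bN := (borel R N).
Local Notation leb := (leb R N).

(* Integral against a signed measure through its Jordan decomposition; the
   value does not depend on the Hahn decomposition chosen. *)
Definition charge_Rintegral (nu : {charge set bN -> \bar R}) (D : set bN)
    (f : bN -> R) : R :=
  let hP := cid (Hahn_decomposition nu) in
  let nuPN := svalP (cid (svalP hP)) in
  \int[jordan_pos nuPN]_(x in D) f x - \int[jordan_neg nuPN]_(x in D) f x.

Definition partial k (phi : 'rV[R]_N -> R) : 'rV[R]_N -> R :=
  fun x => 'D_(delta_mx ord0 k) phi x.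

(* phi is in C^1_c(Omega), extended by 0 outside of Omega. *)
Definition test_fun Omega (phi : 'rV[R]_N -> R) : Prop :=
  [/\ forall x, differentiable phi x,
      forall k, continuous (partial k phi),
      compact (closure [set x | phi x != 0]) &
      closure [set x | phi x != 0] `<=` Omega].

Definition matrix_charge p q := 'I_p -> 'I_q -> 'I_N -> {charge set bN -> \bar R}.

(* [mu i j k] is the k-th distributional partial derivative of the (i, j) entry
   of [u]; only its restriction to Borel subsets of [Omega] is relevant. *)
Definition is_Du p q Omega (u : 'rV[R]_N -> 'M[R]_(p, q))
    (mu : matrix_charge p q) : Prop :=
  forall i j k phi, test_fun Omega phi ->
    \int[leb]_(x in Omega) (u x i j * partial k phi x) =
    - charge_Rintegral (mu i j k) Omega phi.

Definition L1loc p q Omega (u : 'rV[R]_N -> 'M[R]_(p, q)) : Prop :=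
  forall K, compact K -> K `<=` Omega ->
  forall i j, leb.-integrable K (fun x => (u x i j)%:E).

Definition BV p q Omega (M : set 'M[R]_(p, q)) (u : 'rV[R]_N -> 'M[R]_(p, q))
    : Prop :=
  [/\ L1loc Omega u, {ae leb, forall x, Omega x -> M (u x)} &
      exists mu, is_Du Omega u mu].

(* For [u] of bounded variation any choice gives the same measure on [Omega]. *)
Definition Du p q Omega (u : 'rV[R]_N -> 'M[R]_(p, q)) : matrix_charge p q :=
  if pselect (exists mu, is_Du Omega u mu) is left h then sval (cid h)
  else fun _ _ _ => czero.

(* The matrix-valued measure (Du) w. *)
Definition directional p q (mu : matrix_charge p q) (w : 'rV[R]_N)
    (A : set bN) : 'M[R]_(p, q) :=
  \matrix_(i, j) \sum_k w ord0 k * fine (mu i j k A).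

Definition total_variation p q (nu : set bN -> 'M[R]_(p, q)) (A : set bN)
    : \bar R :=
  ereal_sup [set (\sum_(k <oo) (frob (nu (F k)))%:E)%E |
    F in [set F : (set bN)^nat | [/\ forall k, measurable (F k),
      trivIset setT F & \bigcup_k F k = A]]].

(* The integrand is the total variation of (Du) w on [Omega]. *)
Definition bv_seminorm p q Omega (u : 'rV[R]_N -> 'M[R]_(p, q)) : \bar R :=
  let H := hausdorff_measure R N N.-1 in
  let S := @unit_sphere R N : set (caratheodory_type (hausdorff R N N.-1)) in
  (((fine (H S))^-1)%:E *
   \int[H]_(w in S) total_variation (directional (Du Omega u) w) Omega)%E.

End bv.

(* Main.v *)
Require Import Defs.
From HB Require Import structures.
From mathcomp Require Import all_boot all_order all_algebra.
From mathcomp Require Import all_classical all_reals all_analysis.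
From mathcomp Require Import measurable_realfun ring lra.
Import Order.TTheory GRing.Theory Num.Theory.
Import numFieldNormedType.Exports.
Local Open Scope classical_set_scope.
Local Open Scope ring_scope.
Set Implicit Arguments.
Unset Strict Implicit.
Unset Printing Implicit Defensive.

(* Fix a representative w of u with values in RP everywhere. For e in the unit
   ball of R^d, n_e(x) = w(x) e / |w(x) e| is a measurable lifting of w where
   w(x) e <> 0: of the two unit vectors +-n on the line w(x) it takes the one
   with n . e > 0. For two lines at angle theta these choices disagree with
   probability theta / pi, whence, averaging over e,
     E |n_e(x) - n_e(y)| <= (1 + 2 / pi) |w(x) - w(y)|.
   The L^1 norm of w(. + t om) - w on a compact part of Omega is at most
   t |D_om u|(Omega), so by Fatou's lemma the liminf as t -> 0 of the
   difference quotients of n_e in direction om is on average at most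
   (1 + 2 / pi) |D_om u|(Omega). This liminf bounds |D_om n_e|(Omega), and when
   it is finite in the coordinate directions D n_e is a measure, by weak
   compactness. Integrating over om as well, some e does no worse than the
   average. The decomposition of Du into absolutely continuous, Cantor and jump
   parts is not needed. *)

(** The constant is the slope at angle zero of the averaged cost. Lines at a small angle [theta] are
    at distance [sin theta], matching representatives are about [theta] apart, and a mismatch, of
    length close to 2, has probability [theta / pi]; the ratio tends to [1 + 2 / pi]. This
    probability is bounded through additivity along great circles and the invariance of Lebesgue
    measure under reflections. The obstacle is that [D n_e] is not known to be a measure when the
    average is taken, and that a choice of [e] good for one [om] may be bad for another. Hence all
    estimates bear on difference quotients, jointly measurable in [e] and [om], so that one [e]
    serves the whole sphere. Finiteness in the coordinate directions is a separate requirement,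
    since for [N >= 2] an integral over the sphere does not see finitely many directions. It holds
    for almost every [e], as does the fact that [w(x) e] vanishes only on a null set of [x], and a
    first moment argument picks an [e] among these. Tonelli's theorem over the sphere is applied to
    a finite Borel measure, whence the proof that Borel sets are Hausdorff measurable. *)

Section frobenius.
Context {R : realType} {p q : nat}.
Implicit Types A B C : 'M[R]_(p, q).

Definition mxdot A B : R := \sum_i \sum_j A i j * B i j.

Lemma mxdotC A B : mxdot A B = mxdot B A.
Proof. by apply: eq_bigr => i _; apply: eq_bigr => j _; rewrite mulrC. Qed.

Lemma mxdotDl A B C : mxdot (A + B) C = mxdot A C + mxdot B C.
Proof.
rewrite -big_split; apply: eq_bigr => i _; rewrite -big_split.
by apply: eq_bigr => j _; rewrite mxE mulrDl.
Qed.

Lemma mxdotZl a A B : mxdot (a *: A) B = a * mxdot A B.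
Proof.
rewrite mulr_sumr; apply: eq_bigr => i _; rewrite mulr_sumr.
by apply: eq_bigr => j _; rewrite mxE mulrA.
Qed.

Lemma mxdotDr A B C : mxdot A (B + C) = mxdot A B + mxdot A C.
Proof. by rewrite ![mxdot A _]mxdotC mxdotDl. Qed.

Lemma mxdotZr a A B : mxdot A (a *: B) = a * mxdot A B.
Proof. by rewrite ![mxdot A _]mxdotC mxdotZl. Qed.

Lemma mxdotNl A B : mxdot (- A) B = - mxdot A B.
Proof. by rewrite -scaleN1r mxdotZl mulN1r. Qed.

Lemma mxdotNr A B : mxdot A (- B) = - mxdot A B.
Proof. by rewrite mxdotC mxdotNl mxdotC. Qed.

Lemma mxdot0l A : mxdot 0 A = 0.
Proof. by rewrite -(scale0r 0) mxdotZl mul0r. Qed.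

Lemma mxdotAA A : mxdot A A = frob A ^+ 2.
Proof.
rewrite /frob sqr_sqrtr; last by do 2! apply: sumr_ge0 => ? _; exact: sqr_ge0.
by apply: eq_bigr => i _; apply: eq_bigr => j _; rewrite expr2.
Qed.

Lemma frob_ge0 A : 0 <= frob A.
Proof. exact: sqrtr_ge0. Qed.

Lemma frobE A : frob A = Num.sqrt (mxdot A A).
Proof. by rewrite mxdotAA sqrtr_sqr ger0_norm// frob_ge0. Qed.

Lemma frobZ a A : frob (a *: A) = `|a| * frob A.
Proof.
by rewrite frobE mxdotZl mxdotZr mulrA -expr2 sqrtrM ?sqr_ge0// sqrtr_sqr -frobE.
Qed.

Lemma frobN A : frob (- A) = frob A.
Proof. by rewrite -scaleN1r frobZ normrN1 mul1r. Qed.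

Lemma frob0 : frob (0 : 'M[R]_(p, q)) = 0.
Proof. by rewrite -(scale0r 0) frobZ normr0 mul0r. Qed.

Lemma entry_le_frob A i j : `|A i j| <= frob A.
Proof.
rewrite -sqrtr_sqr ler_wsqrtr// (bigD1 i)//= (bigD1 j)//= -addrA lerDl.
by rewrite addr_ge0//; do ?apply: sumr_ge0 => ? _; exact: sqr_ge0.
Qed.

Lemma frob_eq0 A : (frob A == 0) = (A == 0).
Proof.
apply/eqP/eqP => [A0|->]; last exact: frob0.
apply/matrixP => i j; rewrite mxE; apply/eqP; rewrite -normr_le0 -A0.
exact: entry_le_frob.
Qed.

(** The Cauchy-Schwarz inequality: expand the square of [frob (frob B *: A - frob A *: B)] and
    cancel the positive factor [frob A * frob B]. *)
Lemma mxdot_le_frob A B : mxdot A B <= frob A * frob B.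
Proof.
have [->|A0] := eqVneq A 0; first by rewrite mxdot0l frob0 mul0r.
have [->|B0] := eqVneq B 0; first by rewrite mxdotC mxdot0l frob0 mulr0.
have a0 : 0 < frob A by rewrite lt_neqAle eq_sym frob_eq0 A0 frob_ge0.
have b0 : 0 < frob B by rewrite lt_neqAle eq_sym frob_eq0 B0 frob_ge0.
have := sqr_ge0 (frob (frob B *: A - frob A *: B)).
rewrite -mxdotAA mxdotDl !mxdotDr !(mxdotNl, mxdotNr) !(mxdotZl, mxdotZr).
rewrite (mxdotC B A) !mxdotAA.
have : 0 < frob A * frob B by rewrite mulr_gt0.
move: (frob A) (frob B) (mxdot A B) => a b c ab h.
rewrite -(ler_pM2l ab); lra.
Qed.

Lemma normr_mxdot_le A B : `|mxdot A B| <= frob A * frob B.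
Proof.
rewrite ler_norml mxdot_le_frob andbT lerNl -mxdotNl.
by rewrite (le_trans (mxdot_le_frob _ _))// frobN.
Qed.

Lemma frobD A B : frob (A + B) <= frob A + frob B.
Proof.
rewrite -(@ler_pXn2r _ 2)// ?nnegrE ?addr_ge0 ?frob_ge0//.
rewrite -mxdotAA mxdotDl !mxdotDr !mxdotAA (mxdotC B A).
have := mxdot_le_frob A B; rewrite sqrrD; lra.
Qed.

Lemma frob_sum I (r : seq I) (P : pred I) (F : I -> 'M[R]_(p, q)) :
  frob (\sum_(i <- r | P i) F i) <= \sum_(i <- r | P i) frob (F i).
Proof.
apply: (big_ind2 (fun A b => frob A <= b)) => //; first by rewrite frob0.
by move=> A a B b hA hB; rewrite (le_trans (frobD _ _))// lerD.
Qed.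

Lemma frob_distD A B C : frob (A - C) <= frob (A - B) + frob (B - C).
Proof. by rewrite (le_trans _ (frobD _ _))// addrA subrK. Qed.

Lemma frob_delta i j : frob (delta_mx i j : 'M[R]_(p, q)) = 1.
Proof.
rewrite /frob (bigD1 i)//= (bigD1 j)//= !mxE !eqxx expr1n big1 ?addr0.
  rewrite big1 ?addr0 ?sqrtr1// => k ki; rewrite big1// => l _.
  by rewrite !mxE (negbTE ki) expr0n.
by move=> k kj; rewrite !mxE (negbTE kj) andbF expr0n.
Qed.

Lemma frob_le_sum A : frob A <= \sum_i \sum_j `|A i j|.
Proof.
have {1}-> : A = \sum_i \sum_j A i j *: delta_mx i j by exact: matrix_sum_delta.
rewrite (le_trans (frob_sum _ _ _))//.
apply: ler_sum => i _; rewrite (le_trans (frob_sum _ _ _))//.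
by apply: ler_sum => j _; rewrite frobZ frob_delta mulr1.
Qed.

Lemma frob_le_entries A (e : R) : (forall i j, `|A i j| <= e) ->
  frob A <= (p * q)%:R * e.
Proof.
move=> Ae; rewrite (le_trans (frob_le_sum _))//.
have -> : (p * q)%:R * e = \sum_(i < p) \sum_(j < q) e.
  by rewrite sumr_const card_ord sumr_const card_ord -mulrnA mulr_natl mulnC.
by apply: ler_sum => i _; apply: ler_sum.
Qed.

End frobenius.

Section rowvec.
Context {R : realType} {n : nat}.
Implicit Types x y v : 'rV[R]_n.

Lemma mxdotE x y : mxdot x y = \sum_i x ord0 i * y ord0 i.
Proof. by rewrite /mxdot big_ord1. Qed.

Lemma rv_norm_le x e : 0 <= e -> (forall i, `|x ord0 i| <= e) -> `|x| <= e.
Proof.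
move=> e0 xe; rewrite /Num.norm/= mx_normrE.
by apply/bigmax_leP; split => // -[i j] _ /=; rewrite ord1; exact: xe.
Qed.

Lemma coord_le_norm x i : `|x ord0 i| <= `|x|.
Proof.
rewrite [leRHS]/Num.norm/= mx_normrE.
exact: (le_bigmax _ (fun ij => `|x ij.1 ij.2|) (ord0, i)).
Qed.

(** Compares the sup norm, which defines balls, with the Euclidean one; in particular unit
    directions have sup norm at most 1. *)
Lemma normr_le_frob x : `|x| <= frob x.
Proof. by apply: rv_norm_le => // [|i]; [exact: frob_ge0|exact: entry_le_frob]. Qed.

End rowvec.

(** * Translation invariance of Lebesgue measure *)

Definition mfun_of d1 d2 (T1 : measurableType d1) (T2 : measurableType d2)
    (f : T1 -> T2) (mf : measurable_fun setT f) : {mfun T1 >-> T2} :=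
  HB.pack f (isMeasurableFun.Build _ _ _ _ _ mf).

Lemma lebesgue_measure_shift (R : realType) (a : R) (A : set (measurableTypeR R)) :
  measurable A -> lebesgue_measure ((fun x => x + a) @^-1` A) = lebesgue_measure A.
Proof.
have mf : measurable_fun [set: measurableTypeR R]
    (fun x => x + a : measurableTypeR R).
  by apply: measurable_funD => //; exact: measurable_id.
move=> mA; apply/esym.
apply: (lebesgue_measure_unique (mu := pushforward lebesgue_measure (mfun_of mf))) => // _ [[x y] _ <-].
rewrite [RHS]/=/pushforward/= (_ : _ @^-1` _ = `]x - a, y - a]%classic).
  by rewrite !lebesgue_measure_itv/= !lte_fin ltrD2r -!EFinB opprB addrA subrK.
by apply/seteqP; split => z /=; rewrite !in_itv/= ltrBlDr lerBrDr.
Qed.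

Section leb_shift.
Context {R : realType}.

Lemma open_borel n (U : set 'rV[R]_n) : open U -> measurable (U : set (borel R n)).
Proof. exact: sub_sigma_algebra. Qed.

Lemma measurable_rv_shift n (v : 'rV[R]_n) :
  measurable_fun setT ((fun x => x + v) : borel R n -> borel R n).
Proof.
apply: measurable_rowP => i; under eq_fun do rewrite mxE.
by apply: measurable_funD => //; exact: measurable_coord.
Qed.

(** Induction on the dimension. The shift splits along [consv] into a shift of the first coordinate
    and one of the others, and a product measure is determined by its values on rectangles. *)
Lemma leb_shift n (v : 'rV[R]_n) (A : set (borel R n)) : measurable A ->
  leb R n ((fun x => x + v) @^-1` A) = leb R n A.
Proof.
elim: n v A => [|n IH] v A mA.
  by rewrite (_ : _ @^-1` _ = A)//; apply/funext => x /=; congr A; rewrite [v]thinmx0 addr0.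
pose v' : 'rV[R]_n := \row_i v ord0 (lift ord0 i).
pose s (p : measurableTypeR R * borel R n) : measurableTypeR R * borel R n :=
  (p.1 + v ord0 ord0, (p.2 : 'rV[R]_n) + v').
have ms : measurable_fun setT s.
  apply/measurable_fun_pairP; split; rewrite /comp /=.
    by apply: measurable_funD => //; exact: measurable_fst.
  exact: (measurableT_comp (measurable_rv_shift v') measurable_snd).
have mC : measurable (@consv R n @^-1` A).
  by rewrite -[X in measurable X]setTI; exact: measurable_consv.
rewrite /= /lebS /pushforward.
rewrite [RHS](product_measure_unique
  (m' := pushforward (@lebesgue_measure R \x leb R n)%E (mfun_of ms)))//.
  rewrite /pushforward /=; congr (product_measure1 _ _ _).
  apply/funext => -[x y] /=; congr A; apply/rowP => i; rewrite !mxE.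
  by case: unliftP => [j ->|->] /=; rewrite ?mxE.
move=> B C mB mC'; rewrite [LHS]/=/pushforward.
rewrite (_ : s @^-1` _ = ((fun x => x + v ord0 ord0) @^-1` B) `*`
  ((fun x : borel R n => (x : 'rV_n) + v' : borel R n) @^-1` C)).
  rewrite product_measure1E//=; last 2 first.
  - rewrite -[X in measurable X]setTI; apply: measurable_funD => //; exact: measurable_id.
  - by rewrite -[X in measurable X]setTI; apply: measurable_rv_shift.
  by rewrite IH// lebesgue_measure_shift.
by apply/funext => -[x y].
Qed.

Lemma ge0_integral_shift n (v : 'rV[R]_n) (f : borel R n -> \bar R) :
  measurable_fun setT f -> (forall x, 0 <= f x)%E ->
  (\int[leb R n]_x f ((x : 'rV_n) + v)%R = \int[leb R n]_x f x)%E.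
Proof.
move=> mf f0.
rewrite [RHS](eq_measure_integral (pushforward (leb R n) (mfun_of (measurable_rv_shift v)))).
  by rewrite (ge0_integral_pushforward (measurable_rv_shift v))// preimage_setT.
by move=> A mA _; rewrite [RHS]/=/pushforward leb_shift.
Qed.

End leb_shift.

(** * Invariance of Lebesgue measure under isometries *)

Section leb_linear.
Context {R : realType}.

Lemma measurable_rv_add n : measurable_fun setT
  (fun p : borel R n * borel R n => (p.1 : 'rV[R]_n) + p.2 : borel R n).
Proof.
apply: measurable_rowP => i; under eq_fun do rewrite mxE.
by apply: measurable_funD => //;
  apply: (measurableT_comp (@measurable_coord R n i)).
Qed.

Lemma measurable_rv_mulmx n p (A : 'M[R]_(n, p)) :
  measurable_fun setT ((fun x : 'rV[R]_n => x *m A) : borel R n -> borel R p).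
Proof.
apply: measurable_rowP => i; under eq_fun do rewrite mxE.
apply: measurable_sum => k; apply: measurable_funM => //.
exact: measurable_coord.
Qed.

(** The sup-norm ball about 0. Unlike a Euclidean ball it is a product, so its measure is
    explicit. *)
Definition cube n (r : R) : set 'rV[R]_n := [set x | forall i, `|x ord0 i| < r].
Arguments cube : clear implicits.

Lemma cube_measurable n r : 0 < r -> measurable (cube n r : set (borel R n)).
Proof.
move=> r0; apply: open_borel; rewrite (_ : cube n r = ball 0 r); first exact: ball_open.
apply/seteqP; split => [x xr|x [_ xr] i].
  split => // i j; rewrite (ord1 i) /ball/= mxE sub0r normrN; exact: xr.
by have := xr ord0 i; rewrite /ball/= mxE sub0r normrN.
Qed.

Lemma leb_cube n r : 0 < r -> leb R n (cube n r) = ((2 * r) ^+ n)%:E.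
Proof.
move=> r0; elim: n => [|n IH].
  by rewrite /= diracE expr0 mem_set// => -[].
rewrite /= /lebS /pushforward (_ : _ @^-1` _ = `]-r, r[%classic `*` cube n r).
  rewrite product_measure1E//; last exact: cube_measurable.
  rewrite IH /= lebesgue_measure_itv/= lte_fin gtrN// -EFinM exprS.
  by rewrite opprK mulr_natl mulr2n.
apply/seteqP; split => -[x v] /=.
  move=> xv; rewrite in_itv/= -ltr_norml; split.
    by have := xv ord0; rewrite mxE unlift_none.
  by move=> i; have := xv (lift ord0 i); rewrite mxE liftK.
move=> -[]; rewrite in_itv/= -ltr_norml => xr vr i; rewrite mxE.
by case: unliftP => [j _|_] //=; exact: vr.
Qed.

Lemma measurable_preimageT d1 d2 (T1 : measurableType d1) (T2 : measurableType d2)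
    (f : T1 -> T2) (C : set T2) :
  measurable_fun setT f -> measurable C -> measurable (f @^-1` C).
Proof. by move=> mf mC; rewrite -[X in measurable X]setTI; exact: mf. Qed.

(** Both sides are measures of [A] that agree on rectangles. *)
Lemma integral_section_swap d1 d2 (T1 : measurableType d1) (T2 : measurableType d2)
    (m1 : {sigma_finite_measure set T1 -> \bar R})
    (m2 : {sigma_finite_measure set T2 -> \bar R}) (A : set (T1 * T2)) :
  measurable A ->
  (\int[m1]_x m2 (xsection A x) = \int[m2]_y m1 (ysection A y))%E.
Proof.
move=> mA; apply: (product_measure_unique (m' := (m1 \x^ m2)%E)) => // B C mB mC.
exact: product_measure2E.
Qed.

Lemma measurable_rvN n :
  measurable_fun setT (fun x : borel R n => - (x : 'rV_n) : borel R n).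
Proof.
apply: measurable_rowP => i; under eq_fun do rewrite mxE.
by apply: measurableT_comp => //; exact: measurable_coord.
Qed.

(* Both sides are the measure of a subset of R^n x R^n, computed with the two
   orders of integration. *)
Lemma leb_linear_swap n (T T' : 'M[R]_n) (A B : set (borel R n)) :
  T' *m T = 1%:M -> measurable A -> measurable B ->
  (leb R n ((fun x : 'rV_n => x *m T) @^-1` A) * leb R n B =
   leb R n ((fun x : 'rV_n => x *m T) @^-1` B) * leb R n ((fun x : 'rV_n => - x)%R @^-1` A))%E.
Proof.
move=> TT mA mB.
pose E := [set p : borel R n * borel R n |
  A ((p.1 : 'rV_n) *m T) /\ B ((p.1 : 'rV_n) *m T + p.2)].
pose E' := [set p : borel R n * borel R n |
  A ((p.1 : 'rV_n) *m T - p.2) /\ B ((p.1 : 'rV_n) *m T)].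
have mT := measurable_rv_mulmx T.
have mT1 : measurable_fun setT
    (fun p : borel R n * borel R n => (p.1 : 'rV_n) *m T : borel R n).
  exact: measurableT_comp mT measurable_fst.
have mE : measurable E.
  apply: measurableI; first exact: (measurable_preimageT mT1).
  have := @measurable_preimageT _ _ _ _ _ B (measurableT_comp
    (@measurable_rv_add n) (measurable_fun_pair mT1 measurable_snd)) mB.
  exact.
have mE' : measurable E'.
  apply: measurableI; last exact: (measurable_preimageT mT1).
  have := @measurable_preimageT _ _ _ _ _ A (measurableT_comp
    (@measurable_rv_add n) (measurable_fun_pair mT1
      (measurableT_comp (@measurable_rvN n) measurable_snd))) mA.
  exact.
have mTA := measurable_preimageT mT mA.
have mTB := measurable_preimageT mT mB.
transitivity (\int[leb R n]_x leb R n (xsection E x))%E.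
  rewrite -(setIT (_ @^-1` A)) -integral_indic// muleC -ge0_integralZl//; last first.
    by apply/measurable_EFinP; exact: measurable_indic.
  apply: eq_integral => x _; rewrite indicE.
  have [xA|xA] := asboolP (A ((x : 'rV_n) *m T)).
    rewrite mem_set// mule1 -(@leb_shift R n ((x : 'rV_n) *m T))//.
    congr (leb R n _); apply/funext => y; apply/propext.
    by rewrite /xsection /= in_setE /E/= addrC; split => // -[].
  rewrite memNset// mule0 (_ : xsection _ _ = set0) ?measure0//.
  by rewrite -subset0 => y; rewrite /xsection /= in_setE => -[].
rewrite integral_section_swap//.
transitivity (\int[leb R n]_y leb R n (ysection E' y))%E.
  (* Since [T' *m T = 1%:M], shifting [x] by [y *m T'] adds [y] to [x *m T]; this carries the
     section of [E] onto that of [E']. *)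
  apply: eq_integral => y _.
  rewrite -[RHS](@leb_shift R n ((y : 'rV_n) *m T')); last exact: measurable_ysection.
  congr (leb R n _); apply/funext => x; apply/propext.
  by rewrite /ysection /= !in_setE /E /E' /= mulmxDl -mulmxA TT mulmx1 addrK.
rewrite -integral_section_swap//.
rewrite -(setIT (_ @^-1` B)) -integral_indic// muleC -ge0_integralZl//; last first.
  by apply/measurable_EFinP; exact: measurable_indic.
apply: eq_integral => x _; rewrite indicE.
have [xB|xB] := asboolP (B ((x : 'rV_n) *m T)).
  rewrite mem_set// mule1 -[RHS](@leb_shift R n (- ((x : 'rV_n) *m T))); last first.
    exact: (measurable_preimageT (@measurable_rvN n)).
  congr (leb R n _); apply/funext => y; apply/propext.
  by rewrite /xsection /= in_setE /E'/= opprB; split => // -[].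
rewrite memNset// mule0 (_ : xsection _ _ = set0) ?measure0//.
by rewrite -subset0 => y; rewrite /xsection /= in_setE => -[].
Qed.

(** It has two roles: a set of positive finite measure fixed by isometries, and the sample space of
    the directions [e]. *)
Definition fball n : set 'rV[R]_n := [set x | frob x < 1].
Arguments fball : clear implicits.

Lemma measurable_frob d (T : measurableType d) p q (f : T -> 'M[R]_(p, q)) :
  (forall i j, measurable_fun setT (fun x => f x i j)) ->
  measurable_fun setT (fun x => frob (f x)).
Proof.
move=> mf; apply: (measurableT_comp (continuous_measurable_fun (@sqrt_continuous R))).
apply: measurable_sum => i; apply: measurable_sum => j.
exact: measurable_funX.
Qed.

Lemma fball_measurable n : measurable (fball n : set (borel R n)).
Proof.
rewrite (_ : fball n = (fun x : borel R n => frob (x : 'rV_n)) @^-1` `]-oo, 1[).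
  apply: measurable_preimageT => //; apply: measurable_frob => i j.
  by rewrite (ord1 i); exact: measurable_coord.
by apply/seteqP; split => x /=; rewrite in_itv.
Qed.

Lemma leb_fball_gt0 n : (0 < leb R n (fball n))%E.
Proof.
have r0 : 0 < (n.+1%:R : R)^-1 by rewrite invr_gt0.
apply: (@lt_le_trans _ _ (leb R n (cube n n.+1%:R^-1))).
  by rewrite leb_cube// lte_fin exprn_gt0// mulr_gt0.
apply: le_measure; rewrite ?inE//; first exact: cube_measurable.
  exact: fball_measurable.
move=> x xr; rewrite /fball/=.
have : frob x <= (1 * n)%:R * n.+1%:R^-1.
  by apply: frob_le_entries => i j; rewrite (ord1 i) ltW.
move/le_lt_trans; apply; rewrite mul1n ltr_pdivrMr// mul1r ltr_nat//.
Qed.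

Lemma leb_fball_lty n : (leb R n (fball n) < +oo)%E.
Proof.
apply: (@le_lt_trans _ _ (leb R n (cube n 1))); last by rewrite leb_cube ?ltry.
apply: le_measure; rewrite ?inE//; first exact: fball_measurable.
  exact: cube_measurable.
by move=> x x1 i; rewrite (le_lt_trans (entry_le_frob _ _ _)).
Qed.

Lemma pmule_injl (x y : \bar R) r : 0 < r -> (r%:E * x = r%:E * y)%E -> x = y.
Proof. by move=> r0 /eqP; rewrite eq_le !lee_pmul2l ?lte_fin// -eq_le => /eqP. Qed.

(** The case where [T] is the identity in [leb_linear_swap]; the measure of the ball cancels. *)
Lemma lebN n (A : set (borel R n)) : measurable A ->
  leb R n ((fun x : 'rV_n => - x) @^-1` A) = leb R n A.
Proof.
move=> mA; have := @leb_linear_swap n 1%:M 1%:M A _ (mulmx1 _) mA (@fball_measurable n).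
have e (C : set 'rV[R]_n) : (fun x : 'rV_n => x *m 1%:M) @^-1` C = C.
  by apply/funext => x; rewrite /preimage/= mulmx1.
rewrite [X in (leb R n X * _)%E]e [X in (_ = leb R n X * _)%E]e muleC => /esym.
have := leb_fball_gt0 n; have := leb_fball_lty n.
move: (leb R n (fball n)) => [r| |]//= _; rewrite lte_fin => r0.
exact: (pmule_injl r0).
Qed.

(** An isometry fixes the ball, so with the ball for [B] both sides of [leb_linear_swap] carry the
    same finite positive factor. *)
Lemma leb_isometry n (T T' : 'M[R]_n) (A : set (borel R n)) :
  T' *m T = 1%:M -> (forall x : 'rV_n, frob (x *m T) = frob x) -> measurable A ->
  leb R n ((fun x : 'rV_n => x *m T) @^-1` A) = leb R n A.
Proof.
move=> TT Tf mA; have := leb_linear_swap TT mA (@fball_measurable n).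
rewrite lebN// (_ : (fun x : 'rV_n => x *m T) @^-1` fball n = fball n); last first.
  by apply/funext => x; rewrite /fball /preimage/= Tf.
rewrite muleC.
have := leb_fball_gt0 n; have := leb_fball_lty n.
move: (leb R n (fball n)) => [r| |]//= _; rewrite lte_fin => r0.
exact: (pmule_injl r0).
Qed.

End leb_linear.

Arguments cube : clear implicits.
Arguments fball : clear implicits.

Section reflection.
Context {R : realType} {n : nat}.
Implicit Types x y v a b : 'rV[R]_n.

(** For a unit vector [v], the Householder reflection in the hyperplane orthogonal to [v].
    Reflections are the only isometries used below. *)
Definition refl v x := x - (2 * mxdot x v) *: v.

Lemma refl_mulmx v x : x *m (1%:M - 2 *: (v^T *m v)) = refl v x.
Proof.
rewrite mulmxBr mulmx1 -scalemxAr mulmxA /refl -scalerA; congr (_ - _ *: _).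
rewrite [x *m _]mx11_scalar mul_scalar_mx; congr (_ *: _).
by rewrite mxE mxdotE; apply: eq_bigr => i _; rewrite mxE.
Qed.

Lemma mxdot_refl v x y : mxdot (refl v x) y = mxdot x (refl v y).
Proof.
rewrite /refl mxdotDl mxdotDr mxdotNl mxdotNr mxdotZl mxdotZr (mxdotC v y).
by congr (_ - _); ring.
Qed.

Lemma reflK v : frob v = 1 -> involutive (refl v).
Proof.
move=> v1 x; rewrite {1}/refl /refl mxdotDl mxdotNl mxdotZl mxdotAA v1.
by rewrite -addrA -opprD -scalerDl [X in X *: _](_ : _ = 0) ?scale0r ?subr0//; ring.
Qed.

Lemma frob_refl v x : frob v = 1 -> frob (refl v x) = frob x.
Proof. by move=> v1; rewrite !frobE mxdot_refl reflK. Qed.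

Lemma leb_refl v (A : set (borel R n)) : frob v = 1 -> measurable A ->
  leb R n ((refl v : 'rV_n -> 'rV_n) @^-1` A) = leb R n A.
Proof.
move=> v1 mA; rewrite -(_ : mulmx^~ (1%:M - 2 *: (v^T *m v)) = refl v); last first.
  by apply/funext => x; exact: refl_mulmx.
apply: (@leb_isometry _ _ _ (1%:M - 2 *: (v^T *m v))) => //.
  apply/row_matrixP => i.
  by rewrite -{1}[1%:M - _]mul1mx !row_mul !refl_mulmx reflK.
by move=> x; rewrite refl_mulmx frob_refl.
Qed.

Lemma measurable_mxdotl a :
  measurable_fun setT (fun x : borel R n => mxdot (x : 'rV_n) a).
Proof.
under eq_fun do rewrite mxdotE.
apply: measurable_sum => i; apply: measurable_funM => //.
exact: measurable_coord.
Qed.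

Lemma hyperplane_measurable a :
  measurable ([set x | mxdot x a = 0] : set (borel R n)).
Proof.
rewrite (_ : [set _ | _] = (fun x : borel R n => mxdot (x : 'rV_n) a) @^-1` [set 0])//.
exact: (measurable_preimageT (measurable_mxdotl a)).
Qed.

(** The mirror is the bisecting hyperplane, with normal [v = (a - b) / frob (a - b)]. For unit
    vectors [2 * mxdot a (a - b) = frob (a - b) ^+ 2], so the reflection subtracts exactly [a - b]
    from [a]. *)
Lemma reflP a b : frob a = 1 -> frob b = 1 -> a != b ->
  exists2 v, frob v = 1 & refl v a = b.
Proof.
move=> a1 b1 ab; pose c := frob (a - b).
have c0 : c != 0 by rewrite frob_eq0 subr_eq0.
exists (c^-1 *: (a - b)).
  by rewrite frobZ ger0_norm ?invr_ge0 ?frob_ge0// mulVf.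
have cE : c ^+ 2 = 2 * (1 - mxdot a b).
  rewrite /c -mxdotAA mxdotDl !mxdotDr !(mxdotNl,mxdotNr) !mxdotAA a1 b1.
  by rewrite (mxdotC b a); ring.
rewrite /refl mxdotZr scalerA mxdotDr mxdotNr mxdotAA a1 expr1n.
rewrite (_ : _ * _ = 1) ?scale1r ?subKr//.
by rewrite mulrCA -cE expr2 mulrA mulVf// mul1r divff.
Qed.

End reflection.

Section hyperplane.
Context {R : realType} {n : nat}.

(** A reflection exchanges [a] with the first basis vector, whose orthogonal hyperplane is, in the
    product that defines [leb], a point times the whole space. *)
Lemma leb_hyperplane (a : 'rV[R]_n) : frob a = 1 ->
  leb R n [set x | mxdot x a = 0] = 0%E.
Proof.
case: n a => [|m] a a1.
  by move: a1; rewrite [a]thinmx0 frob0 => /esym/eqP; rewrite oner_eq0.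
have d1 : frob (delta_mx ord0 ord0 : 'rV[R]_m.+1) = 1 by exact: frob_delta.
have dx (x : 'rV[R]_m.+1) : mxdot x (delta_mx ord0 ord0) = x ord0 ord0.
  rewrite mxdotE (bigD1 ord0)//= mxE !eqxx mulr1 big1 ?addr0// => i i0.
  by rewrite mxE (negbTE i0) andbF mulr0.
have h0 : leb R m.+1 [set x | mxdot x (delta_mx ord0 ord0) = 0] = 0%E.
  rewrite /= /lebS /pushforward (_ : _ @^-1` _ = [set 0] `*` setT).
    by rewrite product_measure1E//= lebesgue_measure_set1 mul0e.
  by apply/seteqP; split => -[x v] /=; rewrite dx mxE unlift_none//= => -[].
have [->//|ad] := eqVneq a (delta_mx ord0 ord0).
rewrite eq_sym in ad; have [v v1 <-] := reflP d1 a1 ad.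
rewrite -[RHS]h0 -[RHS](leb_refl v1); last exact: hyperplane_measurable.
by congr (leb R _ _); apply/funext => x; rewrite /preimage/= mxdot_refl.
Qed.

End hyperplane.

(** * Random choice of signs *)

Section separation.
Context {R : realType} {n : nat}.
Implicit Types a b e : 'rV[R]_n.
Local Notation leb := (leb R n).
Local Notation B := (fball R n).

Definition sepset a b : set (borel R n) :=
  [set e | mxdot (e : 'rV_n) a * mxdot (e : 'rV_n) b < 0].

Lemma sepset_measurable a b : measurable (sepset a b).
Proof.
rewrite (_ : sepset a b =
    (fun e : borel R n => mxdot (e : 'rV_n) a * mxdot (e : 'rV_n) b) @^-1` `]-oo, 0[).
  apply: measurable_preimageT => //.
  by apply: measurable_funM; exact: measurable_mxdotl.
by apply/seteqP; split => x /=; rewrite in_itv.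
Qed.

Definition ballM : R := fine (leb B).
(** Divided by [ballM], the probability that a random [e] gives [a] and [b] opposite signs. The
    bound by [theta / pi] comes from the comparison rules that follow. *)
Definition sep a b : R := fine (leb (B `&` sepset a b)).

Let mBsep a b : measurable (B `&` sepset a b : set (borel R n)).
Proof. by apply: measurableI; [exact: fball_measurable|exact: sepset_measurable]. Qed.

Lemma ballM_gt0 : 0 < ballM.
Proof. by rewrite fine_gt0// leb_fball_gt0 leb_fball_lty. Qed.

Lemma ballME : leb B = ballM%:E.
Proof. by rewrite fineK// ge0_fin_numE ?leb_fball_lty// ltW// leb_fball_gt0. Qed.

Lemma sepE a b : leb (B `&` sepset a b) = (sep a b)%:E.
Proof.
rewrite fineK// ge0_fin_numE//; apply: le_lt_trans (leb_fball_lty n).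
by apply: le_measure; rewrite ?inE//; exact: fball_measurable.
Qed.

Lemma sep_ge0 a b : 0 <= sep a b.
Proof. by rewrite -lee_fin -sepE. Qed.

Lemma sepC a b : sep a b = sep b a.
Proof.
rewrite /sep; congr (fine (leb (_ `&` _))).
by apply/funext => e; rewrite /sepset/= mulrC.
Qed.

Lemma sepNN a b : sep (- a) (- b) = sep a b.
Proof.
rewrite /sep; congr (fine (leb (_ `&` _))).
by apply/funext => e; rewrite /sepset/= !mxdotNr mulrNN.
Qed.

Lemma sep_refl v a b : frob v = 1 -> sep (refl v a) (refl v b) = sep a b.
Proof.
move=> v1; rewrite /sep -(leb_refl v1 (mBsep a b)); congr (fine (leb _)).
apply/funext => e; rewrite /sepset/fball /preimage /setI/=.
by rewrite frob_refl// !mxdot_refl.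
Qed.

Let hyp_null a : frob a = 1 -> leb (B `&` [set e | mxdot e a = 0]) = 0%E.
Proof.
move=> a1; apply/eqP; rewrite eq_le measure_ge0 andbT -(leb_hyperplane a1).
apply: le_measure; rewrite ?inE//; last exact: hyperplane_measurable.
by apply: measurableI; [exact: fball_measurable|exact: hyperplane_measurable].
Qed.

Lemma sepaa a : sep a a = 0.
Proof.
rewrite /sep (_ : sepset _ _ = set0) ?setI0 ?measure0//.
by rewrite -subset0 => e; rewrite /sepset/= -expr2 ltNge sqr_ge0.
Qed.

(** If [e] separates [a] from [c], the sign of [mxdot e b] disagrees with one of the other two,
    unless [e] is orthogonal to [b], which happens on a null set. *)
Lemma sep_triangle a b c : frob b = 1 -> sep a c <= sep a b + sep b c.
Proof.
move=> b1; rewrite -lee_fin EFinD -!sepE -[leRHS]adde0 -(hyp_null b1).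
have mh := measurableI _ _ (@fball_measurable R n) (hyperplane_measurable b).
apply: (@le_trans _ _ (leb ((B `&` sepset a b) `|` (B `&` sepset b c) `|` (B `&` [set e | mxdot e b = 0])))).
  apply: le_measure; rewrite ?inE//; first by do 2?apply: measurableU.
  move=> e [eB]; rewrite /sepset/= => ac; have [b0|b0] := eqVneq (mxdot e b) 0.
    by right.
  left; have [ab|ab] := ltP (mxdot e a * mxdot e b) 0; [by left|right; split => //].
  have b2 : 0 < mxdot e b ^+ 2 by rewrite exprn_even_gt0.
  nra.
apply: (le_trans (measureU2 _ _ _)) => //; first exact: measurableU.
by apply: leeD => //; exact: measureU2.
Qed.

(** No [e] separates [b] from both [a] and [- a], so the two events are disjoint parts of the
    ball. *)
Lemma sep_opp a b : sep a b + sep b (- a) <= ballM.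
Proof.
rewrite -lee_fin EFinD -!sepE -ballME -measureU//.
  apply: le_measure; rewrite ?inE//; first exact: measurableU.
    exact: fball_measurable.
  by move=> e [|] [].
rewrite -subset0 => e [[_ +] [_]]; rewrite /sepset/= mxdotNr; lra.
Qed.

Let convex_lt0 (x y z r s t : R) : 0 < r -> 0 <= s -> 0 <= t ->
  r * y = s * x + t * z -> x * y < 0 -> x * z < 0.
Proof.
move=> r0 s0 t0 yE xy; rewrite ltNge; apply/negP => xz.
have : r * (x * y) < 0 by rewrite pmulr_rlt0.
have -> : r * (x * y) = s * x ^+ 2 + t * (x * z) by rewrite mulrCA yE; ring.
by rewrite ltNge addr_ge0// mulr_ge0// sqr_ge0.
Qed.

Let convex_contra (x y z r s t : R) : 0 < r -> 0 <= s -> 0 <= t ->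
  r * y = s * x + t * z -> x * y < 0 -> y * z < 0 -> False.
Proof.
move=> r0 s0 t0 yE xy yz; have : r * y ^+ 2 <= 0.
  have -> : r * y ^+ 2 = s * (x * y) + t * (y * z) by rewrite expr2 mulrCA yE; ring.
  by rewrite -oppr_ge0 opprD addr_ge0// -mulrN mulr_ge0// oppr_ge0 ltW.
rewrite pmulr_rle0// => y2; have /eqP : y ^+ 2 = 0.
  by apply/eqP; rewrite eq_le y2 sqr_ge0.
by rewrite sqrf_eq0 => /eqP y0; move: xy; rewrite y0 mulr0 ltxx.
Qed.

(** When [b] lies in the cone spanned by [a] and [c], an [e] that separates [b] from one of them
    separates [a] from [c], and it cannot separate [b] from both. This reverses [sep_triangle]. *)
Lemma sep_add a b c (r s t : R) : 0 < r -> 0 <= s -> 0 <= t ->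
  r *: b = s *: a + t *: c -> sep a b + sep b c <= sep a c.
Proof.
move=> r0 s0 t0 bE; rewrite -lee_fin EFinD -!sepE.
have eE e : r * mxdot e b = s * mxdot e a + t * mxdot e c.
  by rewrite -!mxdotZr bE mxdotDr.
rewrite -measureU//.
  apply: le_measure; rewrite ?inE//; first exact: measurableU.
  move=> e [] [eB]; rewrite /sepset/= => h; split => //=.
    exact: convex_lt0 (eE e) h.
  rewrite mulrC; apply: (convex_lt0 r0 t0 s0 _ (_ : _ * mxdot e b < 0)).
    by rewrite eE addrC.
  by rewrite mulrC.
rewrite -subset0 => e [[_ +] [_]]; rewrite /sepset/=.
exact: convex_contra (eE e).
Qed.

End separation.

Arguments ballM : clear implicits.

(** * Separation along a great circle *)

Section circle.
Context {R : realType} {n : nat}.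
Variables a b : 'rV[R]_n.
Hypotheses (a1 : frob a = 1) (b1 : frob b = 1) (ab : mxdot a b = 0).
Local Notation c := (ballM R n).

Let g (t : R) := cos t *: a + sin t *: b.

Let mxdot_g s t : mxdot (g s) (g t) = cos (s - t).
Proof.
rewrite /g !(mxdotDl, mxdotDr, mxdotZl, mxdotZr) !mxdotAA a1 b1 (mxdotC b a) ab.
by rewrite cosB; ring.
Qed.

Let frob_g t : frob (g t) = 1.
Proof. by rewrite frobE mxdot_g subrr cos0 sqrtr1. Qed.

Let refl_g s t : refl (g t) (g s) = - g (2 * t - s).
Proof.
rewrite /refl mxdot_g /g scalerDr !scalerA opprD addrACA -!scalerBl opprD.
rewrite -(scaleNr _ a) -(scaleNr _ b).
have [u ->] : exists u, s = t - u by exists (t - s); rewrite opprB addrC subrK.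
rewrite (_ : 2 * t - (t - u) = t + u); last by ring.
rewrite (_ : t - u - t = - u) ?cosN; last by ring.
congr (_ *: _ + _ *: _).
  by rewrite cosB cosD; ring.
by rewrite sinB sinD; ring.
Qed.

(** A single reflection is enough: in the hyperplane orthogonal to the point at angle
    [(s + t + h) / 2], it sends [g s] to [- g (t + h)] and [g t] to [- g (s + h)], and [sep] is
    symmetric and even. *)
Let sep_rot s t h : sep (g (s + h)) (g (t + h)) = sep (g s) (g t).
Proof.
rewrite -(sep_refl (g s) (g t) (frob_g (2^-1 * (s + t + h)))) !refl_g sepNN.
by rewrite [RHS]sepC; congr (sep (g _) (g _)); field.
Qed.

Let f t := sep (g 0) (g t).

Let fD s t : f (s + t) <= f s + f t.
Proof.
rewrite /f (le_trans (sep_triangle _ _ (frob_g s)))// lerD2l.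
by rewrite -(sep_rot 0 t s) add0r addrC.
Qed.

(** Below [pi] the intermediate point of an arc lies in the cone of its ends, with sines as
    coefficients, so [sep_add] applies. With [fD], this makes [f] additive on arcs shorter than
    [pi]. *)
Let fD_ge s t : 0 <= s -> 0 <= t -> 0 < s + t < pi -> f s + f t <= f (s + t).
Proof.
move=> s0 t0 /andP[st0 stpi]; rewrite {2}/f -(sep_rot 0 t s) add0r (addrC t).
have hs : 0 <= sin s by apply: sin_ge0_pi; rewrite s0/=; lra.
have ht : 0 <= sin t by apply: sin_ge0_pi; rewrite t0/=; lra.
have hst : 0 < sin (s + t) by apply: sin_gt0_pi; rewrite st0.
apply: (sep_add hst ht hs).
rewrite /g !scalerDr !scalerA addrACA -!scalerDl cos0 sin0; congr (_ *: _ + _ *: _).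
  by rewrite -(cos2Dsin2 s) sinD cosD; ring.
by rewrite sinD; ring.
Qed.

Let f0 : f 0 = 0.
Proof. exact: sepaa. Qed.

Let f_muln_le k t : f (k%:R * t) <= k%:R * f t.
Proof.
elim: k => [|k IH]; first by rewrite !mul0r f0.
by rewrite -natr1 !mulrDl !mul1r (le_trans (fD _ _))// lerD2r.
Qed.

Let f_muln_ge k t : 0 < t -> k.+1%:R * t < pi -> k.+1%:R * f t <= f (k.+1%:R * t).
Proof.
move=> t0; elim: k => [|k IH] kt; first by rewrite !mul1r.
rewrite -[k.+2%:R]natr1 !mulrDl !mul1r in kt *.
have kt0 : 0 <= k.+1%:R * t by rewrite mulr_ge0// ltW.
rewrite (le_trans _ (fD_ge kt0 (ltW t0) _))//; last first.
  by rewrite kt andbT ltr_wpDl.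
by rewrite lerD2r IH//; lra.
Qed.

(** Cut the half circle into [m.+2] equal arcs. The first [m.+1] stay below [pi], where [f] is
    superadditive; the last one is added by [sep_opp], because [g pi = - g 0], and the total is at
    most the whole ball. *)
Let f_pi_div m : f (pi / m.+2%:R) <= c / m.+2%:R.
Proof.
set t := pi / m.+2%:R.
have m0 : 0 < m.+2%:R :> R by [].
have t0 : 0 < t by rewrite divr_gt0// pi_gt0.
have mt : m.+1%:R * t = pi - t.
  by apply/eqP; rewrite eq_sym subr_eq -[X in _ == _ + X]mul1r -mulrDl natr1 /t mulrCA divff ?mulr1// gt_eqF.
rewrite ler_pdivlMr// mulrC -natr1 mulrDl mul1r.
have h := f_muln_ge t0 (_ : m.+1%:R * t < pi).
rewrite (le_trans (_ : _ <= f (m.+1%:R * t) + f t))//.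
  by rewrite lerD2r h// mt gtrBl.
rewrite mt (le_trans _ (sep_opp (g 0) (g (pi - t))))// lerD2l.
have -> : - g 0 = g pi.
  by rewrite /g cospi sinpi cos0 sin0 !scale0r !addr0 scale1r scaleN1r.
by rewrite /f -(sep_rot 0 t (pi - t)) add0r (addrC t) subrK.
Qed.

Lemma sep_circle_le (t : R) : 0 <= t < pi ->
  sep a (cos t *: a + sin t *: b) <= c * (t / pi).
Proof.
move=> /andP[t0 tpi].
have -> : sep a (cos t *: a + sin t *: b) = f t.
  by rewrite /f {1}/g cos0 sin0 scale1r scale0r addr0.
(* The angle is measured in steps of [pi / m.+2%:R]. The incomplete last step costs the error
   [c / m.+2%:R], which vanishes as [m] grows. *)
suff H m : f t <= c * (t / pi) + c / m.+2%:R.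
  apply/ler_addgt0Pr => e e0; have := H (Num.bound (c / e)).
  move/le_trans; apply; rewrite lerD2l ler_pdivrMr//.
  rewrite -ler_pdivrMl// mulrC (le_trans (ltW (archi_boundP _)))//.
    by rewrite divr_ge0// ltW// ballM_gt0.
  by rewrite ler_nat -addn2 leq_addr.
pose u : R := pi / m.+2%:R.
have u0 : 0 < u by rewrite divr_gt0// pi_gt0.
pose k := Num.trunc (t / u).
have ku : k%:R * u <= t by rewrite -ler_pdivlMr// truncn_le divr_ge0// ltW.
have tk : t < k.+1%:R * u by rewrite -ltr_pdivrMr// truncnS_gt.
have r0 : 0 <= t - k%:R * u by rewrite subr_ge0.
have fr : f (t - k%:R * u) <= f u.
  have ur : 0 <= u - (t - k%:R * u).
    by move: tk; rewrite -natr1 mulrDl mul1r => tk; lra.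
  have upi : u < pi by rewrite ltr_pdivrMr// ltr_pMr ?pi_gt0// ltr1n.
  have := fD_ge r0 ur; rewrite addrC subrK u0 upi => /(_ isT).
  by apply: le_trans; rewrite lerDl sep_ge0.
have := fD (k%:R * u) (t - k%:R * u); rewrite addrC subrK => /le_trans; apply.
have fu := f_pi_div m; have c0 := @ballM_gt0 R n.
apply: (@le_trans _ _ ((k%:R + 1) * (c / m.+2%:R))).
  rewrite mulrDl mul1r lerD// ?(le_trans fr)//.
  by rewrite (le_trans (f_muln_le _ _))// ler_wpM2l.
rewrite mulrDl mul1r lerD2r mulrCA ler_wpM2l ?(ltW c0)//.
rewrite ler_pdivlMr ?pi_gt0// mulrAC ler_pdivrMr//.
by move: ku; rewrite /u mulrA ler_pdivrMr.
Qed.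

End circle.

(** * The trigonometric inequality that yields the constant *)

Section trig.
Context {R : realType}.

(** This is [h <= tan h] without a quotient: [sin x - x * cos x] vanishes at 0 and has derivative
    [x * sin x]. *)
Let tan_ge (h : R) : 0 <= h <= pi / 4 -> h * cos h <= sin h.
Proof.
move=> /andP[h0 h4]; have pi0 := pi_gt0 R.
have [->|hn0] := eqVneq h 0; first by rewrite mul0r sin0.
have hp : 0 < h by rewrite lt_neqAle eq_sym hn0.
have df x : x \in `]0, h[ -> is_derive x 1 (fun x => sin x - x * cos x) (x * sin x).
  move=> _; apply: is_derive_eq; rewrite /GRing.scale/=; ring.
have cf : {within `[0, h], continuous (fun x : R => sin x - x * cos x)}.
  apply: continuous_subspaceT => x; apply: cvgB; first exact: continuous_sin.
  by apply: cvgM; [exact: cvg_id|exact: continuous_cos].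
have [x xh] := MVT hp df cf.
rewrite sin0 mul0r !subr0 => e; rewrite -subr_ge0 e mulr_ge0//.
move: xh; rewrite in_itv/= => /andP[x0 xh].
by rewrite mulr_ge0 ?(ltW x0)// sin_ge0_pi// (ltW x0)/=; lra.
Qed.

(** Unit vectors at angle [t] are at distance [p = 2 sin (t / 2)], or [q = 2 cos (t / 2)] after a
    change of sign, which has probability at most [t / pi]; [sin t] is the distance of their lines.
    Both sides are equivalent to [(1 + 2 / pi) * t] as [t] tends to 0. *)
Lemma jump_average_le (t p q : R) : 0 <= t <= pi / 2 -> 0 <= p -> 0 <= q ->
  p ^+ 2 = 2 - 2 * cos t -> q ^+ 2 = 2 + 2 * cos t ->
  p + (q - p) * (t / pi) <= (1 + 2 / pi) * sin t.
Proof.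
move=> /andP[t0 tpi] p0 q0 p2 q2; have pi0 := pi_gt0 R.
pose h := t / 2; have th : t = h + h by rewrite /h; lra.
have h0 : 0 <= h by rewrite /h; lra.
have h4 : h <= pi / 4 by rewrite /h; lra.
have s0 : 0 <= sin h by apply: sin_ge0_pi; rewrite h0/=; lra.
have c0 : 0 <= cos h by apply: cos_ge0_pihalf; apply/andP; split; lra.
have cs := cos2Dsin2 h.
have ct : cos t = cos h ^+ 2 - sin h ^+ 2 by rewrite th cosD; ring.
have st : sin t = 2 * (sin h * cos h) by rewrite th sinD; ring.
have -> : p = 2 * sin h.
  apply/eqP; rewrite -(@eqrXn2 _ 2)// ?mulr_ge0//; apply/eqP.
  by rewrite p2 ct exprMn; lra.
have -> : q = 2 * cos h.
  apply/eqP; rewrite -(@eqrXn2 _ 2)// ?mulr_ge0//; apply/eqP.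
  by rewrite q2 ct exprMn; lra.
have hs := tan_ge (introT andP (conj h0 h4)).
have sc : sin h <= cos h.
  have : 0 <= cos t.
    by apply: cos_ge0_pihalf; apply/andP; split; lra.
  rewrite ct subr_ge0 ler_pXn2r//.
(* The only numerical bound on [pi] that enters. *)
have pi4 : pi <= 4 :> R.
  by have := pihalf_02_cos_pihalf R; lra.
rewrite st; pose k : R := pi^-1.
have k4 : 1 <= 4 * k by rewrite /k -ler_pdivrMr ?invr_gt0// invrK mul1r.
have k0 : 0 < k by rewrite invr_gt0.
rewrite (_ : t / pi = 2 * h * k); last by rewrite th /k; ring.
rewrite -/k.
move: (sin h) (cos h) s0 c0 cs hs sc => s c s0 c0 cs hs sc {ct st}.
have cp : 0 < c by nra.
(* Multiplying by [c = cos h] lets [h * c <= s] eliminate the angle; what remains is polynomial in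
   [s], [c] and [k], the inverse of [pi]. *)
rewrite -(ler_pM2l cp).
have E1 : h * c * (c - s) <= s * (c - s) by rewrite ler_wpM2r// subr_ge0.
have E2 : c * s + 2 * k * (s * (c - s)) <= (1 + 2 * k) * (s * c ^+ 2) ->
  c * (2 * s + (2 * c - 2 * s) * (2 * h * k)) <= c * ((1 + 2 * k) * (2 * (s * c))).
  move=> E; have E3 : k * (h * c * (c - s)) <= k * (s * (c - s)) by rewrite ler_pM2l.
  lra.
apply: E2.
(* After division by s, since 1 - c = s^2 / (1 + c). *)
have E4 : (1 + 2 * k) * (s * c) <= 2 * k + 2 * k * c.
  have : s * c <= 2^-1 by have := sqr_ge0 (s - c); lra.
  have : s ^+ 2 <= c ^+ 2 by rewrite ler_pXn2r.
  have : c ^+ 2 <= c by nra.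
  nra.
have E5 : (1 + 2 * k) * (c * (1 - c)) <= 2 * k * s.
  have c1 : 0 < 1 + c by lra.
  rewrite -(ler_pM2r c1).
  have -> : (1 + 2 * k) * (c * (1 - c)) * (1 + c) = s * ((1 + 2 * k) * (s * c)).
    have -> : (1 + 2 * k) * (c * (1 - c)) * (1 + c) = (1 + 2 * k) * c * (1 - c ^+ 2).
      by ring.
    have -> : 1 - c ^+ 2 = s ^+ 2 by lra.
    by ring.
  rewrite (_ : 2 * k * s * (1 + c) = s * (2 * k + 2 * k * c)); last by ring.
  by rewrite ler_wpM2l.
have := ler_wpM2l s0 E5; lra.
Qed.

End trig.

(** * The representative selected by a direction, and its average cost *)

Section direction.
Context {R : realType} {n : nat}.
Implicit Types (a b e v : 'rV[R]_n) (A : 'M[R]_n).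

(** A unit default [v0] keeps the map unit-valued at the zero vector; for a well chosen direction
    this value is taken on a null set only. *)
Definition unit_of (v0 v : 'rV[R]_n) := if v == 0 then v0 else (frob v)^-1 *: v.

Lemma frob_unit_of v0 v : frob v0 = 1 -> frob (unit_of v0 v) = 1.
Proof.
move=> v01; rewrite /unit_of; case: ifPn => // v0'.
by rewrite frobZ ger0_norm ?invr_ge0 ?frob_ge0// mulVf// frob_eq0.
Qed.

Lemma mulmx_rp_embed a e :
  e *m rp_embed a = ((Num.sqrt 2)^-1 * mxdot e a) *: a.
Proof.
rewrite /rp_embed -scalemxAr mulmxA -scalerA; congr (_ *: _).
rewrite [e *m _]mx11_scalar mul_scalar_mx; congr (_ *: _).
by rewrite mxE mxdotE; apply: eq_bigr => i _; rewrite mxE.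
Qed.

Lemma rp_embedN a : rp_embed (- a) = rp_embed a.
Proof.
by apply/matrixP => i j; rewrite !mxE !big_ord1 !mxE mulrNN.
Qed.

Lemma unit_of_rp_embed v0 a e : frob a = 1 -> mxdot e a != 0 ->
  unit_of v0 (e *m rp_embed a) = Num.sg (mxdot e a) *: a.
Proof.
move=> a1 ea; rewrite mulmx_rp_embed /unit_of.
have s2 : 0 < (Num.sqrt 2 : R)^-1 by rewrite invr_gt0 sqrtr_gt0.
have a0 : a != 0 by rewrite -frob_eq0 a1 oner_eq0.
rewrite scaler_eq0 mulf_eq0 (gt_eqF s2) (negbTE ea) (negbTE a0)/=.
rewrite frobZ a1 mulr1 normrM (gtr0_norm s2) scalerA; congr (_ *: _).
rewrite invfM mulrACA mulVf ?mul1r ?gt_eqF//.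
by rewrite {2}(numEsg (mxdot e a)) mulrCA mulVf ?mulr1// normr_eq0.
Qed.

Lemma rp_embed_unit_of v0 a e : frob a = 1 -> mxdot e a != 0 ->
  rp_embed (unit_of v0 (e *m rp_embed a)) = rp_embed a.
Proof.
move=> a1 ea; rewrite unit_of_rp_embed//.
by case: sgrP ea => _ // _; rewrite ?scale1r// scaleN1r rp_embedN.
Qed.

Lemma mxdot_rp_embed a b : mxdot (rp_embed a) (rp_embed b) = 2^-1 * mxdot a b ^+ 2.
Proof.
rewrite /rp_embed mxdotZl mxdotZr mulrA -expr2 exprVn sqr_sqrtr//; congr (_ * _).
rewrite {1}/mxdot expr2 {1}mxdotE mulr_suml; apply: eq_bigr => i _.
rewrite mxdotE mulr_sumr; apply: eq_bigr => j _.
by rewrite !mxE !big_ord1 !mxE; ring.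
Qed.

Lemma measurable_unit_of d (T : measurableType d) v0 (f : T -> borel R n) :
  measurable_fun setT f ->
  measurable_fun setT (fun x => unit_of v0 (f x) : borel R n).
Proof.
move=> mf; have mfi i : measurable_fun setT (fun x => (f x : 'rV_n) ord0 i).
  exact: (measurableT_comp (@measurable_coord R n i) mf).
have mn : measurable_fun setT (fun x => frob (f x : 'rV_n)).
  by apply: measurable_frob => i j; rewrite (ord1 i).
apply: measurable_rowP => i.
(* The inverse is written as the power [-1], a function known to be measurable. *)
rewrite (_ : (fun _ => _) = fun x => if frob (f x : 'rV_n) == 0 then v0 ord0 i
    else (frob (f x : 'rV_n)) `^ (-1) * (f x : 'rV_n) ord0 i).
  apply: measurable_fun_ifT => //; last first.
    by apply: measurable_funM => //; exact: (measurableT_comp (measurable_powR _) mn).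
  by apply: measurable_fun_eqr.
apply/funext => x; rewrite /unit_of -frob_eq0; case: ifPn => // _.
by rewrite mxE powR_inv1// frob_ge0.
Qed.

Let B : set (borel R n) := fball R n.
Let mB : measurable B := @fball_measurable R n.

Lemma measurable_unit_of_mul v0 A :
  measurable_fun setT (fun e : borel R n => unit_of v0 ((e : 'rV_n) *m A) : borel R n).
Proof. by apply: measurable_unit_of; exact: measurable_rv_mulmx. Qed.

(* e separates a and b with probability theta / pi, theta being their angle. *)
Lemma average_dist_le v0 a b : frob a = 1 -> frob b = 1 ->
  (\int[leb R n]_(e in B) (frob (unit_of v0 ((e : 'rV_n) *m rp_embed a) -
                              unit_of v0 ((e : 'rV_n) *m rp_embed b))%R)%:E <=
   (ballM R n * ((1 + 2 / pi) * frob (rp_embed a - rp_embed b)%R))%:E)%E.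
Proof.
move=> a1 b1.
(* Both sides depend on [b] only through its line, which [- b] also represents, so the angle may be
   taken at most [pi / 2]. *)
wlog ab0 : b b1 / 0 <= mxdot a b.
  move=> H; have [|ab] := leP 0 (mxdot a b); first exact: H.
  by rewrite -(rp_embedN b); apply: H; rewrite ?frobN// mxdotNr oppr_ge0 ltW.
pose x := mxdot a b.
have x1 : x <= 1 by have := mxdot_le_frob a b; rewrite a1 b1 mulr1.
pose t := acos x.
have [/andP[t0 tlepi] ct] := @acos_def R x (introT andP (conj (le_trans (lerN10 R) ab0) x1)).
rewrite -/t in t0 tlepi ct; have pi0 := pi_gt0 R.
have tpi : t <= pi / 2.
  rewrite leNgt; apply/negP => h.
  have /sin_gt0_pi : 0 < t - pi / 2 < pi.
    by lra.
  by rewrite sinBpihalf oppr_gt0 ct ltNge ab0.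
pose p := frob (a - b); pose q := frob (a + b).
have p2 : p ^+ 2 = 2 - 2 * cos t.
  rewrite /p -mxdotAA mxdotDl !mxdotDr !(mxdotNl, mxdotNr) !mxdotAA a1 b1.
  by rewrite (mxdotC b a) -/x ct; ring.
have q2 : q ^+ 2 = 2 + 2 * cos t.
  rewrite /q -mxdotAA mxdotDl !mxdotDr !mxdotAA a1 b1.
  by rewrite (mxdotC b a) -/x ct; ring.
have pq : p <= q.
  rewrite -(@ler_pXn2r _ 2)// ?nnegrE ?frob_ge0// p2 q2 ct /x; lra.
(* By [mxdot_rp_embed] the squared distance is [1 - cos t ^+ 2]; the factor [1 / sqrt 2] of the
   embedding is what makes this exact. *)
have fE : frob (rp_embed a - rp_embed b) = sin t.
  rewrite frobE mxdotDl !mxdotDr !(mxdotNl, mxdotNr) !mxdot_rp_embed.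
  rewrite !mxdotAA a1 b1 (mxdotC b a) -/x -ct /t sin_acos; last first.
    by rewrite x1 (le_trans _ ab0).
  by congr Num.sqrt; rewrite -/t ct; field.
have sepab : sep a b <= ballM R n * (t / pi).
  have [st|st] := eqVneq (sin t) 0.
    have t00 : t = 0.
      apply/eqP; rewrite eq_le t0 andbT leNgt; apply/negP => tp.
      by have := @sin_gt0_pi R t; rewrite st ltxx tp/= => /(_ _)/notF; apply; lra.
    have /eqP : p = 0 by apply/eqP; rewrite -sqrf_eq0 p2 t00 cos0 mulr1 subrr.
    rewrite frob_eq0 subr_eq0 => /eqP <-; rewrite sepaa t00 mul0r mulr0//.
  (* Gram-Schmidt: [b] is the point at angle [t] on the great circle through [a] and [b']. *)
  pose b' := (sin t)^-1 *: (b - cos t *: a).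
  have ab' : mxdot a b' = 0.
    rewrite /b' mxdotZr mxdotDr mxdotNr mxdotZr mxdotAA a1 -/x ct.
    by rewrite expr1n mulr1 subrr mulr0.
  have b'1 : frob b' = 1.
    apply/eqP; rewrite -(@eqrXn2 _ 2)// ?frob_ge0// -mxdotAA expr1n /b'.
    rewrite mxdotZl mxdotZr mxdotDl !mxdotDr !(mxdotNl, mxdotNr) !(mxdotZl, mxdotZr).
    rewrite !mxdotAA a1 b1 (mxdotC b a) -/x -ct.
    have := cos2Dsin2 t; move: (cos t) (sin t) st => c s s0 cs.
    rewrite (_ : 1 ^+ 2 + _ + _ = s ^+ 2); last by lra.
    by apply/eqP; field.
  have {1}-> : b = cos t *: a + sin t *: b'.
    by rewrite /b' scalerA divff// scale1r addrC subrK.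
  by apply: (sep_circle_le a1 b'1 ab'); rewrite t0/=; lra.
rewrite fE.
apply: (@le_trans _ _ (p%:E * leb R n B + (q - p)%:E * leb R n (B `&` sepset a b))%E); last first.
  rewrite ballME sepE -!EFinM -EFinD lee_fin.
  apply: (@le_trans _ _ (ballM R n * (p + (q - p) * (t / pi)))).
    rewrite mulrDr mulrC lerD2l mulrCA ler_wpM2l// ?subr_ge0//.
  rewrite ler_wpM2l ?(ltW (@ballM_gt0 R n))//.
  by apply: jump_average_le; rewrite ?t0 ?frob_ge0.
(* The cost is [p] when [e] gives [a] and [b] the same sign and [q] when it separates them; this is
   the integrand off the two null hyperplanes where a sign vanishes. *)
pose f2 (e : borel R n) : \bar R := (p%:E + (q - p)%:E * (\1_(sepset a b) e)%:E)%E.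
have f2_ge0 e : (0 <= f2 e)%E.
  by rewrite /f2 -EFinM -EFinD lee_fin addr_ge0 ?frob_ge0// mulr_ge0 ?subr_ge0.
have mi : measurable_fun B (fun e : borel R n => (\1_(sepset a b) e)%:E : \bar R).
  by apply/measurable_EFinP; apply: measurable_indic; exact: sepset_measurable.
have <- : (\int[leb R n]_(e in B) f2 e =
    p%:E * leb R n B + (q - p)%:E * leb R n (B `&` sepset a b))%E.
  rewrite ge0_integralD//=; last 3 first.
  - by move=> e _; rewrite lee_fin frob_ge0.
  - by move=> e _; rewrite -EFinM lee_fin mulr_ge0 ?subr_ge0.
  - exact: measurable_funeM.
  rewrite integral_cst// ge0_integralZl//; last by rewrite lee_fin subr_ge0.
  rewrite integral_indic//; last exact: sepset_measurable.
  by rewrite (setIC B).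
apply: ae_ge0_le_integral => //.
- by move=> e _; rewrite lee_fin frob_ge0.
- apply/measurable_EFinP; apply: measurable_funTS; apply: measurable_frob => i j.
  rewrite (ord1 i); under eq_fun do rewrite !mxE.
  by apply: measurable_funB;
    apply: (measurableT_comp (@measurable_coord R n j)); exact: measurable_unit_of_mul.
- by apply: emeasurable_funD => //; exact: measurable_funeM.
have na := leb_hyperplane a1; have nb := leb_hyperplane b1.
exists ([set e | mxdot e a = 0] `|` [set e | mxdot e b = 0]); split.
- by apply: measurableU; exact: hyperplane_measurable.
- apply/eqP; rewrite eq_le measure_ge0 andbT -[leRHS]adde0 -{1}na -nb.
  by apply: measureU2; exact: hyperplane_measurable.
move=> e /= H; apply: contrapT => /not_orP[/eqP ea /eqP eb].
apply: H => _; rewrite !unit_of_rp_embed// /f2 indicE -EFinM -EFinD lee_fin.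
have pE r s : r = s -> frob (r *: a - s *: b) = `|s| * p.
  by move=> ->; rewrite -scalerBr frobZ.
have qE r s : r = - s -> frob (r *: a - s *: b) = `|s| * q.
  by move=> ->; rewrite scaleNr -opprD frobN -scalerDr frobZ.
have [h|h] := ltP (mxdot e a * mxdot e b) 0.
  rewrite mem_set//= mulr1 subrKC.
  case: (sgrP (mxdot e a)) ea h => // ha _; case: (sgrP (mxdot e b)) eb => // hb _ h.
  - by move: h; rewrite ltNge mulr_ge0// ltW.
  - by rewrite qE ?opprK// normrN1 mul1r.
  - by rewrite qE// normr1 mul1r.
  - by move: h; rewrite ltNge mulr_le0// ltW.
rewrite memNset/=; last by rewrite /sepset/= ltNge h.
rewrite mulr0 addr0.
case: (sgrP (mxdot e a)) ea h => // ha _; case: (sgrP (mxdot e b)) eb => // hb _ h.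
- by rewrite pE// normr1 mul1r.
- by move: h; rewrite leNgt nmulr_llt0// ha.
- by move: h; rewrite leNgt pmulr_llt0// ha.
- by rewrite pE// normrN1 mul1r.
Qed.

End direction.

(** * Borel sets are Hausdorff measurable *)

Section metric_outer_measure.
Context {R : realType} {n : nat}.
Variable mu : {outer_measure set 'rV[R]_n -> \bar R}.
Implicit Types A B U X : set 'rV[R]_n.

(** Caratheodory's condition of additivity on sets at positive distance. The balls are those of the
    sup norm, for which positive distance means the same as for the Euclidean norm. *)
Definition metric_outer (nu : set 'rV[R]_n -> \bar R) := forall A B (r : R), 0 < r ->
  (forall a b, A a -> B b -> ~ ball a r b) -> (nu A + nu B <= nu (A `|` B))%E.

Hypothesis mu_metric : metric_outer mu.

Let inner U (k : nat) : set 'rV[R]_n := [set x | ball x k.+1%:R^-1 `<=` U].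

Let inner_sub U k : inner U k `<=` U.
Proof. by move=> x; apply; exact: ballxx. Qed.

Let inner_le U k l : (k <= l)%N -> inner U k `<=` inner U l.
Proof.
move=> kl x xk y xy; apply: xk; apply: le_ball xy.
by rewrite lef_pV2 ?posrE// ler_nat ltnS.
Qed.

Let inner_bigcup U : open U -> U `<=` \bigcup_k inner U k.
Proof.
move=> oU x Ux; have /nbhs_ballP[e /= e0 eU] : nbhs x U by exact: open_nbhs_nbhs.
exists (Num.bound e^-1) => // y xy; apply: eU; apply: le_ball xy.
rewrite -[leRHS]invrK lef_pV2 ?posrE ?invr_gt0//.
by rewrite (le_trans (ltW (archi_boundP _))) ?invr_ge0 ?(ltW e0)// ler_nat.
Qed.

Let inner_far U k x y : inner U k x -> ~ inner U k.+1 y ->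
  ~ ball x (k.+1%:R^-1 - k.+2%:R^-1) y.
Proof.
move=> xk /existsNP[z /not_implyP[yz Uz]] xy; apply: Uz; apply: xk.
by rewrite -(subrK k.+2%:R^-1 k.+1%:R^-1); exact: ball_triangle xy yz.
Qed.

(** The sets [A k] increase to the part of [X] inside [U] and are at positive distance from the
    complement of [U]. What [A k.+1] misses is a union of shells [D j] whose outer measures have a
    finite sum, so the missing part tends to 0. *)
Lemma open_caratheodory U : open U -> mu.-caratheodory U.
Proof.
move=> oU; apply: le_caratheodory_measurable => X.
have [->|] := eqVneq (mu X) +oo%E; first by rewrite leey.
rewrite -ltey => Xoo.
pose A k := X `&` inner U k; pose D k := X `&` (inner U k.+2 `\` inner U k.+1).
have r0 k : 0 < k.+1%:R^-1 - k.+2%:R^-1 :> R.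
  by rewrite subr_gt0 ltf_pV2 ?posrE// ltr_nat.
have AX k : (mu (A k) <= mu X)%E by apply: le_outer_measure => x [].
have AD k : (mu (A k) + mu (D k) <= mu (A k.+2))%E.
  apply: (@le_trans _ _ (mu (A k `|` D k))).
    by apply: (mu_metric (r0 k)) => a b [_ ak] [_ [_ bk]]; exact: inner_far ak bk.
  apply: le_outer_measure => x [[Xx xk]|[Xx [xk _]]]; split => //.
  by apply: inner_le xk; rewrite (leq_trans (leqnSn _)).
have AC k : (mu (A k) + mu (X `&` ~` U) <= mu X)%E.
  apply: (@le_trans _ _ (mu (A k `|` (X `&` ~` U)))).
    apply: (@mu_metric _ _ k.+1%:R^-1) => [|a b [_ ak] [_ Ub] ab].
      by rewrite invr_gt0.
    exact/Ub/ak.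
  by apply: le_outer_measure => x [[]|[]].
(* Each [D k] is at positive distance from [A k], which contains the earlier shells of the same
   parity; even and odd shells are thus summed separately. *)
have sumD m : (\sum_(k < m) mu (D k) <= mu (A m) + mu (A m.+1))%E.
  elim: m => [|m IH]; first by rewrite big_ord0 adde_ge0// outer_measure_ge0.
  rewrite big_ord_recr/= [leRHS]addeC.
  by apply: (le_trans (leeD IH (lexx (mu (D m))))); rewrite addeAC leeD2r.
have Doo : (\sum_(0 <= k <oo) mu (D k) < +oo)%E.
  apply: (@le_lt_trans _ _ (mu X + mu X)%E); last by rewrite lte_add_pinfty.
  apply: lime_le; first by apply: is_cvg_nneseries => k _ _; exact: outer_measure_ge0.
  by apply: nearW => m; rewrite big_mkord (le_trans (sumD m))// leeD.
have tail := nneseries_tail_cvg Doo (fun k _ => outer_measure_ge0 mu (D k)).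
have XU k : (mu (X `&` U) <= mu (A k.+1) + \sum_(k <= j <oo) mu (D j))%E.
  pose F j := if (k <= j)%N then D j else set0.
  have -> : (\sum_(k <= j <oo) mu (D j) = \sum_(0 <= j <oo) mu (F j))%E.
    rewrite eseries_cond eseries_mkcond; apply: eq_eseriesr => j _ /=.
    by rewrite /F; case: ifP => //; rewrite outer_measure0.
  apply: (@le_trans _ _ (mu (A k.+1) + mu (\bigcup_j F j))%E); last first.
    exact/leeD2l/outer_measure_sigma_subadditive.
  apply: le_trans (outer_measureU2 _ _ _); apply: le_outer_measure => x [Xx Ux].
  have [xk|xk] := pselect (inner U k.+1 x); [by left|right].
  have [m _ xm] := inner_bigcup oU Ux.
  have [j kj] : exists2 j, (k <= j)%N & inner U j.+2 x /\ ~ inner U j.+1 x.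
    elim: m xm => [|m IH] xm.
      by exfalso; apply: xk; exact: inner_le xm.
    have [xm'|xm'] := pselect (inner U m x); first exact: IH.
    have [mk|km] := leqP m k; first by exfalso; apply: xk; exact: inner_le xm.
    by case: m km xm xm' {IH} => // m km xm xm'; exists m.
  by move=> xj; exists j => //; rewrite /F kj; split.
rewrite -(adde0 (mu X)).
have H k : (mu (X `&` U) + mu (X `&` ~` U) <= mu X + \sum_(k <= j <oo) mu (D j))%E.
  by rewrite (le_trans (leeD2r _ (XU k)))// addeAC leeD2r.
have lim : (fun k => mu X + \sum_(k <= j <oo) mu (D j))%E @ \oo --> (mu X + 0)%E.
  apply: cvgeD => //; last exact: cvg_cst.
  by rewrite fin_num_adde_defl.
by apply: (cvge_ge _ lim); exact: nearW.
Qed.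

Lemma borel_caratheodory (A : set (borel R n)) : measurable A -> mu.-caratheodory A.
Proof.
have : @measurable _ (borel R n) `<=` @measurable _ (caratheodory_type mu).
  by apply: smallest_sub; [exact: sigma_algebra_measurable|exact: open_caratheodory].
exact.
Qed.

End metric_outer_measure.

Section hausdorff_borel.
Context {R : realType} {N : nat} (s : nat).
Local Open Scope ereal_scope.

Let diam_ge (F : set 'rV[R]_N) x y : F x -> F y -> (frob (x - y)%R)%:E <= diam F.
Proof. by move=> Fx Fy; apply: ereal_sup_ubound; exists x => //; exists y. Qed.

Let hausdorff_pre_le (d1 d2 : R) (A : set 'rV[R]_N) : (d1 <= d2)%R ->
  hausdorff_pre s d2 A <= hausdorff_pre s d1 A.
Proof.
move=> d12; apply: ereal_inf_le_tmp => _ [F [AF Fd] <-].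
exists F => //; split => // k; rewrite (le_trans (Fd k))// lee_fin//.
Qed.

(** A set of diameter at most [d < r] cannot meet both [A] and [B], so a cover of the union splits
    into a cover of each. *)
Let hausdorff_preD (d r : R) (A B : set 'rV[R]_N) : (d < r)%R ->
  (forall a b, A a -> B b -> ~ ball a r b) ->
  hausdorff_pre s d A + hausdorff_pre s d B <= hausdorff_pre s d (A `|` B).
Proof.
move=> dr AB; apply: le_ereal_inf_tmp => _ [F [ABF Fd] <-].
pose pick (C : set 'rV[R]_N) k := if asbool (F k `&` C !=set0) then F k else set0.
have pickP C : C `<=` A `|` B -> hausdorff_pre s d C <= \sum_(k <oo) diam_pow s (pick C k).
  move=> CAB; apply: ereal_inf_lbound; exists (pick C) => //; split.
    move=> x Cx; have [k _ Fx] := ABF x (CAB _ Cx); exists k => //.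
    by rewrite /pick; case: asboolP => // -[]; exists x.
  by move=> k; rewrite /pick; case: asboolP => // _; rewrite diam0 leNye.
apply: (le_trans (leeD (pickP A _) (pickP B _))); [by left|by right|].
rewrite -nneseriesD; [|by move=> *; exact: diam_pow_ge0..].
apply: lee_nneseries => [k _ _|k _]; first by rewrite adde_ge0// diam_pow_ge0.
have p0 : diam_pow s (set0 : set 'rV[R]_N) = 0 by rewrite /diam_pow eqxx.
rewrite /pick; case: asboolP => [[a [Fa Aa]]|_]; last first.
  by rewrite p0 add0e; case: ifP => // _; rewrite p0 diam_pow_ge0.
case: asboolP => [[b [Fb Bb]]|_]; last by rewrite p0 adde0.
exfalso; apply: (AB a b Aa Bb).
have ab : (frob (a - b) < r)%R.
  by rewrite -lte_fin (le_lt_trans (diam_ge Fa Fb))// (le_lt_trans (Fd k))// lte_fin.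
split => [|i j]; first exact: le_lt_trans (frob_ge0 _) ab.
rewrite /ball/= (le_lt_trans _ ab)// (le_trans _ (entry_le_frob _ i j))//.
by rewrite !mxE.
Qed.

Lemma hausdorff_metric_outer : metric_outer (hausdorff R N s).
Proof.
move=> A B r r0 AB; set H := hausdorff R N s.
have [->|] := eqVneq (H (A `|` B)) +oo; first by rewrite leey.
have H0 C : 0 <= H C by exact: outer_measure_ge0.
rewrite -ltey => Hoo; have Hfin : H (A `|` B) \is a fin_num by rewrite ge0_fin_numE.
(* Two independent scales, so that the suprema defining [H A] and [H B] can be taken one after the
   other; the pre-measures grow as the scale shrinks. *)
have key d1 d2 : (0 < d1)%R -> (0 < d2)%R ->
    hausdorff_pre s d1 A + hausdorff_pre s d2 B <= H (A `|` B).
  move=> d10 d20; pose d := (Num.min (r / 2) (Num.min d1 d2))%R.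
  have d0 : (0 < d)%R by rewrite !lt_min d10 d20 divr_gt0.
  apply: (@le_trans _ _ (hausdorff_pre s d A + hausdorff_pre s d B)).
    by apply: leeD; apply: hausdorff_pre_le; rewrite /d !ge_min lexx ?orbT.
  apply: (@le_trans _ _ (hausdorff_pre s d (A `|` B))).
    apply: (hausdorff_preD (r := r)) => //.
    by rewrite gt_min ltr_pdivrMr// ltr_pMr// ltr1n.
  by apply: ereal_sup_ubound; exists d.
have pre_ge0 (d : R) (C : set 'rV[R]_N) : 0 <= hausdorff_pre s d C.
  apply: le_ereal_inf_tmp => _ [F _ <-].
  by apply: nneseries_ge0 => k _ _; exact: diam_pow_ge0.
have key2 d1 : (0 < d1)%R -> hausdorff_pre s d1 A + H B <= H (A `|` B).
  move=> d10; have pfin : hausdorff_pre s d1 A \is a fin_num.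
    rewrite ge0_fin_numE//; apply: le_lt_trans Hoo.
    by rewrite (le_trans _ (key d1 _ d10 d10))// leeDl.
  rewrite addeC -leeBrDr//; apply: ge_ereal_sup => _ [d2 /= d20 <-].
  by rewrite leeBrDr// addeC key.
have Bfin : H B \is a fin_num.
  by rewrite ge0_fin_numE// (le_lt_trans _ Hoo)// le_outer_measure.
rewrite -leeBrDr//; apply: ge_ereal_sup => _ [d1 /= d10 <-].
by rewrite leeBrDr// key2.
Qed.

Lemma borel_hausdorff (A : set (borel R N)) : measurable A ->
  measurable (A : set (caratheodory_type (hausdorff R N s))).
Proof. exact/borel_caratheodory/hausdorff_metric_outer. Qed.

End hausdorff_borel.

Lemma metric_outer_borel_measure (R : realType) (n : nat)
    (mu : {outer_measure set 'rV[R]_n -> \bar R}) : metric_outer mu ->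
  exists p : {measure set (borel R n) -> \bar R}, forall A : set (borel R n), p A = mu A.
Proof.
move=> mm; have mid : measurable_fun setT ((fun x => x) : caratheodory_type mu -> borel R n).
  by move=> _ A mA; rewrite setTI; exact: borel_caratheodory mA.
unshelve eexists (pushforward (mu : {measure set (caratheodory_type mu) -> \bar R})
  ((fun x => x) : caratheodory_type mu -> borel R n)); [exact: mid|by []].
Qed.

Lemma continuous_mull (R : realType) (T : topologicalType) (s : R) (f : T -> R) :
  continuous f -> continuous (fun x => s * f x).
Proof.
move=> cf x; exact: (@cvgM R _ (nbhs x) _ (fun=> s) f s (f x) (cvg_cst _) (cf x)).
Qed.

Lemma bounded_integrable d (X : measurableType d) (R : realType)
    (q : {measure set X -> \bar R}) (D : set X) (f : X -> R) (C : R) :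
  measurable D -> (q D < +oo)%E -> measurable_fun D f ->
  (forall x, D x -> `|f x| <= C) -> q.-integrable D (EFin \o f).
Proof.
move=> mD qD mf fC; apply: measurable_bounded_integrable => //.
exists C; split => [|y Cy x Dx]; first exact: num_real.
by apply: (le_trans (fC x Dx)); exact: ltW.
Qed.

Lemma continuous_borel_measurable (R : realType) n (f : 'rV[R]_n -> R) :
  continuous f -> measurable_fun setT (f : borel R n -> measurableTypeR R).
Proof.
move=> /continuousP cf; apply: (measurability _ (RGenOpens.measurableE R)).
move=> _ [_ [a [b ->] <-]]; rewrite setTI; apply: open_borel.
by apply: cf; exact: interval_open.
Qed.

(** * Weak limits of measures *)

Section ultrafilter_limit.
Context {R : realType} {T : Type}.
Variables (U : set_system T) (UU : UltraFilter U).

Lemma ultra_fmap (S : Type) (f : T -> S) : UltraFilter (f @ U).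
Proof.
apply: Build_UltraFilter => G PG UG; apply/seteqP; split => // A GA.
have [//|UA] := in_ultra_setVsetC (f @^-1` A) UU.
exfalso; have GA' : G (~` A) by apply: UG.
by apply: (@filter_not_empty _ G); rewrite -(setICr A); exact: filterI.
Qed.

(** Compactness of a segment. The masses of all Borel sets thus converge simultaneously, without a
    diagonal extraction. *)
Lemma ultra_bounded_cvg (f : T -> R) (M : R) : (forall x, `|f x| <= M) ->
  exists l : R, f @ U --> l.
Proof.
move=> fM; have := @segment_compact R (- M) M; rewrite compact_ultra.
have UF := ultra_fmap f.
move=> /(_ _ UF)[|l [_ fl]]; last by exists l.
apply: (@filterS _ U _ setT); last exact: filterT.
by move=> x _ /=; rewrite in_itv/= -ler_norml.
Qed.

End ultrafilter_limit.

Lemma le_cvg_filter (R : realType) (T : Type) (F : set_system T) {FF : ProperFilter F}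
    (f g : T -> R) (l l' : R) :
  f @ F --> l -> g @ F --> l' -> (forall x, f x <= g x) -> l <= l'.
Proof.
move=> fl gl fg; rewrite -subr_ge0; apply: (cvgr_to_ge (cvgB gl fl)).
by apply: nearW => x; rewrite /= subr_ge0.
Qed.

Lemma cvg_sumr (R : realType) (T : Type) (F : set_system T) {FF : Filter F}
    n (f : nat -> T -> R) (l : nat -> R) : (forall j, f j @ F --> l j) ->
  (fun x => \sum_(j < n) f j x) @ F --> \sum_(j < n) l j.
Proof.
move=> fl; elim: n => [|n IH].
  rewrite big_ord0; under eq_fun do rewrite big_ord0; exact: cvg_cst.
rewrite big_ord_recr; under eq_fun do rewrite big_ord_recr/=.
exact: cvgD IH (fl n).
Qed.

Section layer_cake.
Context {R : realType}.

Let count_le (y : R) n : 0 <= y -> (\sum_(l < n) (l.+1%:R <= y)%R)%:R <= y.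
Proof.
move=> y0; elim: n => [|n IH]; first by rewrite big_ord0.
have [ny|yn] := leP n.+1%:R y; last first.
  by rewrite big_ord_recr/= [n.+1%:R <= y]leNgt yn addn0.
apply: le_trans ny; rewrite ler_nat -[leqRHS]card_ord -sum1_card.
by apply: leq_sum => i _; exact: leq_b1.
Qed.

Let le_count (y : R) n : y <= n%:R -> y <= (\sum_(l < n) (l%:R < y)%R)%:R.
Proof.
elim: n => [|n IH] yn; first by rewrite big_ord0.
have [yn'|ny] := leP y n%:R.
  rewrite (le_trans (IH yn'))// ler_nat big_ord_recr/=; exact: leq_addr.
rewrite (le_trans yn)// ler_nat -[leqLHS]card_ord -sum1_card.
by apply: leq_sum => i _; rewrite (le_lt_trans _ ny)// ler_nat -ltnS.
Qed.

(** [n%:R * phi x] lies between the number of levels [l.+1] it reaches and the number of levels [l]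
    it exceeds. For continuous [phi] the former give closed sets and the latter open sets, as the
    two one-sided bounds on a weak limit require. *)
Lemma layer_cake_sandwich d (X : measurableType d) (m : {measure set X -> \bar R})
    (phi : X -> R) n : measurable_fun setT phi -> (forall x, 0 <= phi x <= 1) ->
  (\sum_(l < n) m [set x | (l.+1%:R <= n%:R * phi x)%R] <= n%:R%:E * \int[m]_x (phi x)%:E)%E /\
  (n%:R%:E * \int[m]_x (phi x)%:E <= \sum_(l < n) m [set x | (l%:R < n%:R * phi x)%R])%E.
Proof.
move=> mphi phi01.
have phi0 x : 0 <= phi x by have /andP[] := phi01 x.
have phi1 x : phi x <= 1 by have /andP[] := phi01 x.
have mnphi : measurable_fun setT (fun x => n%:R * phi x) by exact: measurable_funM.
have mE (l : nat) : measurable [set x | (l.+1%:R <= n%:R * phi x)%R].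
  rewrite (_ : [set _ | _] = (fun x => n%:R * phi x) @^-1` `[l.+1%:R, +oo[).
    exact: measurable_preimageT.
  by apply/seteqP; split => x /=; rewrite in_itv/= andbT.
have mO (l : nat) : measurable [set x | (l%:R < n%:R * phi x)%R].
  rewrite (_ : [set _ | _] = (fun x => n%:R * phi x) @^-1` `]l%:R, +oo[).
    exact: measurable_preimageT.
  by apply/seteqP; split => x /=; rewrite in_itv/= andbT.
have indE (A : nat -> set X) : (forall l, measurable (A l)) ->
    (\sum_(l < n) m (A l) = \int[m]_x (\sum_(l < n) (\1_(A l) x)%:E))%E.
  move=> mA; rewrite ge0_integral_sum//=.
  - by apply: eq_bigr => l _; rewrite integral_indic// setIT.
  - by move=> l; apply/measurable_EFinP; exact: measurable_indic.
have sumE (A : nat -> set X) (P : nat -> X -> bool) x :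
    (forall l x, A l x <-> P l x) ->
    (\sum_(l < n) (\1_(A l) x)%:E = (\sum_(l < n) P l x)%N%:R%:E :> \bar R)%E.
  move=> AP; rewrite sumEFin natr_sum; congr EFin; apply: eq_bigr => l _.
  rewrite indicE; congr (nat_of_bool _)%:R.
  by apply/idP/idP; rewrite inE => /AP.
rewrite -ge0_integralZl//; last 2 first.
- exact/measurable_EFinP.
- by move=> x _; rewrite lee_fin.
rewrite (indE (fun l => [set x | (l.+1%:R <= n%:R * phi x)%R]))//.
rewrite (indE (fun l => [set x | (l%:R < n%:R * phi x)%R]))//; split; apply: ge0_le_integral => //.
- by move=> x _; apply: sume_ge0 => l _; rewrite lee_fin.
- by apply: emeasurable_sum => l; apply/measurable_EFinP; exact: measurable_indic.
- exact/measurable_EFinP.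
- move=> x _; rewrite (sumE (fun l => [set x | (l.+1%:R <= n%:R * phi x)%R])
    (fun l x => (l.+1%:R <= n%:R * phi x)%R))// lee_fin.
  by rewrite count_le// mulr_ge0.
- by move=> x _; rewrite -EFinM lee_fin mulr_ge0.
- exact/measurable_EFinP.
- by apply: emeasurable_sum => l; apply/measurable_EFinP; exact: measurable_indic.
- move=> x _; rewrite (sumE (fun l => [set x | (l%:R < n%:R * phi x)%R])
    (fun l x => (l%:R < n%:R * phi x)%R))// lee_fin.
  by rewrite le_count// ler_piMr.
Qed.

End layer_cake.

Section weak_limit.
Context {R : realType} {N : nat} {T : Type}.
Local Notation bN := (borel R N).
Variables (U : set_system T) (UU : UltraFilter U).
Variables (m : T -> {measure set bN -> \bar R}) (M : R).
Hypothesis mM : forall k, (m k setT <= M%:E)%E.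

Let FU : Filter U. Proof. exact: (@filter_filter _ _ (@ultra_proper _ _ UU)). Qed.

Let mfin k (A : set bN) : measurable A -> m k A = (fine (m k A))%:E.
Proof.
move=> mA; rewrite fineK// ge0_fin_numE// (le_lt_trans _ (ltry M))//.
by rewrite (le_trans _ (mM k))// le_measure ?inE.
Qed.

Let m_le k (A : set bN) : measurable A -> fine (m k A) <= M.
Proof.
by move=> mA; rewrite -lee_fin -mfin// (le_trans _ (mM k))// le_measure ?inE.
Qed.

(* The limit measure is built by Caratheodory's method from the limits along the
   ultrafilter of the masses of the open sets. *)
Let lamP (A : set bN) : {l : R | measurable A -> (fun k => fine (m k A)) @ U --> l}.
Proof.
apply: cid; have [mA|nA] := pselect (measurable A); last by exists 0.
have bA k : `|fine (m k A)| <= M by rewrite ger0_norm ?m_le// fine_ge0.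
by have [l ml] := ultra_bounded_cvg UU bA; exists l.
Qed.

Let lam A : R := sval (lamP A).

Let lam_cvg A : measurable A -> (fun k => fine (m k A)) @ U --> lam A.
Proof. by move=> mA; rewrite /lam; case: lamP => l /= /(_ mA). Qed.

Let lam_ge0 A : measurable A -> 0 <= lam A.
Proof.
by move=> mA; apply: (cvgr_to_ge (lam_cvg mA)); apply: nearW => k; exact: fine_ge0.
Qed.

Let lam_leM A : measurable A -> lam A <= M.
Proof.
by move=> mA; apply: (cvgr_to_le (lam_cvg mA)); apply: nearW => k; exact: m_le.
Qed.

Let lam_le A B : measurable A -> measurable B -> A `<=` B -> lam A <= lam B.
Proof.
move=> mA mB AB; apply: (le_cvg_filter (lam_cvg mA) (lam_cvg mB)) => k.
by rewrite -lee_fin -!mfin// le_measure ?inE.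
Qed.

Let lam_disj A B C : measurable A -> measurable B -> measurable C ->
  A `&` B = set0 -> A `|` B `<=` C -> lam A + lam B <= lam C.
Proof.
move=> mA mB mC AB ABC.
apply: (le_cvg_filter (cvgD (lam_cvg mA) (lam_cvg mB)) (lam_cvg mC)) => k.
rewrite -lee_fin EFinD -!mfin// -measureU// le_measure ?inE//.
exact: measurableU.
Qed.

Let lam_bigsetU (F : nat -> set bN) n : (forall k, measurable (F k)) ->
  lam (\big[setU/set0]_(j < n) F j) <= \sum_(j < n) lam (F j).
Proof.
move=> mF.
have mUF : measurable (\big[setU/set0]_(j < n) F j) by exact: bigsetU_measurable.
have sF := @cvg_sumr _ _ U FU n (fun j k => fine (m k (F j))) _ (fun j => lam_cvg (mF j)).
apply: (le_cvg_filter (lam_cvg mUF) sF) => k.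
rewrite -lee_fin -mfin// -sumEFin.
rewrite (le_trans (Boole_inequality (m k) _))//.
by apply: lee_sum => j _; rewrite -mfin.
Qed.

(** The value [+oo] off the open sets restricts the outer measure to open covers. *)
Let gauge (A : set bN) : \bar R :=
  if asbool (open (A : set 'rV[R]_N)) then (lam A)%:E else +oo%E.

Let gauge_open A : open (A : set 'rV[R]_N) -> gauge A = (lam A)%:E.
Proof. by move=> oA; rewrite /gauge asboolT. Qed.

Let gauge_ge0 A : (0 <= gauge A)%E.
Proof.
by rewrite /gauge; case: asboolP => // oA; rewrite lee_fin lam_ge0//; exact: open_borel.
Qed.

Let lam0 : lam set0 = 0.
Proof.
have h : (fun k => fine (m k set0)) @ U --> (0 : R).
  rewrite (_ : (fun _ => _) = cst 0); first exact: cvg_cst.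
  by apply/funext => k; rewrite measure0.
exact: cvg_unique (lam_cvg measurable0) h.
Qed.

Let gauge0 : gauge set0 = 0%E.
Proof. by rewrite gauge_open ?lam0//; exact: open0. Qed.

Let mu0 : mu_ext gauge set0 = 0%E.
Proof. exact: mu_ext0. Qed.

Let wouter : {outer_measure set 'rV[R]_N -> \bar R} :=
  HB.pack (mu_ext gauge : set 'rV[R]_N -> \bar R)
    (isOuterMeasure.Build R 'rV[R]_N (mu_ext gauge) mu0
      (mu_ext_ge0 gauge_ge0) (@le_mu_ext _ _ _ gauge) (mu_ext_sigma_subadditive gauge_ge0)).

Let wouterE A : wouter A = mu_ext gauge A.
Proof. by []. Qed.

Let wouter_open (A : set 'rV[R]_N) : open A -> (wouter A <= (lam A)%:E)%E.
Proof.
move=> oA; rewrite wouterE -(gauge_open oA).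
apply: ereal_inf_lbound; exists (fun j => if j == 0%N then A else set0).
  split; first by case => [|j] /=; [exact: open_borel|exact: measurable0].
  by move=> x Ax; exists 0%N.
rewrite (@nneseries_split _ _ 0 1)//= big_nat1/= eseries0 ?adde0// => -[|j]//= _ _.
Qed.

(** An open cover of [K] has a finite subcover, on which the limit masses are subadditive. With
    [wouter_open], the limit measure is at least [lam] on compact sets and at most [lam] on open
    ones. *)
Let lam_compact (K : set 'rV[R]_N) : compact K -> measurable (K : set bN) ->
  ((lam K)%:E <= wouter K)%E.
Proof.
move=> cK mK; rewrite wouterE; apply: le_ereal_inf_tmp => _ [F [mF KF] <-].
have [oF|] := pselect (forall j, open (F j : set 'rV[R]_N)); last first.
  move=> /existsNP[j oF]; rewrite (eseries_pinfty (k := j))// ?leey//.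
    by move=> i _; rewrite -ltNye (lt_le_trans _ (gauge_ge0 _)).
  by rewrite /gauge asboolF.
have := cK; rewrite compact_cover => /(_ _ setT F (fun j _ => oF j) KF)[D _ KD].
pose n := (\max_(j <- finmap.enum_fset D) j).+1.
have KU : K `<=` \big[setU/set0]_(j < n) F j.
  move=> x /KD[j /= jD Fjx]; rewrite -bigcup_mkord; exists j => //=.
  by rewrite ltnS; exact: leq_bigmax_seq.
apply: (@le_trans _ _ (\sum_(j < n) (lam (F j))%:E)%E).
  rewrite sumEFin lee_fin (le_trans _ (lam_bigsetU _ mF))// lam_le//.
  exact: bigsetU_measurable.
rewrite -(big_mkord xpredT (fun j => (lam (F j))%:E)).
apply: le_trans (nneseries_lim_ge n _) => //.
by apply: lee_sum => j _; rewrite gauge_open.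
Qed.

(** A cover is split by intersecting it with the [r / 2]-neighbourhoods of [A] and [B], which are
    open and disjoint. *)
Let wouter_metric : metric_outer wouter.
Proof.
move=> A B r r0 AB; rewrite !wouterE.
apply: le_ereal_inf_tmp => _ [F [mF ABF] <-].
pose nb (C : set 'rV[R]_N) := \bigcup_(x in C) ball x (r / 2).
have onb C : open (nb C) by apply: bigcup_open => x _; exact: ball_open.
have Cnb C : C `<=` nb C by move=> x Cx; exists x => //; apply: ballxx; rewrite divr_gt0.
have mnb C : measurable (nb C : set bN) by exact: open_borel.
have nbAB : nb A `&` nb B = set0.
  rewrite -subset0 => x [[a Aa ax] [b Bb bx]]; apply: (AB a b Aa Bb).
  by rewrite [r]splitr; apply: ball_triangle ax _; exact: ball_sym.
have H C : C `<=` A `|` B -> (mu_ext gauge C <= \sum_(j <oo) gauge (F j `&` nb C))%E.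
  move=> CAB; apply: ereal_inf_lbound; exists (fun j => F j `&` nb C) => //; split.
    by move=> j; exact: measurableI.
  by move=> x Cx; have [j _ Fx] := ABF x (CAB x Cx); exists j => //; split => //; exact: Cnb.
apply: (le_trans (leeD (H A _) (H B _))); [by left|by right|].
rewrite -nneseriesD//; apply: lee_nneseries => [j _ _|j _]; first by rewrite adde_ge0.
rewrite {3}/gauge; case: asboolP => [oF|]; last by rewrite leey.
rewrite !gauge_open; [|exact: openI..].
rewrite -EFinD lee_fin lam_disj//; [exact: measurableI..| |].
  by rewrite setIACA nbAB setI0.
by move=> x [|] [].
Qed.

(** For [phi] with values in [[0, 1]], the layer cake bounds with [n] levels put [n] times the limit
    of the integrals within [M] of [n] times the integral against [p]; a large [n] forces
    equality. *)
Lemma weak_limit : exists2 p : {measure set bN -> \bar R}, (p setT <= M%:E)%E &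
  forall (phi : 'rV[R]_N -> R) (C : R), continuous phi ->
  (forall x, `|phi x| <= C) -> compact (closure [set x | phi x != 0]) ->
  (fun k => \int[m k]_x phi x) @ U --> \int[p]_x phi x.
Proof.
have [p pE] := metric_outer_borel_measure wouter_metric.
have pT : (p setT <= M%:E)%E.
  by rewrite pE (le_trans (wouter_open openT))// lee_fin lam_leM.
exists p => //.
have pfin (A : set bN) : measurable A -> p A = (fine (p A))%:E.
  move=> mA; rewrite fineK// ge0_fin_numE// (le_lt_trans _ (ltry M))//.
  by rewrite (le_trans _ pT)// le_measure ?inE.
have M0 : 0 <= M by rewrite -lee_fin (le_trans _ pT).
have key (phi : 'rV[R]_N -> R) : continuous phi -> (forall x, 0 <= phi x <= 1) ->
    compact (closure [set x | phi x != 0]) ->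
    (fun k => \int[m k]_x phi x) @ U --> \int[p]_x phi x.
  move=> cphi phi01 kphi.
  have mphi := continuous_borel_measurable cphi.
  have intE (q : {measure set bN -> \bar R}) : (q setT <= M%:E)%E ->
      (\int[q]_x (phi x)%:E)%E = (\int[q]_x phi x)%:E /\ 0 <= \int[q]_x phi x <= M.
    move=> qM; have i0 : (0 <= \int[q]_x (phi x)%:E)%E.
      by apply: integral_ge0 => x _; rewrite lee_fin; case/andP: (phi01 x).
    have iM : (\int[q]_x (phi x)%:E <= M%:E)%E.
      apply: le_trans qM; rewrite -[leRHS]mul1e -(integral_cst q measurableT).
      apply: ge0_le_integral => //; [|exact/measurable_EFinP|];
        by move=> x _; rewrite lee_fin; case/andP: (phi01 x).
    have e : (\int[q]_x (phi x)%:E)%E = (\int[q]_x phi x)%:E.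
      by rewrite fineK// ge0_fin_numE// (le_lt_trans iM)// ltry.
    by split => //; rewrite -!lee_fin -e i0 iM.
  have [a ca] : exists a : R, (fun k => \int[m k]_x phi x) @ U --> a.
    apply: (ultra_bounded_cvg UU (M := M)) => k.
    by have [_ /andP[i0 iM]] := intE _ (mM k); rewrite ger0_norm.
  suff -> : \int[p]_x phi x = a by [].
  pose E n (l : nat) : set 'rV[R]_N := [set x | l.+1%:R <= n%:R * phi x].
  pose O n (l : nat) : set 'rV[R]_N := [set x | l%:R < n%:R * phi x].
  have cnphi n : continuous (fun x => n%:R * phi x).
    exact: continuous_mull.
  have oO n l : open (O n l).
    rewrite (_ : O n l = (fun x => n%:R * phi x) @^-1` `]l%:R, +oo[).
      by move/continuousP : (cnphi n); apply; exact: interval_open.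
    by apply/seteqP; split => x /=; rewrite in_itv/= andbT.
  have clE n l : closed (E n l).
    rewrite (_ : E n l = (fun x => n%:R * phi x) @^-1` `[l.+1%:R, +oo[).
      by apply: closed_comp => [x _|]; [exact: cnphi|exact: interval_closed].
    by apply/seteqP; split => x /=; rewrite in_itv/= andbT.
  have cE n l : compact (E n l).
    apply: subclosed_compact kphi _ => // x; rewrite /E/= => h.
    apply: subset_closure => /=; apply/eqP => x0; move: h.
    by rewrite x0 mulr0 leNgt ltr0n.
  have mO n l : measurable (O n l : set bN) by exact: open_borel.
  have mE n l : measurable (E n l : set bN).
    rewrite -[E n l]setCK; apply: measurableC; apply: open_borel.
    exact: closed_openC.
  have sumfin (q : {measure set bN -> \bar R}) (A : nat -> set bN) n :
      (forall B, measurable B -> q B = (fine (q B))%:E) -> (forall l, measurable (A l)) ->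
      (\sum_(l < n) q (A l) = (\sum_(l < n) fine (q (A l)))%:E)%E.
    by move=> qE mA; rewrite -sumEFin; apply: eq_bigr => l _; exact: qE.
  have sand (q : {measure set bN -> \bar R}) n :
      (forall B, measurable B -> q B = (fine (q B))%:E) -> (q setT <= M%:E)%E ->
      \sum_(l < n) fine (q (E n l)) <= n%:R * \int[q]_x phi x <=
      \sum_(l < n) fine (q (O n l)).
    move=> qE qM; have [] := layer_cake_sandwich q n mphi phi01.
    rewrite (sumfin _ (E n))// (sumfin _ (O n))// (intE _ qM).1 -EFinM !lee_fin.
    by move=> -> ->.
  (* Exceeding the level [l.+1] implies reaching it, so passing from open to closed sets shifts the
     index by one and costs a single term, at most [M]. *)
  have OE n : \sum_(l < n) lam (O n l) <= M + \sum_(l < n) lam (E n l).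
    case: n => [|n]; first by rewrite !big_ord0 addr0.
    rewrite big_ord_recl big_ord_recr/= lerD ?lam_leM//.
    rewrite ler_wpDr ?lam_ge0//; apply: ler_sum => i _; apply: lam_le => // x.
    exact: ltW.
  have pO n l : fine (p (O n l)) <= lam (O n l).
    by rewrite -lee_fin -pfin// pE wouter_open.
  have pEE n l : lam (E n l) <= fine (p (E n l)).
    by rewrite -lee_fin -pfin// pE lam_compact.
  have H1 n : n%:R * a <= M + n%:R * \int[p]_x phi x.
    have /andP[pl _] := sand p n pfin pT.
    apply: (@le_trans _ _ (\sum_(l < n) lam (O n l))).
      have c1 : (fun k => n%:R * \int[m k]_x phi x) @ U --> n%:R * a.
        by apply: cvgM => //; exact: cvg_cst.
      have c2 := @cvg_sumr _ _ U FU n (fun l k => fine (m k (O n l))) _ (fun l => lam_cvg (mO n l)).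
      apply: (le_cvg_filter c1 c2) => k.
      by have /andP[] := sand (m k) n (mfin k) (mM k).
    rewrite (le_trans (OE n))// lerD2l (le_trans _ pl)//.
    by apply: ler_sum => l _; exact: pEE.
  have H2 n : n%:R * \int[p]_x phi x <= M + n%:R * a.
    have /andP[_ pu] := sand p n pfin pT.
    apply: (le_trans pu); apply: (@le_trans _ _ (\sum_(l < n) lam (O n l))).
      by apply: ler_sum => l _; exact: pO.
    rewrite (le_trans (OE n))// lerD2l.
    have c1 : (fun k => n%:R * \int[m k]_x phi x) @ U --> n%:R * a.
      by apply: cvgM => //; exact: cvg_cst.
    have c2 := @cvg_sumr _ _ U FU n (fun l k => fine (m k (E n l))) _ (fun l => lam_cvg (mE n l)).
    apply: (le_cvg_filter c2 c1) => k.
    by have /andP[] := sand (m k) n (mfin k) (mM k).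
  apply/eqP/negPn/negP => ne.
  have d0 : 0 < `|\int[p]_x phi x - a| by rewrite normr_gt0 subr_eq0.
  have := archi_boundP (divr_ge0 M0 (ltW d0)).
  rewrite ltr_pdivrMr// ltNge => /negP; apply; set n := Num.bound _.
  rewrite -[n%:R]ger0_norm// -normrM ler_norml mulrBr.
  by have := H1 n; have := H2 n; move: (n%:R * a) (n%:R * _) => x y; lra.
move=> phi C cphi phiC kphi; pose D := C + 1.
have D0 : 0 < D by rewrite ltr_wpDl// (le_trans _ (phiC 0)).
(* [pos 1] and [pos (-1)] are the positive and negative parts of [phi] divided by [D], which exceeds
   the bound [C] so as to be positive. *)
pose pos (s : R) x := (2 * D)^-1 * (`|phi x| + s * phi x).
have D20 : 0 < 2 * D by rewrite mulr_gt0.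
have cpos s : continuous (pos s).
  apply: continuous_mull => x; have cs := @continuous_mull _ _ s _ cphi x.
  exact: (@cvgD R _ _ (nbhs x) _ _ _ _ _ (cvg_norm (cphi x)) cs).
have pos01 s x : `|s| <= 1 -> 0 <= pos s x <= 1.
  move=> s1; have sp : `|s * phi x| <= `|phi x| by rewrite normrM ler_piMl.
  move: sp; rewrite ler_norml => /andP[sl su].
  rewrite /pos mulr_ge0 ?invr_ge0 ?(ltW D20)//=; last by rewrite addrC -lerBlDr sub0r.
  rewrite ler_pdivrMl// mulr1 (le_trans (lerD (lexx _) su))//.
  by have := phiC x; rewrite /D; lra.
have kpos s : compact (closure [set x | pos s x != 0]).
  apply: subclosed_compact kphi _; first exact: closed_closure.
  apply: closure_subset => x /=; apply: contra => /eqP x0.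
  by rewrite /pos x0 normr0 mulr0 addr0 mulr0.
have phiE x : phi x = D * pos 1 x - D * pos (-1) x.
  by rewrite /pos; field; rewrite gt_eqF.
have n1 : `|1| <= 1 :> R by rewrite normr1.
have nN1 : `|-1| <= 1 :> R by rewrite normrN1.
have intE (q : {measure set bN -> \bar R}) : (q setT <= M%:E)%E ->
    \int[q]_x phi x = D * \int[q]_x pos 1 x - D * \int[q]_x pos (-1) x.
  move=> qM; have qoo : (q setT < +oo)%E by rewrite (le_lt_trans qM)// ltry.
  have ip s : `|s| <= 1 -> q.-integrable setT (EFin \o pos s).
    move=> s1; apply: (@bounded_integrable _ _ _ _ _ _ 1) => // [|x _].
      exact: continuous_borel_measurable.
    by have /andP[p0 p1] := pos01 s x s1; rewrite ger0_norm.
  have iDp s : `|s| <= 1 -> q.-integrable setT (EFin \o (fun x => D * pos s x)).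
    move=> s1; apply: (@bounded_integrable _ _ _ _ _ _ D) => // [|x _].
      by apply: measurable_funM => //; exact: continuous_borel_measurable.
    have /andP[p0 p1] := pos01 s x s1.
    by rewrite normrM !ger0_norm ?(ltW D0)// ler_piMr// ltW.
  rewrite -!RintegralZl//; [|exact: ip..].
  rewrite -RintegralB//; [|exact: iDp..].
  by apply: eq_Rintegral => x _; exact: phiE.
rewrite intE//; under eq_fun do rewrite intE//.
by apply: cvgB; apply: cvgMl_tmp; apply: key => // x; exact: pos01.
Qed.

End weak_limit.

Section continuity.
Context {R : realType} {T : topologicalType}.
Implicit Types f g : T -> R.

Lemma continuous_addf f g : continuous f -> continuous g -> continuous (fun x => f x + g x).
Proof.
move=> cf cg x; exact: (@cvgD R _ _ (nbhs x) _ _ _ _ _ (cf x) (cg x)).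
Qed.

Lemma continuous_mulf f g : continuous f -> continuous g -> continuous (fun x => f x * g x).
Proof.
move=> cf cg x; exact: (@cvgM R _ (nbhs x) _ _ _ _ _ (cf x) (cg x)).
Qed.

End continuity.

(** * Test functions *)

Section C1_functions.
Context {R : realType} {N : nat}.
Implicit Types (f g : 'rV[R]_N -> R).

Definition C1 f := (forall x, differentiable f x) /\ forall k, continuous (partial k f).

Lemma C1_continuous f : C1 f -> continuous f.
Proof. by case=> df _ x; exact: differentiable_continuous. Qed.

Lemma C1_cst (c : R) : C1 (fun=> c).
Proof.
split=> [x|k]; first exact: differentiable_cst.
rewrite (_ : partial k _ = cst 0); first exact: cst_continuous.
by apply/funext => x; rewrite /partial derive_cst.
Qed.

Lemma C1_coord i : C1 (fun x => x ord0 i).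
Proof.
have dl x : differentiable (fun x : 'rV[R]_N => x ord0 i) x by exact: differentiable_coord.
split=> // k.
rewrite (_ : partial k _ = cst ((delta_mx ord0 k : 'rV[R]_N) ord0 i)).
  exact: cst_continuous.
apply/funext => x; rewrite /partial deriveE//.
have @f : {linear 'rV[R]_N -> R}.
  by exists (fun x : 'rV[R]_N => x ord0 i); do 2![eexists]; do ?[constructor];
     rewrite ?mxE// => ? *; rewrite ?mxE//; move=> ?; rewrite !mxE.
by rewrite (_ : (fun _ => _) = f)// diff_lin//; exact: coord_continuous.
Qed.

Lemma C1D f g : C1 f -> C1 g -> C1 (fun x => f x + g x).
Proof.
move=> [df cf] [dg cg]; split=> [x|k]; first exact: differentiableD.
rewrite (_ : partial k _ = fun x => partial k f x + partial k g x).
  by apply: continuous_addf.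
by apply/funext => x; rewrite /partial deriveD//; apply: diff_derivable.
Qed.

Lemma C1M f g : C1 f -> C1 g -> C1 (fun x => f x * g x).
Proof.
move=> cf' cg'; have [df cf] := cf'; have [dg cg] := cg'.
split=> [x|k]; first exact: differentiableM.
rewrite (_ : partial k _ = fun x => f x * partial k g x + g x * partial k f x).
  by apply: continuous_addf; apply: continuous_mulf => //; exact: C1_continuous.
by apply/funext => x; rewrite /partial deriveM//; apply: diff_derivable.
Qed.

Lemma C1_comp f (h h' : R -> R) : (forall t : R, is_derive t (1 : R) h (h' t)) ->
  continuous h' -> C1 f -> C1 (fun x => h (f x)).
Proof.
move=> dh ch' cf'; have [df cf] := cf'.
have diffh t : differentiable h t by apply/derivable1_diffP; have [] := dh t.
split=> [x|k]; first exact: differentiable_comp.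
rewrite (_ : partial k _ = fun x => partial k f x * h' (f x)).
  apply: continuous_mulf => // x.
  by apply: continuous_comp; [exact: (C1_continuous cf')|exact: ch'].
apply/funext => x; rewrite /partial !deriveE//; last exact: differentiable_comp.
rewrite (_ : (fun x => h (f x)) = h \o f)// diff_comp//=.
by rewrite diff1E// derive1E derive_val.
Qed.

Lemma C1_prod (I : eqType) (s : seq I) (F : I -> 'rV[R]_N -> R) :
  (forall i, C1 (F i)) -> C1 (fun x => \prod_(i <- s) F i x).
Proof.
move=> cF; elim: s => [|i s IH].
  by under eq_fun do rewrite big_nil; exact: C1_cst.
by under eq_fun do rewrite big_cons; exact: C1M.
Qed.

End C1_functions.

Section bump.
Context {R : realType}.

(** The square makes the positive part continuously differentiable, the regularity asked of test
    functions. *)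
Definition pos2 (t : R) := Num.max 0 t ^+ 2.

Lemma is_derive_quadratic (f : R -> R) (x d C : R) :
  (forall h, `|f (x + h) - f x - d * h| <= C * h ^+ 2) -> is_derive x 1 f d.
Proof.
move=> fh.
suff H : (fun h => h^-1 *: (f (h *: 1 + x) - f x)) @ 0^' --> d.
  by apply: DeriveDef; [apply/cvg_ex; exists d|exact: cvg_lim H].
have C0 : 0 <= C by have := le_trans (normr_ge0 _) (fh 1); rewrite expr1n mulr1.
apply/cvgrPdist_lt => e e0; near=> h.
have h0 : h != 0 by near: h; exact: nbhs_dnbhs_neq.
have he : `|h| < e / (C + 1).
  near: h; apply: dnbhs0_lt; by rewrite divr_gt0// ltr_wpDl.
have nh : 0 < `|h| by rewrite normr_gt0.
rewrite -(ltr_pM2r nh) -normrM mulrBl /GRing.scale/= mulr1.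
rewrite mulrAC mulVf// mul1r distrC (addrC h x).
rewrite (le_lt_trans (fh h))// -(real_normK (num_real h)) expr2 mulrA ltr_pM2r//.
have : C * `|h| <= (C + 1) * `|h| by rewrite ler_pM2r// lerDl.
move/le_lt_trans; apply; by rewrite mulrC -ltr_pdivlMr// ltr_wpDl.
Unshelve. all: end_near. Qed.

Lemma is_derive_pos2 (t : R) : is_derive t 1 pos2 (2 * Num.max 0 t).
Proof.
apply: (@is_derive_quadratic _ _ _ 1) => h; rewrite mul1r /pos2.
have [t0|t0] := leP 0 t; have [th|th] := leP 0 (t + h).
- rewrite (_ : _ - _ = h ^+ 2) ?normrX ?real_normK ?num_real//; ring.
- rewrite expr0n/= sub0r (_ : _ - _ = - (t ^+ 2 + 2 * t * h)); last by ring.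
  rewrite ler_norml; apply/andP; split; nra.
- rewrite expr0n/= mulr0 mul0r !subr0 ger0_norm ?sqr_ge0//; nra.
- by rewrite expr0n/= mulr0 mul0r !subr0 normr0 sqr_ge0.
Qed.

Lemma continuous_pos2' : continuous (fun t : R => 2 * Num.max 0 t).
Proof.
rewrite (_ : (fun _ => _) = fun t : R => t + `|t|).
  by apply: continuous_addf => [t|]; [exact: cvg_id|exact: norm_continuous].
apply/funext => t; have [t0|t0] := leP 0 t.
  by rewrite ger0_norm// mulr2n mulrDl mul1r.
by rewrite ltr0_norm// mulr0 subrr.
Qed.

Lemma pos2_ge0 (t : R) : 0 <= pos2 t. Proof. exact: sqr_ge0. Qed.

Lemma pos2_gt0 (t : R) : (0 < pos2 t) = (0 < t).
Proof.
rewrite /pos2; have [t0|t0] := leP t 0; first by rewrite expr0n/= ltxx.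
by rewrite exprn_gt0.
Qed.

Lemma pos2_le1 (t : R) : t <= 1 -> pos2 t <= 1.
Proof.
move=> t1; rewrite /pos2 expr_le1// ?le_max ?lexx// ge_max t1 ler01//.
Qed.

Context {N : nat}.

(** A product over coordinates, because neighbourhoods are sup-norm balls: for [r > 0] the bump is
    positive exactly on such a ball. *)
Definition bump (c : 'rV[R]_N) (r : R) (x : 'rV[R]_N) : R :=
  \prod_(i < N) pos2 (1 - (r^-1 * (x ord0 i - c ord0 i)) ^+ 2).

Lemma C1_bump c r : C1 (bump c r).
Proof.
apply: C1_prod => i; apply: C1_comp; [exact: is_derive_pos2|exact: continuous_pos2'|].
have cl : C1 (fun x : 'rV[R]_N => r^-1 * (x ord0 i - c ord0 i)).
  by apply: C1M; [exact: C1_cst|apply: C1D; [exact: C1_coord|exact: C1_cst]].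
rewrite [X in C1 X](_ : _ = fun x : 'rV[R]_N => 1 + (-1) *
    ((r^-1 * (x ord0 i - c ord0 i)) * (r^-1 * (x ord0 i - c ord0 i)))).
  apply: C1D; first exact: C1_cst.
  by apply: C1M; [exact: C1_cst|exact: C1M].
by apply/funext => x; rewrite expr2 mulN1r.
Qed.

Lemma bump_ge0 c r x : 0 <= bump c r x.
Proof. by apply: prodr_ge0 => i _; exact: pos2_ge0. Qed.

Lemma bump_le1 c r x : bump c r x <= 1.
Proof.
apply: Num.Theory.prodr_ile1 => i _; rewrite pos2_ge0 pos2_le1//.
by rewrite gerBl sqr_ge0.
Qed.

Lemma bump_gt0 c r x : 0 < r -> (0 < bump c r x) = [forall i, `|x ord0 i - c ord0 i| < r].
Proof.
move=> r0.
have E i : (0 < pos2 (1 - (r^-1 * (x ord0 i - c ord0 i)) ^+ 2)) = (`|x ord0 i - c ord0 i| < r).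
  rewrite pos2_gt0 subr_gt0 -(real_normK (num_real (_ * _))) expr_lt1// normrM.
  by rewrite gtr0_norm ?invr_gt0// mulrC ltr_pdivrMr// mul1r.
apply/idP/forallP => [b0 i|xr].
  rewrite -E lt_neqAle pos2_ge0 andbT eq_sym; apply: contraTneq b0 => e.
  by rewrite /bump (bigD1 i)//= e mul0r ltxx.
by apply: prodr_gt0 => i _; rewrite E.
Qed.

End bump.

Section test_functions.
Context {R : realType} {N : nat}.
Implicit Types (Omega U K : set 'rV[R]_N) (phi psi : 'rV[R]_N -> R).

Lemma test_fun_C1 Omega phi : test_fun Omega phi -> C1 phi.
Proof. by case. Qed.

Lemma test_fun_supp Omega phi x : test_fun Omega phi -> ~ Omega x -> phi x = 0.
Proof.
move=> [_ _ _ s] nx; apply: contrapT => /eqP x0; apply/nx/s.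
exact: subset_closure.
Qed.

Lemma test_fun_intro Omega K phi : C1 phi -> compact K -> K `<=` Omega ->
  (forall x, phi x != 0 -> K x) -> test_fun Omega phi.
Proof.
move=> [df cf] cK KO phiK.
have clK : closed K by apply: compact_closed => //; exact: norm_hausdorff.
have sK : closure [set x | phi x != 0] `<=` K.
  by rewrite closureE => x; apply; split.
split => //; last exact: subset_trans KO.
by apply: subclosed_compact cK _ => //; exact: closed_closure.
Qed.

Lemma sub_test_fun Omega U phi : Omega `<=` U -> test_fun Omega phi -> test_fun U phi.
Proof. by move=> OU [? ? ? s]; split => //; exact: subset_trans OU. Qed.

Lemma test_fun0 Omega : test_fun Omega (fun=> 0).
Proof.
apply: (@test_fun_intro _ set0) => //; first exact: C1_cst.
- exact: compact0.
- by move=> x; rewrite eqxx.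
Qed.

Lemma test_funM Omega phi psi : test_fun Omega phi -> C1 psi ->
  test_fun Omega (fun x => phi x * psi x).
Proof.
move=> tphi cpsi; have [_ _ k s] := tphi.
apply: test_fun_intro k s _; first by apply: C1M => //; exact: test_fun_C1 tphi.
move=> x; rewrite mulf_eq0 negb_or => /andP[x0 _]; exact: subset_closure.
Qed.

Lemma test_funD Omega phi psi : test_fun Omega phi -> test_fun Omega psi ->
  test_fun Omega (fun x => phi x + psi x).
Proof.
move=> tphi tpsi; have [_ _ k1 s1] := tphi; have [_ _ k2 s2] := tpsi.
apply: (@test_fun_intro _ (closure [set x | phi x != 0] `|` closure [set x | psi x != 0])).
- by apply: C1D; [exact: test_fun_C1 tphi|exact: test_fun_C1 tpsi].
- exact: compactU.
- by move=> x [/s1|/s2].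
move=> x xx; have [p0|p0] := eqVneq (phi x) 0; last by left; exact: subset_closure.
by right; apply: subset_closure; move: xx; rewrite p0 add0r.
Qed.

Lemma test_fun_bounded Omega phi : test_fun Omega phi -> exists C, forall x, `|phi x| <= C.
Proof.
move=> tphi; have [_ _ k s] := tphi; have cphi := C1_continuous (test_fun_C1 tphi).
have := continuous_compact (continuous_subspaceT cphi) k.
move=> /compact_bounded [M [_ HM]]; exists (Num.max (M + 1) 0) => x.
rewrite le_max; have [->|x0] := eqVneq (phi x) 0; first by rewrite normr0 lexx orbT.
apply/orP; left; apply: (HM (M + 1)); first by rewrite ltrDl.
by exists x => //; exact: subset_closure.
Qed.

Definition cutoff Omega psi := test_fun Omega psi /\ forall x, 0 <= psi x <= 1.

Lemma cutoff0 Omega : cutoff Omega (fun=> 0).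
Proof. by split; [exact: test_fun0|move=> x; rewrite lexx ler01]. Qed.

Lemma sub_cutoff Omega U psi : Omega `<=` U -> cutoff Omega psi -> cutoff U psi.
Proof. by move=> OU [t b]; split => //; exact: sub_test_fun t. Qed.

(** The probabilistic sum, a smooth substitute for the union: it equals 1 as soon as one of the two
    cutoffs does. *)
Lemma cutoff_or Omega phi psi : cutoff Omega phi -> cutoff Omega psi ->
  cutoff Omega (fun x => 1 - (1 - phi x) * (1 - psi x)).
Proof.
move=> [tp bp] [tq bq]; split.
  rewrite (_ : (fun x : 'rV[R]_N => _) = fun x => phi x + psi x * (1 + (-1) * phi x)).
    apply: test_funD => //; apply: test_funM => //.
    apply: C1D; first exact: C1_cst.
    by apply: C1M; [exact: C1_cst|exact: test_fun_C1 tp].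
  by apply/funext => x; ring.
move=> x; have /andP[p0 p1] := bp x; have /andP[q0 q1] := bq x.
by rewrite subr_ge0 gerBl mulr_ge0 ?subr_ge0// mulr_ile1 ?subr_ge0// gerBl.
Qed.

Lemma cutoff_andN Omega phi psi : cutoff Omega phi -> cutoff Omega psi ->
  cutoff Omega (fun x => phi x * (1 - psi x)).
Proof.
move=> [tp bp] [tq bq]; split.
  apply: test_funM => //; rewrite (_ : (fun x : 'rV[R]_N => _) = fun x => 1 + (-1) * psi x).
    apply: C1D; first exact: C1_cst.
    by apply: C1M; [exact: C1_cst|exact: test_fun_C1 tq].
  by apply/funext => x; rewrite mulN1r.
move=> x; have /andP[p0 p1] := bp x; have /andP[q0 q1] := bq x.
by rewrite mulr_ge0 ?subr_ge0// mulr_ile1 ?subr_ge0// gerBl.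
Qed.

Lemma cutoff_ors Omega (I : Type) (s : seq I) (F : I -> 'rV[R]_N -> R) :
  (forall i, cutoff Omega (F i)) -> cutoff Omega (fun x => 1 - \prod_(i <- s) (1 - F i x)).
Proof.
move=> cF; elim: s => [|i s IH].
  by under eq_fun do rewrite big_nil subrr; exact: cutoff0.
have := cutoff_or (cF i) IH.
by under eq_fun do rewrite subKr; under [X in _ -> cutoff _ X]eq_fun do rewrite big_cons.
Qed.

Let ccube (c : 'rV[R]_N) r : set 'rV[R]_N := [set x | forall i, `|x ord0 i - c ord0 i| <= r].

Let compact_ccube c r : compact (ccube c r).
Proof.
have := @rV_compact R N (fun i => `[c ord0 i - r, c ord0 i + r]%classic)
  (fun i => @segment_compact R _ _).
rewrite (_ : [set _ | _] = ccube c r)//.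
by apply/seteqP; split => x /= h i; have := h i; rewrite /= in_itv/= ler_distl.
Qed.

Let cutoff_bump U c r : 0 < r -> ccube c r `<=` U -> cutoff U (bump c r).
Proof.
move=> r0 cU; split; last by move=> x; rewrite bump_ge0 bump_le1.
apply: (test_fun_intro (C1_bump c r) (@compact_ccube c r)) => // x x0.
have : 0 < bump c r x by rewrite lt_neqAle eq_sym x0 bump_ge0.
by rewrite bump_gt0// => /forallP h i; exact/ltW/h.
Qed.

Let basic (qk : 'rV[rat]_N * nat) : 'rV[R]_N := map_mx ratr qk.1.

(** A countable family of bumps supported in [U]; for open [U], one of them is positive at each
    point of [U]. All other codes give 0. *)
Let beta U (j : nat) : 'rV[R]_N -> R :=
  if unpickle j is Some qk then
    if asbool (ccube (basic qk) qk.2.+1%:R^-1 `<=` U) then bump (basic qk) qk.2.+1%:R^-1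
    else fun=> 0
  else fun=> 0.

Let cutoff_beta U j : cutoff U (beta U j).
Proof.
rewrite /beta; case: unpickle => [qk|]; last exact: cutoff0.
case: asboolP => h; last exact: cutoff0.
by apply: cutoff_bump h; rewrite invr_gt0.
Qed.

Let beta_gt0 U x : open U -> U x -> exists j, 0 < beta U j x.
Proof.
move=> oU Ux; have /nbhs_ballP[e /= e0 eU] : nbhs x U by exact: open_nbhs_nbhs.
have e20 : 0 < e / 2 by rewrite divr_gt0.
pose k := Num.bound (e / 2)^-1.
have ke : k.+1%:R^-1 < e / 2.
  rewrite invf_plt ?posrE// (lt_trans (archi_boundP _)) ?ltr_nat//.
  by rewrite invr_ge0 ltW.
have k0 : 0 < k.+1%:R^-1 :> R by rewrite invr_gt0.
have /choice[q qP] : forall i : 'I_N, exists q : rat, `|x ord0 i - ratr q| < k.+1%:R^-1.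
  move=> i; have xx : x ord0 i - k.+1%:R^-1 < x ord0 i + k.+1%:R^-1 by rewrite ltrD2l gtrN.
  have [q] := rat_in_itvoo xx; rewrite in_itv /= => /andP[q1 q2].
  by exists q; rewrite ltr_distlC; apply/andP.
exists (pickle (\row_i q i, k)); rewrite /beta pickleK /= asboolT.
  by rewrite bump_gt0//; apply/forallP => i; rewrite !mxE; exact: qP.
move=> y /= yc; apply: eU; split => // i j; rewrite (ord1 i) /ball/=.
rewrite (le_lt_trans (ler_distD (ratr (q j)) _ _))// (splitr e) ltrD//.
  exact: lt_trans (qP j) ke.
by have := yc j; rewrite !mxE distrC => /le_lt_trans; apply.
Qed.

Lemma cutoff_cvg_indic U : open U -> exists psi : nat -> 'rV[R]_N -> R,
  (forall n, cutoff U (psi n)) /\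
  forall x, (fun n => psi n x) @ \oo --> (\1_U x : R).
Proof.
move=> oU.
(* Here [F n j = 1 - (1 - beta U j) ^+ n], so a single positive [beta U j x] drives the product in
   [psi] to 0 as [n] grows, while every factor is 1 outside [U]. *)
pose F n j x := 1 - \prod_(l < n) (1 - beta U j x).
have cF n j : cutoff U (F n j) by apply: cutoff_ors => _; exact: cutoff_beta.
pose psi n x := 1 - \prod_(j < n) (1 - F n j x).
have cpsi n : cutoff U (psi n) by apply: cutoff_ors.
exists psi; split => // x; rewrite indicE.
have [Ux|nUx] := pselect (U x); last first.
  rewrite memNset//= (_ : (fun n => _) = cst 0); first exact: cvg_cst.
  by apply/funext => n; exact: test_fun_supp (cpsi n).1 nUx.
rewrite mem_set//=; have [j0 b0] := beta_gt0 oU Ux.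
have b1 : beta U j0 x <= 1 by have /andP[] := (cutoff_beta U j0).2 x.
have g0 : (fun n => (1 - beta U j0 x) ^+ n) @ \oo --> (0 : R).
  by apply: cvg_expr; rewrite ger0_norm ?subr_ge0// gtrBl.
have g1 : (fun n => 1 - (1 - beta U j0 x) ^+ n) @ \oo --> (1 : R).
  by rewrite -[X in _ --> X]subr0; apply: cvgB => //; exact: cvg_cst.
apply: (squeeze_cvgr _ g1 (@cvg_cst _ (1 : R) _ _ _)); near=> n.
have /andP[_ ->] := (cpsi n).2 x; rewrite andbT lerD2l lerN2.
have jn : (j0 < n)%N by near: n; exact: nbhs_infty_gt.
have FE j : 1 - F n j x = (1 - beta U j x) ^+ n by rewrite subKr prodr_const card_ord.
rewrite (bigD1 (Ordinal jn))//= FE ler_piMr//.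
  by rewrite exprn_ge0// subr_ge0.
apply: Num.Theory.prodr_ile1 => i _; have /andP[f0 f1] := (cF n i).2 x.
by apply/andP; split; [rewrite subr_ge0|rewrite gerBl].
Unshelve. all: end_near. Qed.

End test_functions.

(** * Density of test functions and test fields for a finite measure *)

Section density.
Context {R : realType} {N : nat}.
Local Notation bN := (borel R N).
Variables (m : {measure set bN -> \bar R}) (Omega : set 'rV[R]_N).
Hypotheses (moo : (m setT < +oo)%E) (oO : open Omega).

Let mO : measurable (Omega : set bN) := open_borel oO.

Let dist (f g : bN -> R) : \bar R := (\int[m]_(x in (Omega : set bN)) (`|f x - g x|)%:E)%E.

Let measurable_dist (f g : bN -> R) (D : set bN) : measurable_fun setT f -> measurable_fun setT g ->
  measurable_fun D (fun x => (`|f x - g x|)%:E).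
Proof.
move=> mf mg; apply/measurable_EFinP; apply: measurable_funTS.
by apply: measurableT_comp => //; exact: measurable_funB.
Qed.

Let dist_le2 (f g f1 g1 f2 g2 : bN -> R) :
  measurable_fun setT f -> measurable_fun setT g ->
  measurable_fun setT f1 -> measurable_fun setT g1 ->
  measurable_fun setT f2 -> measurable_fun setT g2 ->
  (forall x, Omega x -> `|f x - g x| <= `|f1 x - g1 x| + `|f2 x - g2 x|) ->
  (dist f g <= dist f1 g1 + dist f2 g2)%E.
Proof.
move=> mf mg mf1 mg1 mf2 mg2 fg.
rewrite /dist -ge0_integralD//; [|exact: measurable_dist..].
apply: ge0_le_integral => //; first exact: measurable_dist.
by apply: emeasurable_funD; exact: measurable_dist.
Qed.

Let mcutoff psi : cutoff Omega psi -> measurable_fun setT (psi : bN -> R).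
Proof.
by move=> [t _]; apply: continuous_borel_measurable; exact: C1_continuous (test_fun_C1 t).
Qed.

Let approx (F : set bN) := forall e, 0 < e ->
  exists2 psi, cutoff Omega psi & (dist \1_F psi <= e%:E)%E.

Let mI (F : set bN) : measurable F -> measurable_fun setT (\1_F : bN -> R).
Proof. exact: measurable_indic. Qed.

Let dist_cvg0 (f : bN -> R) (g : nat -> bN -> R) e :
  measurable_fun setT f -> (forall n, measurable_fun setT (g n)) ->
  (forall n x, Omega x -> `|f x - g n x| <= 1) ->
  (forall x, Omega x -> (fun n => g n x) @ \oo --> f x) -> 0 < e ->
  exists n, (dist f (g n) <= e%:E)%E.
Proof.
move=> mf mg fg1 gf e0.
have dcv : (fun n => dist f (g n)) @ \oo --> (\int[m]_(x in (Omega : set bN)) 0)%E.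
  apply: (@dominated_cvg _ _ _ m _ mO _ _ (cst 1%E)).
  - by move=> n; exact: measurable_dist.
  - move=> x Ox; apply: cvg_EFin; first exact: nearW.
    have -> : (0 : R) = `|f x - f x| by rewrite subrr normr0.
    by apply: cvg_norm; apply: cvgB; [exact: cvg_cst|exact: gf].
  - by [].
  - apply: (@bounded_integrable _ _ _ _ _ (cst 1) 1) => //; last by move=> x _; rewrite /= normr1.
    by rewrite (le_lt_trans _ moo)// le_measure ?inE.
  - by move=> n x Ox /=; rewrite lee_fin normr_id; exact: fg1.
rewrite integral0 in dcv.
have /fine_cvgP[dfin dlim] := dcv.
have : \forall n \near \oo, (dist f (g n) <= e%:E)%E.
  near=> n; have dn : dist f (g n) \is a fin_num by near: n.
  rewrite -(fineK dn) lee_fin (le_trans (ler_norm _))//.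
  by near: n; move/cvgr0_norm_le : dlim; exact.
by move=> [n _ /(_ n (leqnn n)) H]; exists n.
Unshelve. all: end_near. Qed.

Let approx_open (U : set 'rV[R]_N) : open U -> approx U.
Proof.
move=> oU e e0; have [psi [cpsi psiU]] := cutoff_cvg_indic (openI oU oO).
have cpsiO n : cutoff Omega (psi n) by apply: sub_cutoff (cpsi n) => x [].
have [|||x Ox|n dn] := @dist_cvg0 \1_U psi e _ _ _ _ e0; last by exists (psi n).
- by apply: mI; exact: open_borel.
- by move=> n; exact: mcutoff.
- move=> n x Ox; have /andP[p0 p1] := (cpsi n).2 x.
  by rewrite indicE ler_norml; case: (x \in U) => /=; apply/andP; split; lra.
rewrite (_ : \1_U x = \1_(U `&` Omega) x) ?psiU//.
by rewrite !indicE in_setI (mem_set Ox) andbT.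
Qed.

Let approxC F : measurable F -> approx F -> approx (~` F).
Proof.
move=> mF aF e e0; have e20 : 0 < e / 2 by rewrite divr_gt0.
have [psi cpsi dpsi] := aF _ e20; have [chi cchi dchi] := approx_open openT e20.
(* [1 - psi] need not have compact support; the factor [chi], a cutoff close to 1 in mean, repairs
   this. *)
exists (fun x => chi x * (1 - psi x)); first exact: cutoff_andN.
rewrite [e]splitr EFinD; apply: le_trans (leeD dchi dpsi).
apply: dist_le2 => //; do ?[exact: mcutoff|apply: mI => //; exact: measurableC].
  by apply: mcutoff; exact: cutoff_andN.
move=> x Ox; rewrite !indicE in_setC in_setT/=.
have -> : (x \notin F)%:R = 1 - (x \in F)%:R :> R by case: (x \in F); rewrite ?subrr ?subr0.
have /andP[p0 p1] := cpsi.2 x.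
rewrite (_ : _ - _ = (1 - chi x) * (1 - psi x) - ((x \in F)%:R - psi x)); last by ring.
rewrite (le_trans (ler_normB _ _))// lerD2r normrM ler_piMr// ger0_norm ?subr_ge0//.
by rewrite gerBl.
Qed.

Let approxU F G : measurable F -> measurable G -> approx F -> approx G -> approx (F `|` G).
Proof.
move=> mF mG aF aG e e0; have e20 : 0 < e / 2 by rewrite divr_gt0.
have [psi cpsi dpsi] := aF _ e20; have [chi cchi dchi] := aG _ e20.
exists (fun x => 1 - (1 - psi x) * (1 - chi x)); first exact: cutoff_or.
rewrite [e]splitr EFinD; apply: le_trans (leeD dpsi dchi).
apply: dist_le2 => //; do ?[exact: mcutoff|apply: mI => //; exact: measurableU].
  by apply: mcutoff; exact: cutoff_or.
move=> x Ox; rewrite !indicE in_setU.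
have /andP[p0 p1] := cpsi.2 x; have /andP[c0 c1] := cchi.2 x.
move: (_ \in F) (_ \in G) => p q.
have -> : (p || q)%:R = 1 - (1 - p%:R) * (1 - q%:R) :> R by case: p; case: q => /=; ring.
have f0 : 0 <= 1 - p%:R :> R by rewrite subr_ge0 lern1 leq_b1.
have f1 : 1 - p%:R <= 1 :> R by rewrite gerBl.
rewrite (_ : _ - _ = (p%:R - psi x) * (1 - chi x) + (1 - p%:R) * (q%:R - chi x)); last by ring.
rewrite (le_trans (ler_normD _ _))// lerD// normrM.
  by rewrite ler_piMr// ger0_norm ?subr_ge0// gerBl.
by rewrite ler_piMl// ger0_norm.
Qed.

Let approx_bigcup (F : nat -> set bN) : (forall n, measurable (F n)) -> trivIset setT F ->
  (forall n, approx (F n)) -> approx (\bigcup_n F n).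
Proof.
move=> mF tF aF e e0; have e20 : 0 < e / 2 by rewrite divr_gt0.
have afin n : approx (\big[setU/set0]_(i < n) F i).
  elim: n => [|n IH].
    rewrite big_ord0 => d d0; exists (fun=> 0); first exact: cutoff0.
    rewrite /dist integral0_eq ?lee_fin ?ltW// => x _.
    by rewrite indicE in_set0 subrr normr0.
  rewrite big_ord_recr/=; apply: approxU => //.
  exact: bigsetU_measurable.
have mU : measurable (\bigcup_n F n) by exact: bigcup_measurable.
have mUn n : measurable (\big[setU/set0]_(i < n) F i) by exact: bigsetU_measurable.
have [n dn] : exists n, (dist \1_(\bigcup_n F n) \1_(\big[setU/set0]_(i < n) F i) <= (e / 2)%:E)%E.
  apply: (@dist_cvg0 \1_(\bigcup_n F n) (fun n => \1_(\big[setU/set0]_(i < n) F i)) _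
    (mI mU) (fun n => mI (mUn n)) _ _ e20).
    move=> n x _; rewrite !indicE ler_norml.
    by case: (_ \in _); case: (_ \in _) => /=; apply/andP; split; lra.
  move=> x Ox; rewrite indicE; have [[k _ Fk]|nF] := pselect ((\bigcup_n F n) x).
    rewrite mem_set/=; last by exists k.
    apply: cvg_near_cst; near=> n; rewrite indicE mem_set// -bigcup_mkord.
    by exists k => //=; near: n; exact: nbhs_infty_gt.
  rewrite memNset//; apply: cvg_near_cst; apply: nearW => n.
  rewrite indicE memNset// -bigcup_mkord => -[k _ Fk]; apply: nF; by exists k.
have [psi cpsi dpsi] := afin n _ e20.
exists psi => //; rewrite [e]splitr EFinD; apply: le_trans (leeD dn dpsi).
apply: dist_le2 => //; do ?[exact: mcutoff|exact: mI].
by move=> x _; exact: ler_distD.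
Unshelve. all: end_near. Qed.

(** Dynkin induction from the open sets: the sets approximable in mean by cutoffs are stable under
    complements and countable disjoint unions. *)
Lemma cutoff_dense (F : set bN) e : measurable F -> 0 < e ->
  exists2 psi, cutoff Omega psi &
    (\int[m]_(x in (Omega : set bN)) (`|\1_F x - psi x|)%:E <= e%:E)%E.
Proof.
move=> mF; move: e; apply: (@dynkin_induction _ bN (@open 'rV[R]_N) approx _ _ _ _ _ _ F) => //.
- by move=> A B; exact: openI.
- exact: approx_open openT.
Qed.

End density.

Section simple_approximation.
Context {R : realType} {N p q : nat}.
Local Notation bN := (borel R N).
Implicit Types (a : bN -> 'M[R]_(p, q)).

Definition mxmeasurable a := forall i j, measurable_fun setT (fun x => a x i j : R).

(* The cells are the level sets of the entrywise integer part of [a / delta]. *)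
Lemma oscillation_partition a (delta : R) : mxmeasurable a -> 0 < delta ->
  exists F : nat -> set bN, [/\ forall n, measurable (F n), trivIset setT F,
    \bigcup_n F n = setT &
    forall n x y, F n x -> F n y -> frob (a x - a y) <= (p * q)%:R * delta].
Proof.
move=> ma d0.
pose cell (x : bN) : 'M[int]_(p, q) := \matrix_(i, j) Num.floor (a x i j / delta).
pose F n : set bN := [set x | pickle (cell x) = n].
exists F; split.
- move=> n; rewrite /F.
  case E : (unpickle n : option 'M[int]_(p, q)) => [z|]; last first.
    rewrite (_ : [set _ | _] = set0)//; rewrite -subset0 => x /= xn.
    by move: E; rewrite -xn pickleK.
  have [zn|zn] := eqVneq (pickle z) n; last first.
    rewrite (_ : [set _ | _] = set0)//; rewrite -subset0 => x /= xn.
    by move: zn; rewrite -xn; move: E; rewrite -xn pickleK => -[->]; rewrite eqxx.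
  rewrite (_ : [set _ | _] = \big[setI/setT]_(ij : 'I_p * 'I_q)
      ((fun x => a x ij.1 ij.2) @^-1` `[(z ij.1 ij.2)%:~R * delta, (z ij.1 ij.2 + 1)%:~R * delta[)).
    apply: bigsetI_measurable => ij _.
    exact: (measurable_preimageT (ma ij.1 ij.2)).
  rewrite -bigcap_seq; apply/seteqP; split => x /=.
    move=> xn ij _ /=; have -> : z = cell x by move: E; rewrite -xn pickleK => -[].
    rewrite in_itv/= mxE -ler_pdivlMr// floor_le_tmp -ltr_pdivrMr//.
    by rewrite floorD1_gt.
  move=> H; rewrite -zn; congr pickle; apply/matrixP => i j; rewrite mxE.
  have := H (i, j) (mem_index_enum _); rewrite /= in_itv/= => /andP[h1 h2].
  by apply: floor_def; rewrite ler_pdivlMr// ltr_pdivrMr// h1 h2.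
- by apply/trivIsetP => m n _ _ mn; rewrite -subset0 => x [/= xm xn]; move: mn; rewrite -xm -xn eqxx.
- by rewrite -subTset => x _; exists (pickle (cell x)).
move=> n x y /= xn yn; apply: frob_le_entries => i j; rewrite !mxE.
have /matrixP/(_ i j) : cell x = cell y by apply: (pcan_inj pickleK); rewrite xn yn.
rewrite !mxE => E.
have h1 := floor_le_tmp (a x i j / delta); have h2 := floorD1_gt (a x i j / delta).
have h3 := floor_le_tmp (a y i j / delta); have h4 := floorD1_gt (a y i j / delta).
rewrite -E in h3 h4; rewrite !(ler_pdivlMr, ltr_pdivrMr)// in h1 h2 h3 h4.
rewrite intrD mulrDl mul1r in h2 h4.
rewrite ler_norml; lra.
Qed.

End simple_approximation.

Section field_density.
Context {R : realType} {N p q : nat}.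
Local Notation bN := (borel R N).
Implicit Types (a : bN -> 'M[R]_(p, q)).
Variables (m : {measure set bN -> \bar R}).
Hypothesis moo : (m setT < +oo)%E.

Let mDoo (D : set bN) : measurable D -> (m D < +oo)%E.
Proof. by move=> mD; rewrite (le_lt_trans _ moo)// le_measure ?inE. Qed.

Lemma mxmeasurableB (a b : bN -> 'M[R]_(p, q)) : mxmeasurable a -> mxmeasurable b ->
  mxmeasurable (fun x => a x - b x).
Proof.
by move=> ma mb i j; under eq_fun do rewrite !mxE; exact: measurable_funB.
Qed.

Let measurable_frobB (a b : bN -> 'M[R]_(p, q)) (D : set bN) :
  mxmeasurable a -> mxmeasurable b ->
  measurable_fun D (fun x => (frob (a x - b x))%:E : \bar R).
Proof.
move=> ma mb; apply/measurable_EFinP; apply: measurable_funTS.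
by apply: measurable_frob; exact: mxmeasurableB.
Qed.

Definition step (F : nat -> set bN) (c : nat -> 'M[R]_(p, q)) n (x : bN) : 'M[R]_(p, q) :=
  \sum_(k < n) (\1_(F k) x : R) *: c k.

Lemma step_in F c n k x : trivIset setT F -> F k x -> (k < n)%N -> step F c n x = c k.
Proof.
move=> tF Fk kn; rewrite /step (bigD1 (Ordinal kn))//= indicE mem_set//= scale1r.
rewrite big1 ?addr0// => j jk; rewrite indicE memNset ?scale0r// => Fj.
by move/negP : jk; apply; apply/eqP/val_inj; apply: tF => //; exists x.
Qed.

Lemma step_out F c n x : (forall k, (k < n)%N -> ~ F k x) -> step F c n x = 0.
Proof.
move=> nF; rewrite /step big1// => j _; rewrite indicE memNset ?scale0r//.
exact: nF.
Qed.

Lemma mxmeasurable_step F c n : (forall k, measurable (F k)) -> mxmeasurable (step F c n).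
Proof.
move=> mF i j; rewrite (_ : (fun _ => _) = fun x => \sum_(k < n) \1_(F k) x * c k i j).
  by apply: measurable_sum => k; apply: measurable_funM.
by apply/funext => x; rewrite summxE; apply: eq_bigr => k _; rewrite mxE.
Qed.

Lemma frob_step_le1 F c n x : trivIset setT F -> (forall k, frob (c k) <= 1) ->
  frob (step F c n x) <= 1.
Proof.
move=> tF c1; have [[k [kn Fk]]|nF] := pselect (exists k, (k < n)%N /\ F k x).
  by rewrite (step_in c tF Fk kn).
rewrite step_out ?frob0// => k kn Fk; apply: nF; by exists k.
Qed.

(** On each cell of small oscillation the field is replaced by its value at a point of the cell,
    which preserves the bound 1. The cells are countably many; dominated convergence allows finitely
    many to be kept. *)
Lemma simple_approx a (D : set bN) e : mxmeasurable a -> (forall x, frob (a x) <= 1) ->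
  measurable D -> 0 < e ->
  exists (F : nat -> set bN) (c : nat -> 'M[R]_(p, q)) (n : nat),
    [/\ forall k, measurable (F k), trivIset setT F, \bigcup_k F k = setT,
        forall k, frob (c k) <= 1 &
        (\int[m]_(x in D) (frob (a x - step F c n x))%:E <= e%:E)%E].
Proof.
move=> ma a1 mD e0; pose M : R := fine (m setT) + 1.
have mM : (m D <= M%:E)%E.
  apply: (@le_trans _ _ (m setT)); first by rewrite le_measure ?inE.
  rewrite /M EFinD fineK ?leeDl ?lee_fin//.
  by rewrite ge0_fin_numE.
have M0 : 0 < M by rewrite /M ltr_wpDl// fine_ge0.
pose d := e / 2 / ((p * q)%:R + 1) / M.
have pq0 : 0 < (p * q)%:R + 1 :> R by rewrite ltr_wpDl.
have d0 : 0 < d by rewrite !divr_gt0.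
have [F [mF tF UF Fd]] := oscillation_partition ma d0.
have cP k : exists c, frob c <= 1 /\ forall x, F k x -> frob (a x - c) <= (p * q)%:R * d.
  have [[y Fy]|nF] := pselect (F k !=set0).
    by exists (a y); split => // x Fx; exact: Fd Fx Fy.
  by exists 0; split; [rewrite frob0|move=> x Fx; exfalso; apply: nF; exists x].
have [c cPP] := choice cP; exists F, c.
have c1 k := (cPP k).1; have cF k := (cPP k).2.
pose g n (x : bN) := (frob (a x - step F c n x))%:E : \bar R.
(* The error left when all the cells are kept; the choice of [d] makes its integral at most
   [e / 2]. *)
pose h (x : bN) := lim (g ^~ x @ \oo).
have gh x : (g ^~ x @ \oo --> h x) /\ (h x <= ((p * q)%:R * d)%:E)%E.
  have [k _ Fk] : (\bigcup_k F k) x by rewrite UF.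
  have gc : g ^~ x @ \oo --> (frob (a x - c k))%:E.
    apply: cvg_near_cst; near=> n; rewrite /g (step_in c tF Fk)//.
    by near: n; exact: nbhs_infty_gt.
  by rewrite /h (cvg_lim _ gc)//; split => //; rewrite lee_fin cF.
have mg n : measurable_fun D (g n).
  by apply: measurable_frobB => //; exact: mxmeasurable_step.
have mh : measurable_fun D h.
  apply: (emeasurable_fun_cvg g) => // x _; exact: (gh x).1.
have g2 n x : (g n x <= 2%:E)%E.
  rewrite lee_fin (le_trans (frobD _ _))// frobN -[2]/(1 + 1) lerD//.
  exact: frob_step_le1.
have g0 n x : (0 <= g n x)%E by rewrite lee_fin frob_ge0.
have cv : (\int[m]_(x in D) g n x)%E @[n --> \oo] --> (\int[m]_(x in D) h x)%E.
  apply: (@dominated_cvg _ _ _ m _ mD _ _ (cst 2%:E)) => //.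
  - by move=> x _; exact: (gh x).1.
  - apply: (@bounded_integrable _ _ _ _ _ (cst 2) 2) => //; first exact: mDoo.
    by move=> x _; rewrite /= ger0_norm.
  - by move=> n x _; rewrite gee0_abs.
have ih : (\int[m]_(x in D) h x <= (e / 2)%:E)%E.
  apply: (@le_trans _ _ (\int[m]_(x in D) (((p * q)%:R * d)%:E))%E).
    apply: ge0_le_integral => //; last by move=> x _; exact: (gh x).2.
    by move=> x _; apply: (cvge_ge _ (gh x).1); exact: nearW.
  rewrite integral_cst//; apply: (le_trans (lee_wpmul2l _ mM)).
    by rewrite lee_fin mulr_ge0// ltW.
  rewrite -EFinM lee_fin /d mulrA divfK ?gt_eqF// mulrCA ler_piMr//.
    by rewrite divr_ge0// ltW.
  by rewrite ler_pdivrMr// mul1r lerDl.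
have [n Hn] : exists n, (\int[m]_(x in D) g n x <= e%:E)%E.
  apply: contrapT => /forallNP H; have : (e%:E <= \int[m]_(x in D) h x)%E.
    apply: (cvge_ge _ cv); apply: nearW => n; apply: ltW.
    by have /negP := H n; rewrite -ltNge.
  by move/le_trans => /(_ _ ih); rewrite lee_fin; lra.
by exists n.
Unshelve. all: end_near. Qed.

Definition test_field (Omega : set 'rV[R]_N) (Phi : 'rV[R]_N -> 'M[R]_(p, q)) :=
  (forall i j, test_fun Omega (fun x => Phi x i j)) /\ forall x, frob (Phi x) <= 1.

Lemma test_field_mxmeasurable Omega Phi : test_field Omega Phi -> mxmeasurable (Phi : bN -> _).
Proof.
move=> [tP _] i j; apply: continuous_borel_measurable.
exact: C1_continuous (test_fun_C1 (tP i j)).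
Qed.

(** The cells of a step field are smoothed one at a time. Each stage is a convex combination of the
    previous field and the value on the cell, so the bound 1, on which duality with the total
    variation rests, is never lost. *)
Lemma test_field_dense (Omega : set 'rV[R]_N) a e : open Omega ->
  mxmeasurable a -> (forall x, frob (a x) <= 1) -> 0 < e ->
  exists2 Phi, test_field Omega Phi &
    (\int[m]_(x in (Omega : set bN)) (frob (a x - Phi x))%:E <= e%:E)%E.
Proof.
move=> oO ma a1 e0; have mO := open_borel oO.
have e20 : 0 < e / 2 by rewrite divr_gt0.
have [F [c [n [mF tF UF c1 aFc]]]] := simple_approx ma a1 mO e20.
suff H : forall d, 0 < d -> exists2 Phi, test_field Omega Phi &
    (\int[m]_(x in (Omega : set bN)) (frob (step F c n x - Phi x))%:E <= d%:E)%E.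
  have [Phi tP dP] := H _ e20; exists Phi => //.
  rewrite [e]splitr EFinD; apply: le_trans (leeD aFc dP).
  have mP := test_field_mxmeasurable tP; have ms := mxmeasurable_step c n mF.
  rewrite -ge0_integralD//; [|by move=> x _; rewrite lee_fin frob_ge0|exact: measurable_frobB
    |by move=> x _; rewrite lee_fin frob_ge0|exact: measurable_frobB].
  apply: ge0_le_integral => //; [by move=> x _; rewrite lee_fin frob_ge0|exact: measurable_frobB| |].
    by apply: emeasurable_funD; exact: measurable_frobB.
  by move=> x _; rewrite -EFinD lee_fin frob_distD.
elim: n {aFc} => [|n IH] d d0.
  exists (fun=> 0); first split.
  - by move=> i j; under eq_fun do rewrite mxE; exact: test_fun0.
  - by move=> x; rewrite frob0.
  rewrite integral0_eq ?lee_fin ?ltW// => x _.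
  by rewrite step_out// subrr frob0.
have d20 : 0 < d / 2 by rewrite divr_gt0.
(* The error of the cutoff is multiplied by the distance of two matrices of norm at most 1, in total
   [d / 2 + 2 * (d / 4)]. *)
have d40 : 0 < d / 4 by rewrite divr_gt0.
have [Phi tP dP] := IH _ d20.
have [psi [tpsi psi01] dpsi] := cutoff_dense moo oO (mF n) d40.
have mP := test_field_mxmeasurable tP.
exists (fun x => Phi x + psi x *: (c n - Phi x)); first split.
- move=> i j; under eq_fun do rewrite !mxE.
  apply: test_funD; first exact: tP.1.
  apply: test_funM => //; apply: C1D; first exact: C1_cst.
  under eq_fun do rewrite -mulN1r; apply: C1M; first exact: C1_cst.
  exact: test_fun_C1 (tP.1 i j).
- move=> x; have /andP[p0 p1] := psi01 x.
  rewrite (_ : _ + _ = (1 - psi x) *: Phi x + psi x *: c n); last first.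
    by rewrite scalerBr scalerBl scale1r addrA addrAC.
  rewrite (le_trans (frobD _ _))// !frobZ ger0_norm ?subr_ge0// ger0_norm//.
  have := tP.2 x; have := c1 n; move: (frob _) (frob _) => r s; nra.
have mpsi : measurable_fun setT (psi : bN -> R).
  by apply: continuous_borel_measurable; exact: C1_continuous (test_fun_C1 tpsi).
have md : measurable_fun (Omega : set bN) (fun x : bN => (`|\1_(F n) x - psi x|)%:E : \bar R).
  apply/measurable_EFinP; apply: measurable_funTS; apply: measurableT_comp => //.
  by apply: measurable_funB => //; exact: measurable_indic.
have mP' : mxmeasurable (fun x : bN => Phi x + psi x *: (c n - Phi x)).
  move=> i j; under eq_fun do rewrite !mxE.
  apply: measurable_funD; first exact: mP.
  by apply: measurable_funM => //; apply: measurable_funB.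
apply: (@le_trans _ _ (\int[m]_(x in (Omega : set bN))
    ((frob (step F c n x - Phi x))%:E + 2%:E * (`|\1_(F n) x - psi x|)%:E))%E).
  apply: ge0_le_integral => //.
  - by move=> x _; rewrite lee_fin frob_ge0.
  - by apply: measurable_frobB => //; exact: mxmeasurable_step.
  - apply: emeasurable_funD; first by apply: measurable_frobB => //; exact: mxmeasurable_step.
    exact: measurable_funeM.
  move=> x _; rewrite -EFinM -EFinD lee_fin.
  set s := step F c n x.
  have -> : step F c n.+1 x = (1 - \1_(F n) x) *: s + \1_(F n) x *: c n.
    rewrite /step big_ord_recr/= -/(step F c n x) -/s; congr (_ + _).
    have [Fx|nFx] := pselect (F n x); last by rewrite indicE memNset// subr0 scale1r.
    rewrite indicE mem_set// subrr scale0r /s step_out// => k kn Fk.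
    have kn' : k = n by apply: tF => //; exists x.
    by move: kn; rewrite kn' ltnn.
  rewrite (_ : _ - _ = (1 - psi x) *: (s - Phi x) + (\1_(F n) x - psi x) *: (c n - s)); last first.
    apply/matrixP => i j; rewrite !mxE; ring.
  have /andP[p0 p1] := psi01 x.
  rewrite (le_trans (frobD _ _))// !frobZ; apply: lerD.
    by rewrite ler_piMl ?frob_ge0// ger0_norm ?subr_ge0// gerBl.
  rewrite mulrC ler_wpM2r// (le_trans (frobD _ _))// frobN -[2]/(1 + 1) lerD//.
  exact: frob_step_le1.
rewrite ge0_integralD//; [|by move=> x _; rewrite lee_fin frob_ge0|
  by apply: measurable_frobB => //; exact: mxmeasurable_step|
  exact: measurable_funeM].
rewrite ge0_integralZl//.
apply: (le_trans (leeD dP (lee_wpmul2l _ dpsi))) => //.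
by rewrite -EFinM -EFinD lee_fin; lra.
Qed.

End field_density.

(** * Signed measures and total variation *)

Section charge_integral.
Context {R : realType} {N : nat}.
Local Notation bN := (borel R N).
Implicit Types (nu : {charge set bN -> \bar R}) (p q : {measure set bN -> \bar R}).
Implicit Types (f g : bN -> R) (D : set bN).

Let boundedf f := exists C : R, forall x, `|f x| <= C.

Lemma bounded_integrableT p D f : (p setT < +oo)%E -> measurable D ->
  measurable_fun setT f -> boundedf f -> p.-integrable D (EFin \o f).
Proof.
move=> poo mD mf [C fC]; apply: (@bounded_integrable _ _ _ _ _ _ C) => //.
- by rewrite (le_lt_trans _ poo)// le_measure ?inE.
- exact: measurable_funTS.
Qed.

Lemma charge_Rintegral_jordan nu : exists p q,
  [/\ (p setT < +oo)%E, (q setT < +oo)%E,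
    forall A, measurable A -> nu A = (p A - q A)%E &
    forall D f, charge_Rintegral nu D f = \int[p]_(x in D) f x - \int[q]_(x in D) f x].
Proof.
rewrite /charge_Rintegral; set hP := cid (Hahn_decomposition nu).
set nuPN := svalP (cid (svalP hP)); exists (jordan_pos nuPN), (jordan_neg nuPN); split => //.
- by rewrite ltey_eq fin_num_measure.
- by rewrite ltey_eq fin_num_measure.
- by move=> A mA; rewrite (jordan_decomp nuPN mA) /cadd/= cscaleN1.
Qed.

Lemma measure_diff_charge p q : (p setT < +oo)%E -> (q setT < +oo)%E ->
  exists nu, forall A, measurable A -> nu A = (p A - q A)%E.
Proof.
move=> poo qoo.
have finP (r : {measure set bN -> \bar R}) : (r setT < +oo)%E -> fin_num_fun r.
  move=> roo A mA; rewrite ge0_fin_numE// (le_lt_trans _ roo)// le_measure ?inE//.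
have charge_of (r : {measure set bN -> \bar R}) : (r setT < +oo)%E ->
    {nu : {charge set bN -> \bar R} | forall A, nu A = r A}.
  move=> roo; pose f A := r A.
  have f0 : f set0 = 0%E by exact: measure0.
  have ff : fin_num_fun f by exact: finP.
  have fs : semi_sigma_additive f by exact: measure_semi_sigma_additive.
  pose nu : {charge set bN -> \bar R} := HB.pack f (isCharge.Build _ _ _ f f0 ff fs).
  by exists nu.
have [fp fpE] := charge_of p poo; have [fq fqE] := charge_of q qoo.
exists (cadd fp (copp fq)) => A mA.
by rewrite -fpE -fqE.
Qed.

Let RintegralD_measure p q D f : (p setT < +oo)%E -> (q setT < +oo)%E -> measurable D ->
  measurable_fun setT f -> boundedf f ->
  \int[measure_add p q]_(x in D) f x = \int[p]_(x in D) f x + \int[q]_(x in D) f x.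
Proof.
move=> poo qoo mD mf bf.
have ip := bounded_integrableT poo mD mf bf.
have iq := bounded_integrableT qoo mD mf bf.
rewrite /Rintegral integral_measure_add// fineD//; exact: integrable_fin_num.
Qed.

(** Two decompositions [p - q] and [p' - q'] of the same charge satisfy [p' + q = p + q'], and
    integrals of bounded functions add over measures. *)
Lemma charge_Rintegral_diff nu p q D f : (p setT < +oo)%E -> (q setT < +oo)%E ->
  (forall A, measurable A -> nu A = (p A - q A)%E) -> measurable D ->
  measurable_fun setT f -> boundedf f ->
  charge_Rintegral nu D f = \int[p]_(x in D) f x - \int[q]_(x in D) f x.
Proof.
move=> poo qoo nupq mD mf bf.
have [p' [q' [poo' qoo' nupq' ->]]] := charge_Rintegral_jordan nu.
suff : \int[measure_add p' q]_(x in D) f x = \int[measure_add p q']_(x in D) f x.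
  by rewrite !RintegralD_measure//; lra.
rewrite /Rintegral; congr fine; apply: eq_measure_integral => A mA _.
transitivity (p' A + q A)%E; first exact: measure_addE.
transitivity (p A + q' A)%E; last exact/esym/measure_addE.
have := nupq A mA; rewrite (nupq' A mA).
have fn (r : {measure set bN -> \bar R}) : (r setT < +oo)%E -> r A \is a fin_num.
  by move=> roo; rewrite ge0_fin_numE// (le_lt_trans _ roo)// le_measure ?inE.
have := fn _ poo; have := fn _ qoo; have := fn _ poo'; have := fn _ qoo'.
move: (p A) (q A) (p' A) (q' A) => [a| |] [b| |] [c| |] [d| |]//= _ _ _ _ [].
by rewrite -!EFinD => e; congr EFin; lra.
Qed.

Lemma charge_RintegralD nu D f g : measurable D -> measurable_fun setT f -> boundedf f ->
  measurable_fun setT g -> boundedf g ->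
  charge_Rintegral nu D (fun x => f x + g x) = charge_Rintegral nu D f + charge_Rintegral nu D g.
Proof.
move=> mD mf bf mg bg; have [p [q [poo qoo _ H]]] := charge_Rintegral_jordan nu.
by rewrite !H !RintegralD//; [lra|exact: bounded_integrableT..].
Qed.

Lemma charge_RintegralZ nu D f (c : R) : measurable D -> measurable_fun setT f -> boundedf f ->
  charge_Rintegral nu D (fun x => c * f x) = c * charge_Rintegral nu D f.
Proof.
move=> mD mf bf; have [p [q [poo qoo _ H]]] := charge_Rintegral_jordan nu.
by rewrite !H !RintegralZl//; [lra|exact: bounded_integrableT..].
Qed.

Lemma charge_Rintegral_indic nu D A : measurable D -> measurable A ->
  charge_Rintegral nu D \1_A = fine (nu (A `&` D)).
Proof.
move=> mD mA; have [p [q [poo qoo nuE ->]]] := charge_Rintegral_jordan nu.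
have mAD : measurable (A `&` D) by exact: measurableI.
rewrite nuE// /Rintegral !integral_indic// fineB//.
  by rewrite ge0_fin_numE// (le_lt_trans _ poo)// le_measure ?inE.
by rewrite ge0_fin_numE// (le_lt_trans _ qoo)// le_measure ?inE.
Qed.

Let ge0_integral_add_le p q D (f : bN -> \bar R) : measurable D ->
  (forall x, 0 <= f x)%E -> measurable_fun D f ->
  (\int[p]_(x in D) f x <= \int[measure_add p q]_(x in D) f x /\
   \int[q]_(x in D) f x <= \int[measure_add p q]_(x in D) f x)%E.
Proof.
move=> mD f0 mf; rewrite ge0_integral_measure_add//; split.
  by rewrite leeDl// integral_ge0.
by rewrite leeDr// integral_ge0.
Qed.

(** The sum of all Jordan parts. With a single dominating measure, one approximation in mean
    controls every entry of a matrix of charges. *)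
Lemma charges_dominated (I : finType) (nu : I -> {charge set bN -> \bar R}) :
  exists2 m : {measure set bN -> \bar R}, (m setT < +oo)%E &
  forall i D f, measurable D -> measurable_fun setT f -> boundedf f ->
    `|charge_Rintegral (nu i) D f| <= \int[m]_(x in D) `|f x|.
Proof.
have sdom i : exists2 m : {measure set bN -> \bar R}, (m setT < +oo)%E &
    forall D f, measurable D -> measurable_fun setT f -> boundedf f ->
      `|charge_Rintegral (nu i) D f| <= \int[m]_(x in D) `|f x|.
  have [p [q [poo qoo _ H]]] := charge_Rintegral_jordan (nu i).
  exists (measure_add p q); first by rewrite [ltLHS]measure_addE lte_add_pinfty.
  move=> D f mD mf bf; rewrite H.
  have mnf : measurable_fun setT (fun x => `|f x|) by exact: measurableT_comp.
  have bnf : boundedf (fun x => `|f x|).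
    by case: bf => C fC; exists C => x; rewrite normr_id.
  rewrite RintegralD_measure// (le_trans (ler_normB _ _))// lerD//.
    exact: (le_normr_Rintegral mD (bounded_integrableT poo mD mf bf)).
  exact: (le_normr_Rintegral mD (bounded_integrableT qoo mD mf bf)).
have [m mP] := choice (fun i => let: ex_intro2 a b c := sdom i in ex_intro _ a (conj b c)).
suff [M Moo MP] : exists2 M : {measure set bN -> \bar R}, (M setT < +oo)%E &
    forall i, i \in enum I -> forall D (f : bN -> \bar R), measurable D ->
    (forall x, 0 <= f x)%E -> measurable_fun D f ->
    (\int[m i]_(x in D) f x <= \int[M]_(x in D) f x)%E.
  exists M => // i D f mD mf bf.
  have mnf : measurable_fun setT (fun x => `|f x|) by exact: measurableT_comp.
  have bnf : boundedf (fun x => `|f x|).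
    by case: bf => C fC; exists C => x; rewrite normr_id.
  apply: (le_trans ((mP i).2 D f mD mf bf)); apply: fine_le.
  - exact: integrable_fin_num (bounded_integrableT (mP i).1 mD mnf bnf).
  - exact: integrable_fin_num (bounded_integrableT Moo mD mnf bnf).
  apply: MP => //; first by rewrite mem_enum.
  by apply/measurable_EFinP; exact: measurable_funTS.
elim: (enum I) => [|i s [M Moo MP]]; first by exists mzero; rewrite //= /mzero ltry.
exists (measure_add (m i) M).
  by rewrite [ltLHS]measure_addE lte_add_pinfty//; exact: (mP i).1.
move=> j; rewrite inE => /predU1P[->|js] D f mD f0 mf.
  by have [] := ge0_integral_add_le (m i) M mD f0 mf.
by apply: (le_trans (MP j js D f mD f0 mf)); have [] := ge0_integral_add_le (m i) M mD f0 mf.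
Qed.

End charge_integral.

Section duality.
Context {R : realType} {N p q : nat}.
Local Notation bN := (borel R N).
Variables (Omega : set 'rV[R]_N) (oO : open Omega).
Variables (mu : @matrix_charge R N p q) (w : 'rV[R]_N).
Implicit Types (A B : bN -> 'M[R]_(p, q)).

Let mO : measurable (Omega : set bN) := open_borel oO.

(** The integral over [Omega] of [A] against the matrix-valued measure [directional mu w], in the
    Frobenius inner product. *)
Definition field_pairing A : R :=
  \sum_i \sum_j \sum_k w ord0 k * charge_Rintegral (mu i j k) Omega (fun x => A x i j).

Let nice A := mxmeasurable A /\ exists C : R, forall x, frob (A x) <= C.

Let nice_entry A i j : nice A -> measurable_fun setT (fun x => A x i j) /\
  exists C : R, forall x, `|A x i j| <= C.
Proof.
by move=> [mA [C AC]]; split => //; exists C => x; rewrite (le_trans (entry_le_frob _ _ _)).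
Qed.

Let niceD A B : nice A -> nice B -> nice (fun x => A x + B x).
Proof.
move=> [mA [C AC]] [mB [D BD]]; split; last first.
  by exists (C + D) => x; rewrite (le_trans (frobD _ _))// lerD.
by move=> i j; under eq_fun do rewrite mxE; exact: measurable_funD.
Qed.

Let niceZ c A : nice A -> nice (fun x => c *: A x).
Proof.
move=> [mA [C AC]]; split; last first.
  by exists (`|c| * C) => x; rewrite frobZ ler_wpM2l.
by move=> i j; under eq_fun do rewrite mxE; exact: measurable_funM.
Qed.

Let pairingD A B : nice A -> nice B ->
  field_pairing (fun x => A x + B x) = field_pairing A + field_pairing B.
Proof.
move=> nA nB; rewrite /field_pairing -big_split; apply: eq_bigr => i _.
rewrite -big_split; apply: eq_bigr => j _; rewrite -big_split; apply: eq_bigr => k _ /=.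
under [X in charge_Rintegral _ _ X]eq_fun do rewrite mxE.
have [mA bA] := nice_entry i j nA; have [mB bB] := nice_entry i j nB.
by rewrite charge_RintegralD// mulrDr.
Qed.

Let pairingZ c A : nice A -> field_pairing (fun x => c *: A x) = c * field_pairing A.
Proof.
move=> nA; rewrite /field_pairing mulr_sumr; apply: eq_bigr => i _.
rewrite mulr_sumr; apply: eq_bigr => j _; rewrite mulr_sumr; apply: eq_bigr => k _ /=.
under [X in charge_Rintegral _ _ X]eq_fun do rewrite mxE.
have [mA bA] := nice_entry i j nA.
by rewrite charge_RintegralZ// mulrCA.
Qed.

Let K : R := \sum_(i < p) \sum_(j < q) \sum_k `|w ord0 k|.

Let K_ge0 : 0 <= K.
Proof. by do 3![apply: sumr_ge0 => ? _]. Qed.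

Let dom : {m : {measure set bN -> \bar R} | (m setT < +oo)%E /\
  forall A, nice A -> `|field_pairing A| <= K * \int[m]_(x in (Omega : set bN)) frob (A x)}.
Proof.
apply: cid.
have [m moo mP] := charges_dominated (fun ijk : 'I_p * 'I_q * 'I_N => mu ijk.1.1 ijk.1.2 ijk.2).
exists m; split => // A nA; have [mA [C AC]] := nA.
have mf : measurable_fun setT (fun x => frob (A x)) by exact: measurable_frob.
have inf : m.-integrable (Omega : set bN) (EFin \o (fun x => frob (A x))).
  by apply: bounded_integrableT => //; exists C => x; rewrite ger0_norm ?frob_ge0.
rewrite /field_pairing /K mulr_suml (le_trans (ler_norm_sum _ _ _))//.
apply: ler_sum => i _; rewrite mulr_suml (le_trans (ler_norm_sum _ _ _))//.
apply: ler_sum => j _; rewrite mulr_suml (le_trans (ler_norm_sum _ _ _))//.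
apply: ler_sum => k _; rewrite normrM ler_wpM2l//.
have [mij bij] := nice_entry i j nA.
apply: (le_trans (mP (i, j, k) Omega (fun x => A x i j) mO mij bij)).
apply: le_Rintegral => //.
- apply: bounded_integrableT => //; first exact: measurableT_comp.
  by case: bij => D AD; exists D => x; rewrite normr_id.
- by move=> x _; exact: entry_le_frob.
Qed.

Let m := sval dom.
Let moo : (m setT < +oo)%E := (svalP dom).1.

Let pairing_le A : nice A -> `|field_pairing A| <= K * \int[m]_(x in (Omega : set bN)) frob (A x).
Proof. exact: (svalP dom).2. Qed.

Let pairing_dist A B e : nice A -> nice B ->
  (\int[m]_(x in (Omega : set bN)) (frob (A x - B x))%:E <= e%:E)%E ->
  field_pairing A <= field_pairing B + K * e.
Proof.
move=> nA nB dAB; rewrite -lerBlDl.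
have nNB := niceZ (-1) nB; have nAB := niceD nA nNB.
have <- : field_pairing (fun x => A x + -1 *: B x) = field_pairing A - field_pairing B.
  by rewrite pairingD// pairingZ// mulN1r.
rewrite (le_trans (ler_norm _))// (le_trans (pairing_le nAB))// ler_wpM2l//.
rewrite -lee_fin; apply: le_trans dAB; rewrite /Rintegral fineK.
  by under eq_integral do rewrite scaleN1r.
apply: integrable_fin_num => //; apply: bounded_integrableT => //.
  by apply: measurable_frob => i j; exact: (nice_entry i j nAB).1.
by case: nAB => _ [C HC]; exists C => x; rewrite ger0_norm ?frob_ge0.
Qed.

Let nice_step F c n : (forall k, measurable (F k)) -> trivIset setT F ->
  (forall k, frob (c k) <= 1) -> nice (step F c n).
Proof.
move=> mF tF c1; split; first exact: mxmeasurable_step.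
by exists 1 => x; exact: frob_step_le1.
Qed.

Let pairing_step F c n : (forall k, measurable (F k)) ->
  field_pairing (step F c n) = \sum_(l < n) mxdot (c l) (directional mu w (F l `&` Omega)).
Proof.
move=> mF.
have n1 (l : nat) : nice (fun x => (\1_(F l) x : R) *: c l).
  split; last first.
    exists (frob (c l)) => x; rewrite frobZ indicE; case: (_ \in _) => /=.
      by rewrite normr1 mul1r.
    by rewrite normr0 mul0r frob_ge0.
  by move=> i j; under eq_fun do rewrite mxE; exact: measurable_funM.
elim: n => [|n IH].
  rewrite big_ord0 (_ : step F c 0 = fun x => 0 *: (0 : 'M[R]_(p, q))).
    rewrite (pairingZ 0 (A := fun=> 0)) ?mul0r//.
    split; last by exists 0 => x; rewrite frob0.
    by move=> i j; rewrite (_ : (fun _ => _) = cst 0)//; apply/funext => x; rewrite mxE.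
  by apply/funext => x; rewrite /step big_ord0 scale0r.
rewrite big_ord_recr/= -IH (_ : step F c n.+1 = fun x => step F c n x + (\1_(F n) x : R) *: c n).
  rewrite pairingD//; last first.
    split; first exact: mxmeasurable_step.
    exists (\sum_(l < n) frob (c l)) => x; rewrite /step (le_trans (frob_sum _ _ _))//.
    apply: ler_sum => l _; rewrite frobZ ler_piMl ?frob_ge0// indicE.
    by case: (_ \in _); rewrite ?normr1 ?normr0.
  congr (_ + _); rewrite /field_pairing /mxdot; apply: eq_bigr => i _; apply: eq_bigr => j _.
  rewrite mxE mulr_sumr; apply: eq_bigr => k _.
  under [X in charge_Rintegral _ _ X]eq_fun do rewrite mxE mulrC.
  rewrite charge_RintegralZ//; last by exists 1 => x; rewrite indicE; case: (_ \in _); rewrite ?normr1 ?normr0.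
  by rewrite charge_Rintegral_indic// mulrCA.
by apply/funext => x; rewrite /step big_ord_recr.
Qed.

(** For finitely many cells of a partition, the sum of the norms is the pairing with the step field
    of normalised values of the measure, and test fields approximate that step field in mean. *)
Lemma total_variation_le (C : R) : 0 <= C ->
  (forall Phi, test_field Omega Phi -> field_pairing Phi <= C) ->
  (Defs.total_variation (directional mu w) Omega <= C%:E)%E.
Proof.
move=> C0 HC; apply: ge_ereal_sup => _ [F [mF tF UF] <-].
have FO k : F k `&` Omega = F k by apply/setIidPl; rewrite -UF; exact: bigcup_sup.
apply: lime_le.
  by apply: is_cvg_nneseries => k _ _; rewrite lee_fin frob_ge0.
apply: nearW => n; rewrite big_mkord sumEFin lee_fin.
pose c k := (frob (directional mu w (F k)))^-1 *: directional mu w (F k).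
have c1 k : frob (c k) <= 1.
  rewrite /c frobZ ger0_norm ?invr_ge0 ?frob_ge0//.
  have [->|h] := eqVneq (frob (directional mu w (F k))) 0; first by rewrite mulr0.
  by rewrite mulVf.
have -> : \sum_(k < n) frob (directional mu w (F k)) = field_pairing (step F c n).
  rewrite pairing_step//; apply: eq_bigr => k _; rewrite FO /c mxdotZl mxdotAA.
  have [->|h] := eqVneq (frob (directional mu w (F k))) 0; first by rewrite invr0 mul0r.
  by rewrite expr2 mulKf.
apply/ler_addgt0Pr => e e0.
(* [K + 1] rather than [K], which may vanish. *)
have e'0 : 0 < e / (K + 1) by rewrite divr_gt0// ltr_wpDl.
have ns := nice_step n mF tF c1.
have [Phi tP dP] := test_field_dense moo oO ns.1 (fun x => frob_step_le1 n x tF c1) e'0.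
have nP : nice Phi.
  by split; [exact: test_field_mxmeasurable tP|exists 1 => x; exact: tP.2].
apply: (le_trans (pairing_dist ns nP dP)); apply: lerD; first exact: HC.
rewrite mulrCA ler_piMr// ?(ltW e0)// ler_pdivrMr ?ltr_wpDl// mul1r lerDl//.
Qed.

(** With [Phi] replaced by a step field the pairing is a finite sum over cells, and Cauchy-Schwarz
    on each cell bounds it by the sum for a partition of [Omega]. *)
Lemma total_variation_ge Phi : test_field Omega Phi ->
  ((field_pairing Phi)%:E <= Defs.total_variation (directional mu w) Omega)%E.
Proof.
move=> tP; have nP : nice Phi.
  by split; [exact: test_field_mxmeasurable tP|exists 1 => x; exact: tP.2].
apply/lee_addgt0Pr => e e0.
have e'0 : 0 < e / (K + 1) by rewrite divr_gt0// ltr_wpDl.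
have [F [c [n [mF tF UF c1 dF]]]] := simple_approx moo nP.1 tP.2 mO e'0.
have ns := nice_step n mF tF c1.
have := pairing_dist nP ns dF; rewrite pairing_step// -lee_fin => /le_trans; apply.
rewrite EFinD; apply: leeD; last first.
  rewrite lee_fin mulrCA ler_piMr// ?(ltW e0)// ler_pdivrMr ?ltr_wpDl// mul1r lerDl//.
apply: (@le_trans _ _ (\sum_(k <oo) (frob (directional mu w (F k `&` Omega)))%:E)%E).
  apply: le_trans (nneseries_lim_ge n _); last by move=> k _ _; rewrite lee_fin frob_ge0.
  rewrite big_mkord sumEFin lee_fin; apply: ler_sum => k _.
  by rewrite (le_trans (mxdot_le_frob _ _))// ler_piMl ?frob_ge0.
apply: ereal_sup_ubound; exists (fun k => F k `&` Omega) => //; split.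
- by move=> k; exact: measurableI.
- by apply: trivIset_setIr.
- by rewrite -setI_bigcupl UF setTI.
Qed.

Lemma total_variation_lty : (Defs.total_variation (directional mu w) Omega < +oo)%E.
Proof.
pose C := K * \int[m]_(x in (Omega : set bN)) (1 : R).
have i1 : m.-integrable (Omega : set bN) (EFin \o (fun=> 1 : R)).
  by apply: bounded_integrableT => //; exists 1 => x; rewrite normr1.
have C0 : 0 <= C by rewrite mulr_ge0// Rintegral_ge0.
apply: (@le_lt_trans _ _ C%:E); last by rewrite ltry.
apply: total_variation_le => // Phi tP.
have nP : nice Phi.
  by split; [exact: test_field_mxmeasurable tP|exists 1 => x; exact: tP.2].
rewrite (le_trans (ler_norm _))// (le_trans (pairing_le nP))// ler_wpM2l//.
apply: le_Rintegral => //; last by move=> x _; exact: tP.2.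
apply: bounded_integrableT => //; first exact: measurable_frob nP.1.
by exists 1 => x; rewrite ger0_norm ?frob_ge0//; exact: tP.2.
Qed.

End duality.

(** * Difference quotients *)

Section directional_derivative.
Context {R : realType} {N : nat}.
Implicit Types (phi : 'rV[R]_N -> R) (w x : 'rV[R]_N) (U : set 'rV[R]_N).

Definition dirD w phi x : R := \sum_k w ord0 k * partial k phi x.

Lemma dirDE w phi x : differentiable phi x -> 'D_w phi x = dirD w phi x.
Proof.
move=> d; rewrite deriveE// {1}(row_sum_delta w) linear_sum/=; apply: eq_bigr => k _.
by rewrite linearZ/= /partial deriveE.
Qed.

Lemma dirDN w phi x : dirD (- w) phi x = - dirD w phi x.
Proof. by rewrite /dirD -sumrN; apply: eq_bigr => k _; rewrite mxE mulNr. Qed.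

Lemma dirD_delta k phi x : dirD (delta_mx ord0 k) phi x = partial k phi x.
Proof.
rewrite /dirD (bigD1 k)//= mxE !eqxx mul1r big1 ?addr0// => j jk.
by rewrite mxE eqxx/= (negbTE jk) mul0r.
Qed.

Lemma is_derive_translate w phi x (s : R) : C1 phi ->
  is_derive s (1 : R) (fun s => phi (x + s *: w)) (dirD w phi (x + s *: w)).
Proof.
move=> [d _]; set y := x + s *: w.
have e : (fun h : R => h^-1 *: (phi (x + (h *: (1 : R) + s) *: w) - phi y)) =
         (fun h => h^-1 *: (phi (h *: w + y) - phi y)).
  apply/funext => h; congr (_ *: (phi _ - _)).
  by rewrite [h *: 1]mulr1 /y scalerDl addrCA.
apply: DeriveDef; first by rewrite /derivable e; apply: diff_derivable.
by rewrite /derive e -dirDE.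
Qed.

Lemma partial_supp k phi x : ~ closure [set y | phi y != 0] x -> partial k phi x = 0.
Proof.
move=> nx; rewrite /partial (near_eq_derive _ (g := fun=> 0)); first by rewrite derive_cst.
have oC : open (~` closure [set y | phi y != 0]) by apply: closed_openC; exact: closed_closure.
have : \forall y \near x, (~` closure [set y | phi y != 0]) y by exact: open_nbhs_nbhs.
apply: filterS => y ny; apply: contrapT => /eqP y0; apply: ny; exact: subset_closure.
Qed.

Lemma dirD_supp w phi x : ~ closure [set y | phi y != 0] x -> dirD w phi x = 0.
Proof. by move=> nx; rewrite /dirD big1// => k _; rewrite partial_supp ?mulr0. Qed.

Lemma compact_supp_bounded (f : 'rV[R]_N -> R) (K : set 'rV[R]_N) : continuous f ->
  compact K -> (forall x, f x != 0 -> K x) -> exists C, forall x, `|f x| <= C.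
Proof.
move=> cf cK fK; have := continuous_compact (continuous_subspaceT cf) cK.
move=> /compact_bounded [M [_ HM]]; exists (Num.max (M + 1) 0) => x.
rewrite le_max; have [->|x0] := eqVneq (f x) 0; first by rewrite normr0 lexx orbT.
apply/orP; left; apply: (HM (M + 1)); first by rewrite ltrDl.
by exists x => //; exact: fK.
Qed.

Lemma partial_bounded U phi : test_fun U phi ->
  exists2 L, 0 <= L & forall k x, `|partial k phi x| <= L.
Proof.
move=> [_ cp cK _].
have /choice[L LP] : forall k : 'I_N, exists L, forall x, `|partial k phi x| <= L.
  move=> k; apply: compact_supp_bounded cK _ => // x x0.
  by apply: contrapT => /(partial_supp k) e; rewrite e eqxx in x0.
exists (\sum_k `|L k|); first by apply: sumr_ge0.
move=> k x; rewrite (le_trans (LP k x))// (le_trans (ler_norm _))//.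
by rewrite (bigD1 k)//= lerDl sumr_ge0.
Qed.

Lemma dirD_bounded w U phi : test_fun U phi ->
  exists2 L, 0 <= L & forall x, `|dirD w phi x| <= L.
Proof.
move=> /partial_bounded[L L0 HL]; exists (\sum_k `|w ord0 k| * L).
  by apply: sumr_ge0 => k _; rewrite mulr_ge0.
move=> x; rewrite (le_trans (ler_norm_sum _ _ _))//; apply: ler_sum => k _.
by rewrite normrM ler_wpM2l.
Qed.

Lemma dirD_measurable w phi : C1 phi -> measurable_fun setT (dirD w phi : borel R N -> R).
Proof.
move=> [_ cp]; apply: measurable_sum => k; apply: measurable_funM => //.
exact: continuous_borel_measurable.
Qed.

Lemma test_fun_in_cube U phi : test_fun U phi ->
  exists2 r : R, 0 < r & closure [set x | phi x != 0] `<=` cube R N r.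
Proof.
move=> [_ _ /compact_bounded[M [_ HM]] _]; exists (`|M| + 2).
  by rewrite ltr_wpDl.
move=> x /(HM (`|M| + 1)) H i; rewrite (le_lt_trans (coord_le_norm x i))//.
by rewrite (le_lt_trans (H _)) ?ltrD2l ?ltr1n// (le_lt_trans (ler_norm _))// ltrDl.
Qed.

End directional_derivative.

Section leb_pairing.
Context {R : realType} {N : nat}.
Local Notation bN := (borel R N).
Local Notation leb := (leb R N).
Implicit Types (v f : bN -> R) (w : 'rV[R]_N).

Lemma Rintegral_shift w f : measurable_fun setT f ->
  \int[leb]_x f ((x : 'rV_N) + w) = \int[leb]_x f x.
Proof.
move=> mf; rewrite /Rintegral; congr fine; rewrite integralE [RHS]integralE.
have mE : measurable_fun setT (EFin \o f) by exact/measurable_EFinP.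
have mp : measurable_fun setT (EFin \o f)^\+%E by exact: measurable_funepos.
have mn : measurable_fun setT (EFin \o f)^\-%E by exact: measurable_funeneg.
have := @ge0_integral_shift R N w _ mp (fun x => funepos_ge0 _ x).
have := @ge0_integral_shift R N w _ mn (fun x => funeneg_ge0 _ x).
move=> en ep; transitivity (\int[leb]_x (EFin \o f)^\+ x - \int[leb]_x (EFin \o f)^\- x)%E => //.
by rewrite -en -ep; congr (_ - _)%E; apply: eq_integral => x _; rewrite ?funeposE ?funenegE.
Qed.

Lemma integrable_cube f r C : 0 < r -> measurable_fun setT f -> (forall x, `|f x| <= C) ->
  (forall x, f x != 0 -> cube R N r x) -> leb.-integrable setT (EFin \o f).
Proof.
move=> r0 mf fC fr; have mc := @cube_measurable R N r r0.
rewrite (_ : EFin \o f = (EFin \o f) \_ (cube R N r)).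
  rewrite -integrable_mkcond//; apply: (@bounded_integrable _ _ _ _ _ _ C) => //.
    by rewrite [ltLHS](leb_cube N r0) ltry.
  exact: measurable_funTS.
apply/funext => x; rewrite patchE; case: ifPn => // /negP xr /=.
by congr EFin; apply: contrapT => /eqP/fr xc; apply: xr; rewrite inE.
Qed.

Lemma measurable_translate f w : measurable_fun setT f ->
  measurable_fun setT (fun x : bN => f ((x : 'rV_N) + w)).
Proof. by move=> mf; exact: (measurableT_comp mf (measurable_rv_shift w)). Qed.

Lemma cube_translate r (w x : 'rV[R]_N) (s : R) : cube R N r (x + s *: w) ->
  cube R N (r + `|s| * `|w|) x.
Proof.
move=> xr i; have -> : x ord0 i = (x + s *: w) ord0 i - (s *: w) ord0 i by rewrite !mxE addrK.
by rewrite (le_lt_trans (ler_normB _ _))// ltr_leD// -normrZ coord_le_norm.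
Qed.

Lemma pairing_integrable v C U phi w (s : R) : measurable_fun setT v ->
  (forall x, `|v x| <= C) -> test_fun U phi ->
  leb.-integrable setT (fun x => (v x * phi ((x : 'rV_N) + s *: w))%:E) /\
  leb.-integrable setT (fun x => (v x * dirD w phi ((x : 'rV_N) + s *: w))%:E).
Proof.
move=> mv vC tphi; have C0 : 0 <= C by rewrite (le_trans (normr_ge0 _) (vC 0)).
have [r r0 supp] := test_fun_in_cube tphi.
have [A HA] := test_fun_bounded tphi; have [L L0 HL] := dirD_bounded w tphi.
have A0 : 0 <= A by rewrite (le_trans (normr_ge0 _) (HA 0)).
have cphi := test_fun_C1 tphi.
have r'0 : 0 < r + `|s| * `|w| by rewrite ltr_pwDl// mulr_ge0.
have mphi : measurable_fun setT (phi : bN -> R).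
  by apply: continuous_borel_measurable; exact: C1_continuous.
split.
  apply: (@integrable_cube _ (r + `|s| * `|w|) (C * A)) => //.
  - by apply: measurable_funM => //; exact: measurable_translate.
  - by move=> x; rewrite normrM ler_pM.
  - move=> x; rewrite mulf_eq0 negb_or => /andP[_ x0]; apply: cube_translate.
    by apply: supp; exact: subset_closure.
apply: (@integrable_cube _ (r + `|s| * `|w|) (C * L)) => //.
- by apply: measurable_funM => //; apply: (@measurable_translate (dirD w phi)); exact: dirD_measurable.
- by move=> x; rewrite normrM ler_pM.
- move=> x; rewrite mulf_eq0 negb_or => /andP[_ x0]; apply: cube_translate.
  by apply: supp; apply: contrapT => /(dirD_supp w) e; rewrite e eqxx in x0.
Qed.

(** Differentiation under the integral sign; the derivative falls on [phi], since [v] is merely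
    bounded and measurable. *)
Lemma is_derive_pairing v C U phi w (s : R) : measurable_fun setT v ->
  (forall x, `|v x| <= C) -> test_fun U phi ->
  is_derive s (1 : R) (fun s => \int[leb]_x (v x * phi ((x : 'rV_N) + s *: w)))
    (\int[leb]_x (v x * dirD w phi ((x : 'rV_N) + s *: w))).
Proof.
move=> mv vC tphi; have C0 : 0 <= C by rewrite (le_trans (normr_ge0 _) (vC 0)).
have [r r0 supp] := test_fun_in_cube tphi.
have [L L0 HL] := dirD_bounded w tphi; have cphi := test_fun_C1 tphi.
pose f (s : R) (x : bN) := v x * phi ((x : 'rV_N) + s *: w).
have df t x : is_derive t (1 : R) (f^~ x) (v x * dirD w phi ((x : 'rV_N) + t *: w)).
  apply: (is_derive_eq (is_deriveM (is_derive_cst (v x) t 1) (is_derive_translate w x t cphi))).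
  by rewrite scaler0 addr0.
(* A cube containing the supports of all translates whose parameter is within 1 of [s], so that one
   dominating function serves them all. *)
pose r' := r + (`|s| + 1) * `|w|.
have r'0 : 0 < r' by rewrite ltr_pwDl// mulr_ge0// addr_ge0.
pose G (x : bN) : R := C * L * \1_(cube R N r') x.
have mc := @cube_measurable R N r' r'0.
have G0 x : 0 <= G x by rewrite mulr_ge0// mulr_ge0.
have iG : leb.-integrable setT (EFin \o G).
  apply: (@integrable_cube _ r' (C * L)) => //.
  - by apply: measurable_funM => //; exact: measurable_indic.
  - by move=> x; rewrite ger0_norm// /G ler_piMr ?mulr_ge0.
  - by move=> x; rewrite /G indicE; case: (boolP (x \in _)); [rewrite inE|rewrite mulr0 eqxx].
have Is : `]s - 1, s + 1[%classic s by rewrite /= in_itv/= ltrBlDr ltrDl ltr01.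
have intf t : `]s - 1, s + 1[%classic t -> leb.-integrable setT (EFin \o f t).
  by move=> _; exact: (pairing_integrable w t mv vC tphi).1.
have derf t x : `]s - 1, s + 1[%classic t -> setT x -> derivable (f^~ x) t 1.
  by move=> _ _; have [] := df t x.
have d1E t x : partial1of2 f t x = v x * dirD w phi ((x : 'rV_N) + t *: w).
  by rewrite partial1of2E; exact: (@derive_val _ _ _ _ _ _ _ (df t x)).
have Gub t x : `]s - 1, s + 1[%classic t -> setT x -> `|partial1of2 f t x| <= G x.
  rewrite /= in_itv/= => /andP[ts1 ts2] _; rewrite d1E /G indicE normrM.
  case: (boolP (x \in _)) => xr; first by rewrite mulr1 ler_pM.
  suff -> : dirD w phi ((x : 'rV_N) + t *: w) = 0 by rewrite normr0 !mulr0.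
  apply: dirD_supp => /supp /cube_translate xc; move/negP: xr; apply; rewrite inE => i.
  rewrite (lt_le_trans (xc i))// lerD2l ler_wpM2r//.
  rewrite -lerBlDl (le_trans (lerB_dist _ _))// ler_distl; apply/andP; split; lra.
have H1 := derivable_under_integral measurableT Is intf derf G0 iG Gub.
have H2 := differentiation_under_integral measurableT Is intf derf G0 iG Gub.
apply: DeriveDef; first exact: H1.
rewrite -derive1E H2; apply: eq_Rintegral => x _; exact: d1E.
Qed.

End leb_pairing.

(** * Exhaustion of an open set *)

Section exhaustion.
Context {R : realType} {N : nat}.
Implicit Types (Omega K : set 'rV[R]_N).

(** Compact subsets of [Omega]. The sup-norm margin [1 / j.+1] to the complement is what
    translations are allowed to consume. *)
Definition inner Omega (j : nat) : set 'rV[R]_N :=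
  [set x | `|x| <= j%:R /\ forall y, ~ Omega y -> j.+1%:R^-1 <= `|x - y|].

(** The interior is taken because test fields are approximated on open sets; for open [Omega] every
    compact part eventually lies in it. *)
Definition core Omega j : set 'rV[R]_N := interior (inner Omega j).

Lemma inner_closed Omega j : closed (inner Omega j).
Proof.
have -> : inner Omega j = (fun x => `|x|) @^-1` [set t | t <= j%:R] `&`
    \bigcap_(y in ~` Omega) ((fun x => `|x - y|) @^-1` [set t | j.+1%:R^-1 <= t]).
  by apply/seteqP; split => x /= [].
apply: closedI; first by apply: closed_comp => [x _|]; [exact: norm_continuous|exact: closed_le].
apply: closed_bigI => y _; apply: closed_comp => [x _|]; last exact: closed_ge.
have cB : {for x, continuous (fun x : 'rV[R]_N => x - y)}.
  exact: (@cvgB R 'rV[R]_N _ (nbhs x) _ id (fun=> y) x y cvg_id (cvg_cst _)).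
by apply: (@continuous_comp _ _ _ (fun x : 'rV[R]_N => x - y) (fun z => `|z|) x) => //;
  exact: norm_continuous.
Qed.

Lemma inner_compact Omega j : compact (inner Omega j).
Proof.
apply: bounded_closed_compact; last exact: inner_closed.
exists j%:R; split; first exact: num_real.
by move=> M jM x [xj _] /=; exact: le_trans xj (ltW jM).
Qed.

Lemma inner_sub Omega j : inner Omega j `<=` Omega.
Proof.
move=> x [_ H]; apply: contrapT => /H; rewrite subrr normr0 leNgt.
by rewrite invr_gt0 ltr0n.
Qed.

Lemma inner_mono Omega j k : (j <= k)%N -> inner Omega j `<=` inner Omega k.
Proof.
move=> jk x [xj H]; split; first by rewrite (le_trans xj)// ler_nat.
by move=> y /H; apply: le_trans; rewrite lef_pV2 ?posrE ?ltr0n// ler_nat.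
Qed.

Lemma core_open Omega j : open (core Omega j).
Proof. exact: open_interior. Qed.

Lemma core_inner Omega j : core Omega j `<=` inner Omega j.
Proof. exact: interior_subset. Qed.

Lemma core_sub Omega j : core Omega j `<=` Omega.
Proof. exact: subset_trans (@core_inner _ _) (@inner_sub _ _). Qed.

Lemma core_mono Omega j k : (j <= k)%N -> core Omega j `<=` core Omega k.
Proof. by move=> jk x; apply: filterS; exact: inner_mono. Qed.

Lemma core_translate Omega j x h : core Omega j x -> `|h| < j.+1%:R^-1 -> Omega (x + h).
Proof.
move=> /core_inner[_ H] hj; apply: contrapT => /H.
by rewrite opprD addNKr normrN leNgt hj.
Qed.

Lemma bigcup_core Omega : open Omega -> \bigcup_j core Omega j = Omega.
Proof.
move=> oO; apply/seteqP; split => [x [j _]|x Ox]; first exact: core_sub.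
have /nbhs_ballP[e /= e0 eO] : nbhs x Omega by exact: open_nbhs_nbhs.
have e20 : 0 < e / 2 by rewrite divr_gt0.
pose j := (Num.bound (e / 2)^-1 + Num.bound (`|x| + e / 2))%N.
have je : j.+1%:R^-1 <= e / 2.
  rewrite invf_ple ?posrE ?ltr0n// ltW// (lt_le_trans (archi_boundP _)) ?ler_nat//.
    by rewrite invr_ge0 ltW.
  by rewrite -addnS leq_addr.
exists j => //; apply/nbhs_ballP; exists (e / 2) => //= y.
rewrite -ball_normE/= => xy; split.
  rewrite -(subrK x y) (le_trans (ler_normD _ _))// addrC.
  rewrite (le_trans (lerD (lexx _) (ltW _)) (ltW (lt_le_trans (archi_boundP (x := `|x| + e / 2) _) _)))//.
  - by rewrite distrC.
  - by rewrite addr_ge0// ltW.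
  - by rewrite ler_nat leq_addl.
move=> z nz; rewrite leNgt; apply/negP => yz; apply/nz/eO.
rewrite -ball_normE/= -(subrKA y) (le_lt_trans (ler_normD _ _))// (splitr e) ltrD//.
exact: lt_le_trans je.
Qed.

Lemma compact_sub_core Omega K : open Omega -> compact K -> K `<=` Omega ->
  exists J, forall j, (J <= j)%N -> K `<=` core Omega j.
Proof.
move=> oO cK; rewrite -{1}(bigcup_core oO) => KO.
have := cK; rewrite compact_cover => /(_ _ setT (core Omega) (fun j _ => @core_open Omega j) KO)[D _ KD].
exists (\max_(i <- finmap.enum_fset D) i)%N => j Dj x /KD[i /= iD xi].
by apply: core_mono xi; rewrite (leq_trans _ Dj)//; exact: leq_bigmax_seq.
Qed.

Lemma leb_core_lty Omega j : (leb R N (core Omega j) < +oo)%E.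
Proof.
have j0 : 0 < j.+1%:R :> R by rewrite ltr0n.
apply: (@le_lt_trans _ _ (leb R N (cube R N j.+1%:R))).
  apply: le_measure; rewrite ?inE//.
  - by apply: open_borel; exact: core_open.
  - exact: cube_measurable.
  - move=> x /core_inner[xj _] i; rewrite (le_lt_trans (coord_le_norm x i))//.
    by rewrite (le_lt_trans xj)// ltr_nat.
by rewrite [ltLHS](leb_cube N j0) ltry.
Qed.

End exhaustion.

Lemma le_limn_einf (R : realType) (u : nat -> \bar R) (c : \bar R) (J : nat) :
  (forall j, (J <= j)%N -> (c <= u j)%E) -> (c <= limn_einf u)%E.
Proof.
move=> cu; rewrite limn_einf_lim; apply: lime_ge; first exact: is_cvg_einfs.
exists J => // n /= Jn; apply: le_ereal_inf_tmp => _ [k /= nk <-].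
by apply: cu; exact: leq_trans nk.
Qed.

Section Rintegral_sum.
Context d (X : measurableType d) (R : realType) (m : {measure set X -> \bar R}).

Lemma Rintegral_sum (I : Type) (s : seq I) (D : set X) (f : I -> X -> R) :
  measurable D -> (forall i, m.-integrable D (EFin \o f i)) ->
  m.-integrable D (EFin \o (fun x => \sum_(i <- s) f i x)) /\
  \int[m]_(x in D) (\sum_(i <- s) f i x) = \sum_(i <- s) \int[m]_(x in D) f i x.
Proof.
move=> mD fi; elim: s => [|i s [IH1 IH2]].
  rewrite big_nil (_ : (fun _ => _) = cst 0); last by apply/funext => x; rewrite big_nil.
  by split; [exact: integrable0|rewrite Rintegral_cst// mul0r].
rewrite big_cons (_ : (fun _ => _) = fun x => f i x + \sum_(k <- s) f k x).
  by split; [exact: (integrableD mD (fi i) IH1)|rewrite RintegralD// IH2].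
by apply/funext => x; rewrite big_cons.
Qed.

End Rintegral_sum.

Section shifted_test_functions.
Context {R : realType} {N : nat}.
Implicit Types (phi : 'rV[R]_N -> R) (a w x : 'rV[R]_N) (U : set 'rV[R]_N).

Lemma partial_shift k phi a x : partial k (fun y => phi (y + a)) x = partial k phi (x + a).
Proof.
rewrite /partial /derive (_ : (fun h => _) = (fun h : R =>
  h^-1 *: ((phi \o shift (x + a)) (h *: delta_mx ord0 k) - phi (x + a))))//.
by apply/funext => h; rewrite /= addrA.
Qed.

Lemma dirD_shift w phi a x : dirD w (fun y => phi (y + a)) x = dirD w phi (x + a).
Proof. by rewrite /dirD; apply: eq_bigr => k _; rewrite partial_shift. Qed.

Lemma continuous_shiftr a : continuous (fun x : 'rV[R]_N => x + a).
Proof. by move=> x; exact: (@cvgD R 'rV[R]_N _ (nbhs x) _ id (fun=> a) x a cvg_id (cvg_cst _)). Qed.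

Lemma test_fun_shift U Omega phi a : (forall x, U x -> Omega (x - a)) ->
  test_fun U phi -> test_fun Omega (fun x => phi (x + a)).
Proof.
move=> UO tphi; have [df cp ck cs] := tphi.
apply: (@test_fun_intro _ _ _ ((fun x => x - a) @` closure [set x | phi x != 0])).
- split => [x|k].
    apply: (@differentiable_comp _ _ _ _ (fun y : 'rV[R]_N => y + a) phi) => //.
  rewrite (_ : partial k _ = fun x => partial k phi (x + a)).
    move=> x; apply: (@continuous_comp _ _ _ (fun y : 'rV[R]_N => y + a) (partial k phi)).
      exact: continuous_shiftr.
    exact: cp.
  by apply/funext => x; exact: partial_shift.
- apply: continuous_compact => //; apply: continuous_subspaceT; exact: continuous_shiftr.
- by move=> _ [x /cs Ux <-]; exact: UO.
- by move=> x x0; exists (x + a); rewrite ?addrK//; exact: subset_closure.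
Qed.

End shifted_test_functions.

Section translation_estimates.
Context {R : realType} {N p q : nat}.
Local Notation bN := (borel R N).
Local Notation leb := (leb R N).
Variables (v : bN -> 'M[R]_(p, q)) (C : R).
Hypotheses (mv : mxmeasurable v) (vC : forall x, frob (v x) <= C).
Implicit Types (w : 'rV[R]_N) (Phi : 'rV[R]_N -> 'M[R]_(p, q)) (Omega U : set 'rV[R]_N).

Definition tdist w (D : set bN) (t : R) : \bar R :=
  (\int[leb]_(x in D) (frob (v ((x : 'rV_N) + t *: w)%R - v x))%:E)%E.

Let C0 : 0 <= C. Proof. exact: le_trans (frob_ge0 _) (vC 0). Qed.

Let vCij i j x : `|v x i j| <= C.
Proof. by rewrite (le_trans (entry_le_frob _ _ _)). Qed.

Let mvt w t : mxmeasurable (fun x : bN => v ((x : 'rV_N) + t *: w)).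
Proof. by move=> i j; apply: (@measurable_translate _ _ (fun x => v x i j)); exact: mv. Qed.

Let delta w t (x : bN) := v ((x : 'rV_N) + t *: w) - v x.

Let mdelta w t : mxmeasurable (delta w t).
Proof. exact: mxmeasurableB (mvt w t) mv. Qed.

Let delta_le w t x : frob (delta w t x) <= C + C.
Proof. by rewrite (le_trans (frobD _ _))// frobN lerD. Qed.

(** The translation is put on [Phi], which makes [h] differentiable although [v] is not. *)
Let h w Phi (s : R) := \sum_i \sum_j \int[leb]_x (v x i j * Phi ((x : 'rV_N) + s *: (- w)) i j).

Let int0 (f : bN -> R) D U phi : measurable_fun setT f -> (forall x, `|f x| <= D) ->
  test_fun U phi -> leb.-integrable setT (EFin \o (fun x => f x * phi x)).
Proof.
move=> mf fD tphi; have := (pairing_integrable 0 0 mf fD tphi).1.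
by rewrite /comp; under eq_fun do rewrite scale0r addr0.
Qed.

(** Invariance of Lebesgue measure moves the shift back onto [v]: an increment of [h] tests the
    increment of [v]. *)
Let h_translate w Phi U t : test_field U Phi ->
  leb.-integrable setT (EFin \o (fun x => mxdot (Phi x) (delta w t x))) /\
  h w Phi t - h w Phi 0 = \int[leb]_x mxdot (Phi x) (delta w t x).
Proof.
move=> [tP _].
have md i j : measurable_fun setT (fun x => delta w t x i j) := mdelta w t i j.
have bd i j x : `|delta w t x i j| <= C + C by rewrite (le_trans (entry_le_frob _ _ _)).
have intd i j : leb.-integrable setT (EFin \o (fun x => Phi x i j * delta w t x i j)).
  rewrite (_ : (fun _ => _) = fun x => delta w t x i j * Phi x i j).
    exact: int0 (md i j) (bd i j) (tP i j).
  by apply/funext => x; rewrite mulrC.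
have [H1 H2] := Rintegral_sum (index_enum 'I_p) measurableT
  (fun i => (Rintegral_sum (index_enum 'I_q) measurableT (fun j => intd i j)).1).
split; first exact: H1.
rewrite /mxdot [RHS]H2 /h -sumrB; apply: eq_bigr => i _.
rewrite [RHS](Rintegral_sum (index_enum 'I_q) measurableT (fun j => intd i j)).2.
rewrite -sumrB; apply: eq_bigr => j _.
have iP := int0 (mv i j) (vCij i j) (tP i j).
have iPt := int0 (mvt w t i j) (fun x => vCij i j _) (tP i j).
have -> : \int[leb]_x (v x i j * Phi ((x : 'rV_N) + t *: - w) i j) =
    \int[leb]_x (v ((x : 'rV_N) + t *: w) i j * Phi x i j).
  rewrite -(@Rintegral_shift _ _ (t *: w) (fun x => v x i j * Phi ((x : 'rV_N) + t *: - w) i j)).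
    by apply: eq_Rintegral => x _; rewrite scalerN addrK.
  apply: measurable_funM; first exact: mv.
  apply: (@measurable_translate _ _ (fun x => Phi x i j)).
  by apply: continuous_borel_measurable; exact: C1_continuous (test_fun_C1 (tP i j)).
have -> : \int[leb]_x (v x i j * Phi ((x : 'rV_N) + 0 *: - w) i j) = \int[leb]_x (v x i j * Phi x i j).
  by apply: eq_Rintegral => x _; rewrite scale0r addr0.
rewrite -RintegralB//; apply: eq_Rintegral => x _.
by rewrite !mxE -mulrBl mulrC.
Qed.

Let is_derive_h w Phi U (s : R) : test_field U Phi ->
  is_derive s (1 : R) (h w Phi) (\sum_i \sum_j
    \int[leb]_x (v x i j * dirD (- w) (fun y => Phi y i j) ((x : 'rV_N) + s *: (- w)))).
Proof.
move=> [tP _].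
rewrite (_ : h w Phi = \sum_i \sum_j (fun s =>
    \int[leb]_x (v x i j * Phi ((x : 'rV_N) + s *: (- w)) i j))); last first.
  by apply/funext => t; rewrite fct_sumE; apply: eq_bigr => i _; rewrite fct_sumE.
apply: is_derive_sum => i; apply: is_derive_sum => j.
exact: (is_derive_pairing (- w) s (mv i j) (vCij i j) (tP i j)).
Qed.

Lemma field_pairingE w Omega mu Phi : open Omega -> is_Du Omega v mu -> test_field Omega Phi ->
  field_pairing Omega mu w Phi =
  - \sum_i \sum_j \int[leb]_x (v x i j * dirD w (fun y => Phi y i j) x).
Proof.
move=> oO Dv [tP _]; rewrite /field_pairing -sumrN; apply: eq_bigr => i _.
rewrite -sumrN; apply: eq_bigr => j _.
have ip k : leb.-integrable setT (EFin \o (fun x => v x i j * partial k (fun y => Phi y i j) x)).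
  have := (pairing_integrable (delta_mx ord0 k) 0 (mv i j) (vCij i j) (tP i j)).2.
  by rewrite /comp; under eq_fun do rewrite scale0r addr0 dirD_delta.
have iwp k : leb.-integrable setT
    (EFin \o (fun x => w ord0 k * (v x i j * partial k (fun y => Phi y i j) x))).
  by have := integrableZl measurableT (w ord0 k) (ip k).
have -> : \int[leb]_x (v x i j * dirD w (fun y => Phi y i j) x) =
    \int[leb]_x (\sum_k w ord0 k * (v x i j * partial k (fun y => Phi y i j) x)).
  by apply: eq_Rintegral => x _; rewrite mulr_sumr; apply: eq_bigr => k _; rewrite mulrCA.
rewrite (Rintegral_sum (index_enum 'I_N) measurableT iwp).2 -sumrN; apply: eq_bigr => k _.
rewrite RintegralZl// -mulrN; congr (_ * _).
apply: oppr_inj; rewrite opprK -Dv//.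
rewrite [LHS](Rintegral_mkcond leb (Omega : set bN)); apply: eq_Rintegral => x _; rewrite patchE.
case: ifPn => // /negP; rewrite inE => nx; rewrite partial_supp ?mulr0//.
by have [_ _ _ s] := tP i j; move/s.
Qed.

Let test_field_translate w Phi U Omega s : (forall x, U x -> Omega (x + s *: w)) ->
  test_field U Phi -> test_field Omega (fun x => Phi (x + s *: (- w))).
Proof.
move=> UO [tP P1]; split => [i j|x]; last exact: P1.
apply: (test_fun_shift _ (tP i j)) => x Ux; rewrite scalerN opprK; exact: UO.
Qed.

(** While the translated support stays in [Omega], the derivative is the pairing of [Du] with
    another test field, so the total variation controls it uniformly in [s]. *)
Let h_derive_pairing w Omega mu Phi U s : open Omega -> is_Du Omega v mu ->
  (forall x, U x -> Omega (x + s *: w)) -> test_field U Phi ->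
  is_derive s (1 : R) (h w Phi) (field_pairing Omega mu w (fun x => Phi (x + s *: (- w)))).
Proof.
move=> oO Dv UO tP; apply: (is_derive_eq (is_derive_h w s tP)).
rewrite (field_pairingE w oO Dv (test_field_translate UO tP)) -sumrN; apply: eq_bigr => i _.
rewrite -sumrN; apply: eq_bigr => j _.
rewrite -mulN1r -RintegralZl//; last first.
  rewrite /comp; under eq_fun do rewrite (dirD_shift w (fun y => Phi y i j)) -[dirD _ _ _]opprK -dirDN mulrN EFinN.
  have := (pairing_integrable (- w) s (mv i j) (vCij i j) (tP.1 i j)).2.
  exact: integrableN.
apply: eq_Rintegral => x _.
by rewrite (dirD_shift w (fun y => Phi y i j)) dirDN mulN1r mulrN.
Qed.

(* The L^1 norm of the increment is computed by duality against test fields, on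
   which the increment is the integral of a pairing with Du. *)
Lemma tdist_le w Omega mu j t : open Omega -> is_Du Omega v mu -> 0 < t ->
  t * `|w| < j.+1%:R^-1 ->
  (tdist w (core Omega j) t <= t%:E * Defs.total_variation (directional mu w) Omega)%E.
Proof.
move=> oO Dv t0 tw.
have tv_ge Phi (tP : test_field Omega Phi) := total_variation_ge oO mu w tP.
have tv_lty := total_variation_lty oO mu w.
have tf0 : test_field Omega (fun=> 0 : 'M[R]_(p, q)).
  split => [i k|x]; last by rewrite frob0.
  by under eq_fun do rewrite mxE; exact: test_fun0.
have tv_fin : Defs.total_variation (directional mu w) Omega \is a fin_num.
  by rewrite fin_real// tv_lty andbT (lt_le_trans _ (tv_ge _ tf0))// ltNyr.
pose T := fine (Defs.total_variation (directional mu w) Omega).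
have tvT : Defs.total_variation (directional mu w) Omega = T%:E by rewrite fineK.
rewrite tvT -EFinM.
have pT Phi : test_field Omega Phi -> field_pairing Omega mu w Phi <= T.
  by move=> tP; rewrite -lee_fin -tvT; exact: tv_ge.
have coreO s : 0 <= s <= t -> forall x, core Omega j x -> Omega (x + s *: w).
  move=> /andP[s0 st] x cx; apply: (core_translate cx); rewrite normrZ ger0_norm//.
  by apply: le_lt_trans tw; rewrite ler_wpM2r.
(* By the mean value theorem the increment is [t] times one pairing with a translate of [Phi], still
   a test field on [Omega] thanks to the margin. *)
have hT Phi : test_field (core Omega j) Phi -> h w Phi t - h w Phi 0 <= t * T.
  move=> tP; have hd s : 0 <= s <= t -> is_derive s (1 : R) (h w Phi)
      (field_pairing Omega mu w (fun x => Phi (x + s *: (- w)))).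
    by move=> st; exact: h_derive_pairing oO Dv (coreO s st) tP.
  have hd' s : s \in `]0, t[ -> is_derive s (1 : R) (h w Phi)
      (field_pairing Omega mu w (fun x => Phi (x + s *: (- w)))).
    by rewrite in_itv/= => /andP[? ?]; apply: hd; rewrite !ltW.
  have [|c] := MVT t0 hd'.
    apply: derivable_within_continuous => s; rewrite in_itv/= => s0t.
    by have [] := hd s s0t.
  rewrite in_itv/= subr0 => /andP[c0 ct] ->; rewrite mulrC ler_pM2l//.
  by apply: pT; apply: test_field_translate tP; apply: coreO; rewrite !ltW.
have mD : measurable (core Omega j : set bN) by apply: open_borel; exact: core_open.
pose m : {measure set bN -> \bar R} := mrestr leb mD.
have moo : (m setT < +oo)%E by rewrite [ltLHS]/=/mrestr setTI; exact: leb_core_lty.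
have mE (f : bN -> \bar R) :
    (\int[leb]_(x in (core Omega j : set bN)) f x = \int[m]_(x in (core Omega j : set bN)) f x)%E.
  by apply: eq_measure_integral => A mA AD; rewrite [RHS]/=/mrestr setIidl.
(* The direction of the increment is the optimal field: its inner product with the increment is the
   norm. It is only measurable, so a test field approximates it. *)
pose a (x : bN) := (frob (delta w t x))^-1 *: delta w t x.
have mfd : measurable_fun setT (fun x => frob (delta w t x)).
  by apply: measurable_frob => i k; exact: mdelta.
have ma : mxmeasurable a.
  move=> i k; under eq_fun do rewrite mxE; apply: measurable_funM; last exact: mdelta.
  rewrite (_ : (fun _ => _) = fun x => frob (delta w t x) `^ (-1)).
    exact: (measurableT_comp (measurable_powR _) mfd).
  by apply/funext => x; rewrite powR_inv1 ?frob_ge0.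
have a1 x : frob (a x) <= 1.
  rewrite /a frobZ ger0_norm ?invr_ge0 ?frob_ge0//.
  have [->|d0] := eqVneq (frob (delta w t x)) 0; first by rewrite mulr0.
  by rewrite mulVf.
have adot x : mxdot (a x) (delta w t x) = frob (delta w t x).
  rewrite /a mxdotZl mxdotAA.
  have [->|d0] := eqVneq (frob (delta w t x)) 0; first by rewrite expr0n/= mulr0.
  by rewrite expr2 mulKf.
have bI (f : bN -> R) B : measurable_fun setT f -> (forall x, `|f x| <= B) ->
    m.-integrable (core Omega j : set bN) (EFin \o f).
  by move=> mf fB; apply: bounded_integrableT => //; exists B.
have ifd : m.-integrable (core Omega j : set bN) (EFin \o (fun x => frob (delta w t x))).
  by apply: (bI _ (C + C)) => // x; rewrite ger0_norm ?frob_ge0.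
rewrite /tdist mE -/(delta w t) -[leLHS]fineK; last exact: integrable_fin_num ifd.
rewrite lee_fin; apply/ler_addgt0Pr => e e0.
have e'0 : 0 < e / (C + C + 1) by rewrite divr_gt0// ltr_wpDl// addr_ge0.
have [Phi tP dP] := test_field_dense moo (@core_open _ _ Omega j) ma a1 e'0.
have mP := test_field_mxmeasurable tP.
have mmxdot (A : bN -> 'M[R]_(p, q)) : mxmeasurable A ->
    measurable_fun setT (fun x => mxdot (A x) (delta w t x)).
  move=> mA; apply: measurable_sum => i; apply: measurable_sum => k.
  by apply: measurable_funM; [exact: mA|exact: mdelta].
have mfaP : measurable_fun setT (fun x => frob (a x - Phi x)).
  by apply: measurable_frob; exact: mxmeasurableB.
have faP x : frob (a x - Phi x) <= 1 + 1.
  by rewrite (le_trans (frobD _ _))// frobN lerD//; exact: tP.2.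
have iP : m.-integrable (core Omega j : set bN) (EFin \o (fun x => mxdot (Phi x) (delta w t x))).
  apply: (bI _ (C + C)); first exact: mmxdot.
  move=> x; rewrite (le_trans (normr_mxdot_le _ _))// -[leRHS]mul1r ler_pM ?frob_ge0//; exact: tP.2.
have iaP : m.-integrable (core Omega j : set bN) (EFin \o (fun x => frob (a x - Phi x))).
  by apply: (bI _ (1 + 1)) => // x; rewrite ger0_norm ?frob_ge0.
have iaP' : m.-integrable (core Omega j : set bN)
    (EFin \o (fun x => (C + C) * frob (a x - Phi x))).
  by have := integrableZl mD (C + C) iaP.
apply: (@le_trans _ _ (\int[m]_(x in (core Omega j : set bN))
    (mxdot (Phi x) (delta w t x) + (C + C) * frob (a x - Phi x)))).
  apply: le_Rintegral => //; first exact: (integrableD mD iP iaP').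
  move=> x _; rewrite -/(delta w t x) -adot -{1}(subrK (Phi x) (a x)) mxdotDl addrC lerD2l.
  by rewrite (le_trans (mxdot_le_frob _ _))// mulrC ler_wpM2r ?frob_ge0.
rewrite RintegralD// lerD//.
  have [_ <-//] : (m.-integrable (core Omega j : set bN) (EFin \o (fun x => mxdot (Phi x) (delta w t x))) /\
    h w Phi t - h w Phi 0 = \int[m]_(x in (core Omega j : set bN)) mxdot (Phi x) (delta w t x)).
    split => //; rewrite (h_translate w t tP).2 [RHS]/Rintegral -mE; congr fine.
    rewrite [RHS]integral_mkcond; apply: eq_integral => x _; rewrite patchE.
    case: ifPn => // /negP; rewrite inE => nx; congr EFin.
    rewrite /mxdot big1// => i _; rewrite big1// => k _.
    by rewrite (test_fun_supp (tP.1 i k) nx) mul0r.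
  exact: hT.
rewrite RintegralZl//.
have : \int[m]_(x in (core Omega j : set bN)) frob (a x - Phi x) <= e / (C + C + 1).
  by rewrite -lee_fin; apply: le_trans dP; rewrite /Rintegral fineK//; exact: integrable_fin_num iaP.
move=> /(ler_wpM2l (addr_ge0 C0 C0)) /le_trans; apply.
by rewrite mulrCA ler_piMr ?(ltW e0)// ler_pdivrMr ?ltr_wpDl ?addr_ge0// mul1r lerDl.
Qed.

Let h_le_tdist w Phi (D : set bN) t U : test_field U Phi -> measurable D -> U `<=` D ->
  ((h w Phi t - h w Phi 0)%:E <= tdist w D t)%E.
Proof.
move=> tP mD UD; have [iP ->] := h_translate w t tP.
rewrite /Rintegral fineK; last exact: integrable_fin_num iP.
have -> : (\int[leb]_x (mxdot (Phi x) (delta w t x))%:E =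
    \int[leb]_(x in D) (mxdot (Phi x) (delta w t x))%:E)%E.
  rewrite [RHS]integral_mkcond; apply: eq_integral => x _; rewrite patchE.
  case: ifPn => // /negP; rewrite inE => nx; congr EFin.
  rewrite /mxdot big1// => i _; rewrite big1// => k _.
  by rewrite (test_fun_supp (tP.1 i k)) ?mul0r// => /UD.
have mf : measurable_fun D (fun x => (mxdot (Phi x) (delta w t x))%:E).
  by apply: measurable_funTS; exact: measurable_int iP.
apply: (le_trans (lee_abs _)); apply: (le_trans (le_abse_integral leb mD mf)).
apply: ge0_le_integral => //.
- by apply: measurableT_comp mf.
- by apply/measurable_EFinP; apply: measurable_funTS; apply: measurable_frob; exact: mdelta.
- move=> x _; rewrite lee_fin (le_trans (normr_mxdot_le _ _))//.
  by rewrite ler_piMl ?frob_ge0//; exact: tP.2.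
Qed.

(** For a fixed test field, the quotient of [h] tends to the pairing with [Du] and is at most the
    quotient of [tdist] as soon as [core Omega j] contains the support. The supremum over fields
    comes last. *)
Lemma total_variation_le_liminf w Omega mu (t : nat -> R) : open Omega -> is_Du Omega v mu ->
  (forall j, 0 < t j) -> t @ \oo --> (0 : R) ->
  (Defs.total_variation (directional mu w) Omega <=
   limn_einf (fun j => (t j)^-1%:E * tdist w (core Omega j) (t j)))%E.
Proof.
move=> oO Dv t0 tcvg; set G := limn_einf _.
have G0 : (0 <= G)%E.
  apply: (@le_limn_einf _ _ _ 0%N) => j _; apply: mule_ge0.
    by rewrite lee_fin invr_ge0 ltW.
  by apply: integral_ge0 => x _; rewrite lee_fin frob_ge0.
have [->|Goo] := eqVneq G +oo%E; first by rewrite leey.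
have Gfin : G \is a fin_num by rewrite ge0_fin_numE// lt_neqAle Goo leey.
rewrite -(fineK Gfin); apply: (total_variation_le oO); first exact: fine_ge0.
move=> Phi tP.
have hd : is_derive (0 : R) (1 : R) (h w Phi) (field_pairing Omega mu w Phi).
  have HO x : Omega x -> Omega (x + 0 *: w) by rewrite scale0r addr0.
  have := h_derive_pairing oO Dv HO tP.
  by under [X in is_derive _ _ _ (field_pairing _ _ _ X)]eq_fun do rewrite scale0r addr0.
have hc : (fun j => (t j)^-1 * (h w Phi (t j) - h w Phi 0)) @ \oo --> field_pairing Omega mu w Phi.
  have [dh dhE] := hd.
  have dcvg : (fun u : R => u^-1 *: (h w Phi (u *: (1 : R) + 0) - h w Phi 0)) @ 0^' -->
      field_pairing Omega mu w Phi by rewrite -dhE; exact: dh.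
  have := (cvgr_dnbhsP _ _ _).1 dcvg t (conj (fun j => lt0r_neq0 (t0 j)) tcvg).
  by under eq_fun do rewrite addr0 [_ *: 1]mulr1.
have [J KJ] : exists J, forall j, (J <= j)%N ->
    forall i k, closure [set x | Phi x i k != 0] `<=` core Omega j.
  have /choice[f fP] : forall ik : 'I_p * 'I_q, exists J, forall j, (J <= j)%N ->
      closure [set x | Phi x ik.1 ik.2 != 0] `<=` core Omega j.
    by move=> [i k]; have [_ _ ck cs] := tP.1 i k; exact: compact_sub_core.
  exists (\max_ik f ik) => j Jj i k; apply: (fP (i, k)).
  exact: leq_trans (leq_bigmax (i, k)) Jj.
have le_j j : (J <= j)%N -> (((t j)^-1 * (h w Phi (t j) - h w Phi 0))%:E <=
    (t j)^-1%:E * tdist w (core Omega j) (t j))%E.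
  move=> Jj; rewrite EFinM lee_wpmul2l// ?lee_fin ?invr_ge0 ?(ltW (t0 j))//.
  have tPj : test_field (core Omega j) Phi.
    split => [i k|]; last exact: tP.2.
    have [d c ck _] := tP.1 i k; split => //; exact: KJ.
  apply: h_le_tdist tPj _ _ => //; by apply: open_borel; exact: core_open.
apply/ler_addgt0Pl => e e0; rewrite -lerBlDl -lee_fin fineK//.
move/cvgrPdist_le : hc => /(_ e e0)[J' _ HJ'].
apply: (@le_limn_einf _ _ _ (maxn J J')) => j; rewrite geq_max => /andP[Jj J'j].
apply: le_trans (le_j j Jj); rewrite lee_fin.
have := HJ' j J'j; rewrite /= ler_distl => /andP[H1 H2]; lra.
Qed.

End translation_estimates.

(** * The derivative as a weak limit of difference quotients *)

Section measure_with_density.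
Context d (X : measurableType d) (R : realType) (mu : {sigma_finite_measure set X -> \bar R}).
Implicit Types g : X -> R.

(* The projection of Lebesgue measure on the subgraph of f. *)
Lemma density_measure (f : X -> R) : measurable_fun setT f -> (forall x, 0 <= f x) ->
  exists m : {measure set X -> \bar R}, forall g, measurable_fun setT g ->
    (forall x, 0 <= g x) -> (\int[m]_x (g x)%:E = \int[mu]_x (g x * f x)%:E)%E.
Proof.
move=> mf f0; pose S : set (X * measurableTypeR R) := [set z | 0 <= z.2 < f z.1].
have mS : measurable S.
  have m2 : measurable_fun setT (fun z : X * measurableTypeR R => z.2 : R) by exact: measurable_snd.
  have mf1 : measurable_fun setT (fun z : X * measurableTypeR R => f z.1).
    exact: (measurableT_comp mf measurable_fst).
  have mb : measurable_fun setT (fun z : X * measurableTypeR R => (0 <= z.2) && (z.2 < f z.1)).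
    by apply: measurable_and; [exact: measurable_fun_ler|exact: measurable_fun_ltr].
  by rewrite (_ : S = (fun z => (0 <= z.2) && (z.2 < f z.1)) @^-1` [set true])//;
    rewrite -[X in measurable X]setTI; exact: mb.
pose P : {measure set (X * measurableTypeR R) -> \bar R} := (mu \x @lebesgue_measure R)%E.
pose PS : {measure set (X * measurableTypeR R) -> \bar R} := mrestr P mS.
unshelve eexists (pushforward PS (mfun_of (@measurable_fst _ _ X (measurableTypeR R)))).
  exact: measurable_fst.
move=> g mg g0.
have mgE : measurable_fun setT (fun z : X * measurableTypeR R => (g z.1)%:E).
  by apply/measurable_EFinP; exact: (measurableT_comp mg measurable_fst).
rewrite ge0_integral_pushforward//; last 2 first.
- exact/measurable_EFinP.
- by move=> x _; rewrite lee_fin.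
rewrite preimage_setT (@ge0_negligible_integral _ _ _ PS _ (~` S))//; last 3 first.
- exact: measurableC.
- by move=> z _; rewrite lee_fin.
- by rewrite [LHS]/=/mrestr setICl measure0.
rewrite setTD setCK (eq_measure_integral P); last first.
  by move=> A mA AS; rewrite [LHS]/=/mrestr setIidl.
rewrite integral_mkcond fubini_tonelli1; last 2 first.
- by apply/(measurable_restrictT _ _).1 => //; exact: measurable_funTS.
- by move=> z; rewrite patchE; case: ifPn => // _; rewrite lee_fin.
apply: eq_integral => x _; rewrite /fubini_F.
rewrite (_ : (fun y => _) = (cst (g x)%:E) \_ `[0, f x[%classic).
  rewrite -integral_mkcond integral_cst//= lebesgue_measure_itv/= lte_fin.
  case: ltP => [_|fx]; first by rewrite sube0.
  by have -> : f x = 0; [apply/eqP; rewrite eq_le fx f0|rewrite mule0 mulr0].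
apply/funext => y; rewrite !patchE/=.
have -> : ((x, y) \in S) = (y \in `[0, f x[%classic).
  by apply/idP/idP; rewrite !inE /S/= in_itv.
by [].
Qed.

Lemma density_measure_Rintegral (f : X -> R) : measurable_fun setT f -> (forall x, 0 <= f x) ->
  exists m : {measure set X -> \bar R}, (m setT = \int[mu]_x (f x)%:E)%E /\
    forall g, measurable_fun setT g -> \int[m]_x g x = \int[mu]_x (g x * f x).
Proof.
move=> mf f0; have [m mP] := density_measure mf f0; exists m; split.
  have := mP (cst 1) (measurable_cst _) (fun=> ler01).
  rewrite (_ : (fun x => _) = cst 1%E)// integral_cst// mul1e => ->.
  by apply: eq_integral => x _; rewrite mul1r.
move=> g mg; rewrite /Rintegral; congr fine; rewrite integralE [RHS]integralE.
have maxE (c : R) (x : X) : maxe (c * f x)%:E 0 = ((Num.max c 0) * f x)%:E.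
  by rewrite maxr_pMl// mul0r EFin_max.
congr (_ - _)%E.
  transitivity (\int[m]_x (Num.max (g x) 0)%:E)%E.
    by apply: eq_integral => x _; rewrite funeposE EFin_max.
  rewrite mP//; last 2 first.
  - exact: measurable_maxr.
  - by move=> x; rewrite le_max lexx orbT.
  by apply: eq_integral => x _; rewrite funeposE maxE.
transitivity (\int[m]_x (Num.max (- g x) 0)%:E)%E.
  by apply: eq_integral => x _; rewrite funenegE -EFinN EFin_max.
rewrite mP//; last 2 first.
- apply: measurable_maxr => //; exact: measurable_funN.
- by move=> x; rewrite le_max lexx orbT.
by apply: eq_integral => x _; rewrite funenegE -EFinN -mulNr maxE.
Qed.

End measure_with_density.

Section derivative_measure.
Context {R : realType} {N p q : nat}.
Local Notation bN := (borel R N).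
Local Notation leb := (leb R N).
Variables (v : bN -> 'M[R]_(p, q)) (C : R).
Hypotheses (mv : mxmeasurable v) (vC : forall x, frob (v x) <= C).
Variables (Omega : set 'rV[R]_N) (oO : open Omega).
Variables (t : nat -> R) (t0 : forall j, 0 < t j) (tcvg : t @ \oo --> (0 : R)).

Let quotients k j : \bar R := ((t j)^-1%:E * tdist v (delta_mx ord0 k) (core Omega j) (t j))%E.

(** The truncated quotients, taken as densities, have bounded mass along a subsequence; [nu] is the
    difference of the weak limits of their positive and negative parts. A limit along an ultrafilter
    is enough, because the other side converges along the whole subsequence. *)
Lemma partial_charge i j k : (limn_einf (quotients k) < +oo)%E ->
  exists nu : {charge set bN -> \bar R}, forall phi, test_fun Omega phi ->
    \int[leb]_(x in (Omega : set bN)) (v x i j * partial k phi x) =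
    - charge_Rintegral nu Omega phi.
Proof.
move=> fin; set e : 'rV[R]_N := delta_mx ord0 k.
have q0 l : (0 <= quotients k l)%E.
  apply: mule_ge0; first by rewrite lee_fin invr_ge0 ltW.
  by apply: integral_ge0 => x _; rewrite lee_fin frob_ge0.
(* A finite lower limit bounds the quotients at arbitrarily large indices only; [J] selects such
   indices. *)
have [M qM] : exists M : R, forall l, exists2 J, (l <= J)%N & (quotients k J <= M%:E)%E.
  have G0 : (0 <= limn_einf (quotients k))%E by exact: (@le_limn_einf _ _ _ 0%N).
  have Gf : limn_einf (quotients k) \is a fin_num by rewrite ge0_fin_numE.
  exists (fine (limn_einf (quotients k)) + 1) => l; apply: contrapT => nJ.
  suff : ((fine (limn_einf (quotients k)) + 1)%:E <= limn_einf (quotients k))%E.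
    by rewrite -[leRHS]fineK// lee_fin leNgt ltrDl ltr01.
  apply: (@le_limn_einf _ _ _ l) => J lJ; apply/ltW; rewrite ltNge; apply/negP => JM.
  by apply: nJ; exists J.
have /choice[J JP] : forall l, exists J, (l <= J)%N /\ (quotients k J <= M%:E)%E.
  by move=> l; have [J lJ JM] := qM l; exists J.
have mD l : measurable (core Omega (J l) : set bN) by apply: open_borel; exact: core_open.
pose dv l (x : bN) := (v ((x : 'rV_N) + t (J l) *: e) - v x) i j.
have mdv l : measurable_fun setT (dv l).
  have := mxmeasurableB (b := v) (a := fun x : bN => v ((x : 'rV_N) + t (J l) *: e)).
  by apply => // i' j'; apply: (@measurable_translate _ _ (fun x => v x i' j')); exact: mv.
pose f l (x : bN) : R := \1_(core Omega (J l)) x * ((t (J l))^-1 * dv l x).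
have mf l : measurable_fun setT (f l).
  by apply: measurable_funM; [exact: measurable_indic|exact: measurable_funM].
have fM l : (\int[leb]_x `|f l x|%:E <= M%:E)%E.
  apply: le_trans (JP l).2; rewrite /quotients /tdist -/e.
  have mfr : measurable_fun (core Omega (J l) : set bN)
      (fun x => (frob (v ((x : 'rV_N) + t (J l) *: e) - v x))%:E).
    apply/measurable_EFinP; apply: measurable_funTS; apply: measurable_frob.
    have := mxmeasurableB (b := v) (a := fun x : bN => v ((x : 'rV_N) + t (J l) *: e)).
    by apply => // i' j'; apply: (@measurable_translate _ _ (fun x => v x i' j')); exact: mv.
  rewrite -ge0_integralZl//; last 2 first.
  - by move=> x _; rewrite lee_fin frob_ge0.
  - by rewrite lee_fin invr_ge0 ltW.
  rewrite [leRHS]integral_mkcond; apply: ge0_le_integral => //.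
  - by apply/measurable_EFinP; exact: measurableT_comp.
  - apply/(measurable_restrictT _ _).1 => //; exact: measurable_funeM.
  move=> x _; rewrite patchE /f indicE; case: ifPn => xc; last by rewrite mul0r normr0.
  rewrite mul1r -EFinM lee_fin normrM ger0_norm ?invr_ge0 ?(ltW (t0 _))//.
  by rewrite ler_wpM2l ?invr_ge0 ?(ltW (t0 _))// entry_le_frob.
pose fp l x := Num.max (f l x) 0; pose fn l x := Num.max (- f l x) 0.
have mfp l : measurable_fun setT (fp l) by exact: measurable_maxr.
have mfn l : measurable_fun setT (fn l) by apply: measurable_maxr => //; exact: measurable_funN.
have fp0 l x : 0 <= fp l x by rewrite le_max lexx orbT.
have fn0 l x : 0 <= fn l x by rewrite le_max lexx orbT.
have fpM l : (\int[leb]_x (fp l x)%:E <= M%:E)%E.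
  apply: le_trans (fM l); apply: ge0_le_integral => //.
  - by move=> x _; rewrite lee_fin.
  - exact/measurable_EFinP.
  - by apply/measurable_EFinP; exact: measurableT_comp.
  - by move=> x _; rewrite lee_fin ge_max ler_norm normr_ge0.
have fnM l : (\int[leb]_x (fn l x)%:E <= M%:E)%E.
  apply: le_trans (fM l); apply: ge0_le_integral => //.
  - by move=> x _; rewrite lee_fin.
  - exact/measurable_EFinP.
  - by apply/measurable_EFinP; exact: measurableT_comp.
  - by move=> x _; rewrite lee_fin ge_max normr_ge0 -normrN ler_norm.
have /choice[mp mpP] l := density_measure_Rintegral leb (mfp l) (fp0 l).
have /choice[mn mnP] l := density_measure_Rintegral leb (mfn l) (fn0 l).
have [U [UU ooU]] := ultraFilterLemma (@eventually_filter).
have mpM l : (mp l setT <= M%:E)%E by rewrite (mpP l).1.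
have mnM l : (mn l setT <= M%:E)%E by rewrite (mnP l).1.
have [P PM Pcvg] := weak_limit UU mpM; have [Q QM Qcvg] := weak_limit UU mnM.
have Poo := le_lt_trans PM (ltry M); have Qoo := le_lt_trans QM (ltry M).
have [nu nuE] := measure_diff_charge Poo Qoo.
exists nu => phi tphi; have [_ _ ck cs] := tphi.
have cphi := C1_continuous (test_fun_C1 tphi); have [B phiB] := test_fun_bounded tphi.
have mphi := continuous_borel_measurable cphi.
have mO := open_borel oO.
rewrite (charge_Rintegral_diff Poo Qoo nuE mO mphi); last by exists B.
have toT (m : {measure set bN -> \bar R}) g : (forall x, ~ Omega x -> g x = 0) ->
    \int[m]_(x in (Omega : set bN)) g x = \int[m]_x g x.
  move=> gO; rewrite Rintegral_mkcond; apply: eq_Rintegral => x _; rewrite patchE.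
  by case: ifPn => // /negP; rewrite inE => /gO ->.
rewrite !toT; last 3 first.
- by move=> x; exact: test_fun_supp tphi.
- by move=> x; exact: test_fun_supp tphi.
- by move=> x nx; rewrite partial_supp ?mulr0// => /cs.
apply: oppr_inj; rewrite opprK.
have vij x : `|v x i j| <= C by rewrite (le_trans (entry_le_frob _ _ _)).
apply: (@cvg_unique _ (@Rhausdorff R) (fmap (fun l => \int[mp l]_x phi x - \int[mn l]_x phi x) U)).
(* Discrete integration by parts: once the core contains the support of [phi], the truncation is
   invisible and the difference moves onto [phi], with [e] replaced by [- e]. *)
- have near_eq : \forall l \near \oo, \int[mp l]_x phi x - \int[mn l]_x phi x =
      (t (J l))^-1 * (\int[leb]_x (v x i j * phi ((x : 'rV_N) + t (J l) *: - e)) -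
        \int[leb]_x (v x i j * phi ((x : 'rV_N) + 0 *: - e))).
    have [L LK] := compact_sub_core oO ck cs.
    exists L => // l /= Ll; have cl := LK _ (leq_trans Ll (JP l).1).
    have tl0 : 0 <= (t (J l))^-1 by rewrite invr_ge0 ltW.
    have dvb x : `|dv l x| <= C + C.
      by rewrite (le_trans (entry_le_frob _ _ _))// (le_trans (frobD _ _))// frobN lerD.
    have fb x : `|f l x| <= (t (J l))^-1 * (C + C).
      rewrite /f indicE; case: (_ \in _); rewrite ?mul1r ?mul0r ?normr0 ?normrM.
        by rewrite (ger0_norm tl0) ler_wpM2l.
      by rewrite mulr_ge0// (le_trans (normr_ge0 _) (dvb x)).
    have int0 (g : bN -> R) B' : measurable_fun setT g -> (forall x, `|g x| <= B') ->
        leb.-integrable setT (EFin \o (fun x => phi x * g x)).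
      move=> mg gB; have := (pairing_integrable 0 0 mg gB tphi).1.
      by rewrite /comp; under eq_fun do rewrite scale0r addr0 mulrC.
    have ip : leb.-integrable setT (EFin \o (fun x => phi x * fp l x)).
      apply: (int0 _ ((t (J l))^-1 * (C + C))) => // x.
      by rewrite ger0_norm// ge_max (le_trans (ler_norm _) (fb x)) (le_trans (normr_ge0 _) (fb x)).
    have in_ : leb.-integrable setT (EFin \o (fun x => phi x * fn l x)).
      apply: (int0 _ ((t (J l))^-1 * (C + C))) => // x.
      rewrite ger0_norm// ge_max (le_trans (normr_ge0 _) (fb x)) andbT.
      by rewrite (le_trans _ (fb x))// -normrN ler_norm.
    have mvt : measurable_fun setT (fun x : bN => v ((x : 'rV_N) + t (J l) *: e) i j).
      by apply: (@measurable_translate _ _ (fun x => v x i j)); exact: mv.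
    have i1 := int0 _ _ mvt (fun x => vij _).
    have i2 := int0 _ _ (mv i j) vij.
    rewrite (mpP l).2// (mnP l).2// -RintegralB//.
    have -> : \int[leb]_x (v x i j * phi ((x : 'rV_N) + t (J l) *: - e)) =
        \int[leb]_x (phi x * v ((x : 'rV_N) + t (J l) *: e) i j).
      rewrite -(@Rintegral_shift _ _ (t (J l) *: e) (fun x => v x i j * phi ((x : 'rV_N) + t (J l) *: - e))).
        by apply: eq_Rintegral => x _; rewrite scalerN addrK mulrC.
      by apply: measurable_funM; [exact: mv|exact: (@measurable_translate _ _ (phi : bN -> R))].
    have -> : \int[leb]_x (v x i j * phi ((x : 'rV_N) + 0 *: - e)) = \int[leb]_x (phi x * v x i j).
      by apply: eq_Rintegral => x _; rewrite scale0r addr0 mulrC.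
    rewrite -RintegralB// -RintegralZl//; last by have := integrableB measurableT i1 i2.
    apply: eq_Rintegral => x _; rewrite -mulrBr.
    have -> : fp l x - fn l x = f l x.
      rewrite /fp /fn; have [f0|/ltW f0] := leP 0 (f l x).
        by rewrite max_r ?oppr_le0// subr0.
      by rewrite max_l ?oppr_ge0// sub0r opprK.
    rewrite /f indicE; case: (boolP (x \in _)) => xc.
      by rewrite mul1r /dv !mxE; ring.
    have -> : phi x = 0.
      apply: contrapT => /eqP px; move/negP : xc; apply; rewrite inE; apply: cl.
      exact: subset_closure.
    by rewrite !mul0r subrr mulr0.
  have lim : (fun l => (t (J l))^-1 * (\int[leb]_x (v x i j * phi ((x : 'rV_N) + t (J l) *: - e)) -
        \int[leb]_x (v x i j * phi ((x : 'rV_N) + 0 *: - e)))) @ \oo -->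
      - \int[leb]_x (v x i j * partial k phi x).
    have [dh dhE] := is_derive_pairing (- e) 0 (mv i j) vij tphi.
    have tJ : (fun l => t (J l)) @ \oo --> (0 : R).
      apply: (@cvg_comp _ _ _ J t) tcvg => A [n _ nA]; exists n => // l /= nl.
      by apply: nA => /=; exact: leq_trans nl (JP l).1.
    pose F (s : R) := \int[leb]_x (v x i j * phi ((x : 'rV_N) + s *: - e)).
    have dE : \int[leb]_x (v x i j * dirD (- e) phi ((x : 'rV_N) + 0 *: - e)) =
        - \int[leb]_x (v x i j * partial k phi x).
      rewrite -mulN1r -RintegralZl//; last first.
        have := (pairing_integrable e 0 (mv i j) vij tphi).2.
        by under eq_fun do rewrite scale0r addr0 dirD_delta.
      apply: eq_Rintegral => x _; rewrite scale0r addr0 dirDN dirD_delta; ring.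
    have dcvg : (fun u : R => u^-1 *: (F (u *: (1 : R) + 0) - F 0)) @ 0^' -->
        - \int[leb]_x (v x i j * partial k phi x) by rewrite -dE -dhE; exact: dh.
    have := (cvgr_dnbhsP _ _ _).1 dcvg _ (conj (fun l => lt0r_neq0 (t0 (J l))) tJ).
    by under eq_fun do rewrite addr0 [_ *: 1]mulr1.
  move=> A /lim nA; apply: ooU; move: nA; apply: filterS2 near_eq => l /= ->.
  by [].
- apply: cvgB; [exact: Pcvg cphi phiB ck|exact: Qcvg cphi phiB ck].
Qed.

Lemma exists_Du : (forall k, (limn_einf (quotients k) < +oo)%E) ->
  exists mu, is_Du Omega v mu.
Proof.
move=> fin.
have /choice[nu nuP] : forall ijk : 'I_p * 'I_q * 'I_N, exists nu : {charge set bN -> \bar R},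
    forall phi, test_fun Omega phi ->
    \int[leb]_(x in (Omega : set bN)) (v x ijk.1.1 ijk.1.2 * partial ijk.2 phi x) =
    - charge_Rintegral nu Omega phi.
  by move=> [[i j] k]; exact: partial_charge.
exists (fun i j k => nu (i, j, k)) => i j k phi tphi; exact: nuP (i, j, k) phi tphi.
Qed.

End derivative_measure.

(** * Liftings along a direction *)

Section modification.
Context {R : realType} {N p q : nat}.
Local Notation bN := (borel R N).
Local Notation leb := (leb R N).
Variables (Omega : set 'rV[R]_N) (oO : open Omega).
Implicit Types u w : 'rV[R]_N -> 'M[R]_(p, q).

Lemma L1loc_measurable u i j : L1loc Omega u ->
  measurable_fun (Omega : set bN) (fun x => u x i j).
Proof.
move=> Lu; have mI k : measurable (inner Omega k : set bN).
  by rewrite -[inner _ _]setCK; apply: measurableC; apply: open_borel; exact/closed_openC/inner_closed.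
have -> : (Omega : set bN) = \bigcup_k (inner Omega k : set bN).
  apply/seteqP; split => x; last by move=> [k _]; exact: inner_sub.
  by rewrite -{1}(bigcup_core oO) => -[k _ xk]; exists k => //; exact: core_inner.
apply/measurable_fun_bigcup => // k; apply/measurable_EFinP.
apply: (@measurable_int _ _ _ leb).
exact: Lu (@inner_compact _ _ Omega k) (@inner_sub _ _ Omega k) i j.
Qed.

(** Difference quotients evaluate the map at translated points and Tonelli's theorem wants it
    measurable on the whole space, so it is redefined as the constant [c] outside a full-measure
    part of [Omega]. *)
Lemma bounded_modification u M c : L1loc Omega u -> M c ->
  {ae leb, forall x, Omega x -> M (u x)} ->
  exists w : bN -> 'M[R]_(p, q), [/\ mxmeasurable w, forall x, M (w x) &
    {ae leb, forall x, Omega x -> u x = w x}].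
Proof.
move=> Lu Mc [Z [mZ Z0 HZ]]; have mO : measurable (Omega : set bN) := open_borel oO.
pose D : set bN := (Omega : set bN) `\` Z; have mD : measurable D by exact: measurableD.
have DM x : D x -> M (u x) by move=> [Ox nZ]; apply: contrapT => nM; apply/nZ/HZ => /(_ Ox).
exists (fun x => if x \in D then u x else c); split.
- move=> i j; rewrite (_ : (fun _ => _) = fun x => if x \in D then u x i j else c i j).
    apply: measurable_fun_if => //.
    + by apply: measurable_fun_bool; rewrite setTI (_ : _ @^-1` _ = D)//;
        apply/seteqP; split => x /=; [move/set_mem|move/mem_set].
    + apply: (measurable_funS mO) (L1loc_measurable i j Lu) => x [_ /=].
      by move/set_mem => [].
  by apply/funext => x; case: ifP.
- by move=> x; case: ifPn => // /set_mem; exact: DM.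
- exists Z; split => // x /= nx; apply: contrapT => nZ; apply: nx => Ox.
  by rewrite mem_set.
Qed.

Lemma is_Du_ae u w mu : L1loc Omega u -> mxmeasurable (w : bN -> _) ->
  {ae leb, forall x, Omega x -> u x = w x} -> is_Du Omega u mu -> is_Du Omega w mu.
Proof.
move=> Lu mw uw Du i j k phi tphi; rewrite -(Du i j k phi tphi) /Rintegral; congr fine.
have mO : measurable (Omega : set bN) := open_borel oO.
have mp : measurable_fun (Omega : set bN) (partial k phi : bN -> R).
  apply: measurable_funTS; apply: continuous_borel_measurable.
  by case: (test_fun_C1 tphi).
apply: ae_eq_integral => //.
- apply/measurable_EFinP; apply: measurable_funM => //.
  by apply: measurable_funTS; exact: mw.
- apply/measurable_EFinP; apply: measurable_funM => //; exact: L1loc_measurable.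
- have [Z [mZ Z0 HZ]] := uw; exists Z; split => // x /= nx; apply: HZ => /= H.
  by apply: nx => /H ->.
Qed.

Lemma DuP u : (exists mu, is_Du Omega u mu) -> is_Du Omega u (Du Omega u).
Proof. by rewrite /Du; case: pselect => // h _; exact: (svalP (cid h)). Qed.

Lemma bounded_L1loc w C : mxmeasurable (w : bN -> _) -> (forall x, frob (w x) <= C) ->
  L1loc Omega w.
Proof.
move=> mw wC K cK KO i j.
have clK : closed K by apply: compact_closed cK; exact: norm_hausdorff.
have mK : measurable (K : set bN).
  by rewrite -[K]setCK; apply: measurableC; apply: open_borel; exact: closed_openC.
have [J /(_ J (leqnn J)) KJ] := compact_sub_core oO cK KO.
apply: (@bounded_integrable _ bN R leb K (fun x => w x i j) C) => //.
- apply: (le_lt_trans _ (leb_core_lty Omega J)); apply: le_measure; rewrite ?inE//.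
  by apply: open_borel; exact: core_open.
- by apply: measurable_funTS; exact: mw.
- by move=> x _; rewrite (le_trans (entry_le_frob _ _ _)).
Qed.

End modification.

Section total_variation_measurable.
Context {R : realType} {N p q : nat}.
Local Notation bN := (borel R N).
Variables (Omega : set 'rV[R]_N) (mu : @matrix_charge R N p q).

Let tv (w : bN) := Defs.total_variation (directional mu w) Omega.

Lemma total_variation_ge0 (nu : set bN -> 'M[R]_(p, q)) (A : set bN) : measurable A ->
  (0 <= Defs.total_variation nu A)%E.
Proof.
move=> mA; pose F (k : nat) : set bN := if k == 0%N then A else set0.
apply: (@le_trans _ _ (\sum_(k <oo) (frob (nu (F k)))%:E)%E).
  by apply: nneseries_ge0 => k _ _; rewrite lee_fin frob_ge0.
apply: ereal_sup_ubound; exists F => //; split.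
- by move=> k; rewrite /F; case: ifP.
- apply/trivIsetP => -[|i] [|j] _ _ ij //=; rewrite /F/= ?setI0 ?set0I//.
- apply/seteqP; split => [x [k _]|x Ax]; last by exists 0%N.
  by rewrite /F; case: ifP.
Qed.

Let continuous_sumr (I : Type) (s : seq I) (f : I -> 'rV[R]_N -> R) :
  (forall i, continuous (f i)) -> continuous (fun x => \sum_(i <- s) f i x).
Proof.
move=> cf; elim: s => [|i s IH].
  by under eq_fun do rewrite big_nil; exact: cst_continuous.
by under eq_fun do rewrite big_cons; exact: continuous_addf.
Qed.

Let continuous_frob_directional (A : set bN) : continuous (fun w => frob (directional mu w A)).
Proof.
rewrite /frob => x.
apply: (@continuous_comp _ _ _ (fun w => \sum_i \sum_j directional mu w A i j ^+ 2) Num.sqrt);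
  last exact: sqrt_continuous.
apply: continuous_sumr => i; apply: continuous_sumr => j; under eq_fun do rewrite mxE expr2.
have cd : continuous (fun w : 'rV[R]_N => \sum_k w ord0 k * fine (mu i j k A)).
  apply: continuous_sumr => k; apply: continuous_mulf; last exact: cst_continuous.
  exact: coord_continuous.
exact: continuous_mulf.
Qed.

(* A supremum of continuous functions is lower semicontinuous. *)
Lemma measurable_total_variation : measurable_fun setT tv.
Proof.
apply: (measurability _ (ErealGenOInfty.measurableE R)) => _ [_ [a ->] <-].
rewrite setTI; suff : open (tv @^-1` `]a%:E, +oo[%classic : set 'rV[R]_N) by exact: open_borel.
rewrite openE => w /=; rewrite in_itv/= andbT.
move=> /ereal_sup_gt[_ [F [mF tF UF] <-] aF].
have [n an] : exists n, a < \sum_(k < n) frob (directional mu w (F k)).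
  apply: contrapT => /forallNP na; move: aF; apply/negP; rewrite -leNgt.
  apply: lime_le; first by apply: is_cvg_nneseries => k _ _; rewrite lee_fin frob_ge0.
  apply: nearW => n; rewrite big_mkord sumEFin lee_fin leNgt; apply/negP; exact: na.
have cs : continuous (fun w => \sum_(k < n) frob (directional mu w (F k))).
  by apply: continuous_sumr => k; exact: continuous_frob_directional.
have wn : nbhs w [set y : 'rV[R]_N | a < \sum_(k < n) frob (directional mu y (F k))].
  exact: cvgr_gt (cs w) _ an.
apply: filterS wn => x /= ax.
rewrite in_itv/= andbT; apply: lt_le_trans (ereal_sup_ubound _); last by exists F.
apply: (@lt_le_trans _ _ (\sum_(k < n) frob (directional mu x (F k)))%:E); first by rewrite lte_fin.
apply: le_trans (nneseries_lim_ge n _); last by move=> k _ _; rewrite lee_fin frob_ge0.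
by rewrite big_mkord sumEFin.
Qed.

End total_variation_measurable.

Section restriction.
Context d (X : measurableType d) (R : realType).
Implicit Types m mu : {measure set X -> \bar R}.

Lemma ge0_integral_restriction m mu (D : set X) (f : X -> \bar R) : measurable D ->
  (forall A, measurable A -> m A = mu (A `&` D)) ->
  measurable_fun setT f -> (forall x, 0 <= f x)%E ->
  (\int[m]_x f x = \int[mu]_(x in D) f x)%E.
Proof.
move=> mD mE mf f0; rewrite (@ge0_negligible_integral _ _ _ m _ (~` D))//.
- rewrite setTD setCK; apply: eq_measure_integral => A mA AD.
  by rewrite mE// setIidl.
- exact: measurableC.
- by rewrite mE ?setICl ?measure0//; exact: measurableC.
Qed.

(** The first moment method under an almost sure constraint: otherwise, for finite [A], [g - A]
    would be positive almost everywhere while its integral is at most 0. *)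
Lemma exists_le_average m (M : R) (A : \bar R) (g : X -> \bar R) (P : X -> Prop) :
  m setT = M%:E -> 0 < M -> (0 <= A)%E -> measurable_fun setT g -> (forall x, 0 <= g x)%E ->
  (\int[m]_x g x <= M%:E * A)%E -> {ae m, forall x, P x} ->
  exists2 x, P x & (g x <= A)%E.
Proof.
move=> mM M0 A0 mg g0 gA [Z [mZ Z0 HZ]].
have mD : measurable (~` Z) by exact: measurableC.
have mDM : m (~` Z) = M%:E.
  rewrite -setTD measureD//; last by rewrite [ltLHS]mM ltry.
  by rewrite setTI [X in (_ - X)%E](_ : _ = 0%E) ?sube0.
apply: contrapT => nP.
have gtA x : (~` Z) x -> (A < g x)%E.
  move=> nZ; rewrite ltNge; apply/negP => gxA; apply: nP; exists x => //.
  by apply: contrapT => nPx; apply/nZ/HZ.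
have D0 : m (~` Z) = 0%E; last by move: M0; rewrite -lte_fin -mDM D0 ltxx.
have [Aoo|Afin] := eqVneq A +oo%E.
  suff -> : ~` Z = set0 by rewrite measure0.
  by rewrite -subset0 => x /gtA; rewrite Aoo ltNge leey.
have {}Afin : A \is a fin_num by rewrite ge0_fin_numE// lt_neqAle Afin leey.
move: A0 gA gtA; rewrite -(fineK Afin); set r := fine A => r0 gA gtA.
pose h (x : X) : \bar R := (g x - r%:E)%E.
have mh : measurable_fun (~` Z) h by apply: emeasurable_funB => //; exact: measurable_funTS.
have h0 x : (~` Z) x -> (0 <= h x)%E by move=> /gtA/ltW; rewrite sube_ge0.
have ih : (\int[m]_(x in ~` Z) h x = 0)%E.
  apply/eqP; rewrite eq_le integral_ge0// andbT.
  have : (\int[m]_(x in ~` Z) (cst r%:E x + h x) <= M%:E * r%:E)%E.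
    apply: le_trans gA; rewrite [leRHS](@ge0_negligible_integral _ _ _ m _ Z)// setTD.
    by rewrite (eq_integral g)// => x _; rewrite /h/= addeCA subee// adde0.
  rewrite ge0_integralD//.
  by rewrite integral_cst// mDM muleC -leeBrDl// subee.
have : ae_eq m (~` Z) h (cst 0%E).
  apply/ae_eq_integral_abs => //; rewrite -[RHS]ih; apply: eq_integral => x.
  by rewrite inE => /h0 hx; rewrite gee0_abs.
move=> [Y [mY Y0 HY]]; apply/eqP; rewrite -measure_le0 -Y0; apply: le_measure; rewrite ?inE//.
move=> x Zx; apply: HY => /= H; have := gtA x Zx; rewrite -sube_gt0 -/(h x).
by rewrite (H Zx) ltxx.
Qed.

End restriction.

Lemma measurable_unit_sphere (R : realType) n :
  measurable (@unit_sphere R n : set (borel R n)).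
Proof.
have -> : @unit_sphere R n = (fun x : borel R n => frob (x : 'rV_n)) @^-1` [set 1] by [].
apply: measurable_preimageT => //; apply: measurable_frob => i j; rewrite (ord1 i).
exact: measurable_coord.
Qed.

(** * Averaging over the lifting direction *)

Section averaging.
Context {R : realType} {N d : nat}.
Local Notation bN := (borel R N).
Local Notation bd := (borel R d).
Local Notation leb := (leb R N).
Variables (Omega : set 'rV[R]_N) (w : bN -> 'M[R]_d) (v0 : 'rV[R]_d).
Hypotheses (oO : open Omega) (mw : mxmeasurable w) (wRP : forall x, RP (w x)) (v01 : frob v0 = 1).
Variable mu : @matrix_charge R N d d.
Hypothesis Dw : is_Du Omega w mu.

Let beta : {finite_measure set bd -> \bar R} :=
  mfrestr (@fball_measurable R d) (leb_fball_lty d).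

Let betaE (A : set bd) : beta A = Defs.leb R d (A `&` fball R d).
Proof. by []. Qed.

Let betaT : beta setT = (ballM R d)%:E.
Proof. by rewrite betaE setTI ballME. Qed.

Definition lift_along (e : 'rV[R]_d) (x : bN) : 'rV[R]_d := unit_of v0 (e *m w x).

(** Half the margin of [core Omega j], so that a shift by [mesh j *: om] in a unit direction stays
    strictly within it. *)
Definition mesh j : R := (2 * j.+1%:R)^-1.

Lemma mesh_gt0 j : 0 < mesh j.
Proof. by rewrite invr_gt0 mulr_gt0// ltr0n. Qed.

Lemma mesh_cvg0 : mesh @ \oo --> (0 : R).
Proof.
rewrite (_ : mesh = fun j => 2^-1 * harmonic j); last by apply/funext => j; rewrite /mesh invfM.
by rewrite -[X in _ --> X](mulr0 (2^-1 : R)); apply: cvgMr; exact: cvg_harmonic.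
Qed.

(* An upper bound for the total variation of (D n_e) om which, unlike the latter,
   makes sense before D n_e is known to be a measure. *)
Definition lift_energy (e : 'rV[R]_d) (om : 'rV[R]_N) : \bar R :=
  limn_einf (fun j => (mesh j)^-1%:E * tdist (lift_along e) om (core Omega j) (mesh j))%E.

Lemma frob_lift_along e x : frob (lift_along e x) = 1.
Proof. exact: frob_unit_of. Qed.

Let measurable_lift : measurable_fun setT (fun z : bd * bN => lift_along z.1 z.2 : bd).
Proof.
apply: measurable_unit_of; apply: measurable_rowP => i; under eq_fun do rewrite mxE.
apply: measurable_sum => k; apply: measurable_funM.
  exact: (measurableT_comp (@measurable_coord R d k) measurable_fst).
exact: (measurableT_comp (mw k i) measurable_snd).
Qed.

Let measurable_lift_comp d' (T : measurableType d') (f : T -> bd) (g : T -> bN) i :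
  measurable_fun setT f -> measurable_fun setT g ->
  measurable_fun setT (fun t => lift_along (f t) (g t) ord0 i).
Proof.
move=> mf mg; apply: (measurableT_comp (@measurable_coord R d i)).
have mp : measurable_fun setT (fun t => (f t, g t)) by exact/measurable_fun_pairP.
exact: (measurableT_comp measurable_lift mp).
Qed.

Lemma mxmeasurable_lift e : mxmeasurable (lift_along e).
Proof.
by move=> i j; rewrite (ord1 i); apply: measurable_lift_comp.
Qed.

(** The indicator extends the integral to the whole space, where joint measurability in [e], [om]
    and [x] gives access to Tonelli's theorem. *)
Let integrand om j (z : bd * bN) : \bar R :=
  ((frob (lift_along z.1 ((z.2 : 'rV_N) + mesh j *: om)%R - lift_along z.1 z.2))%:E
   * (\1_(core Omega j) z.2)%:E)%E.

Let tdistE om j e :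
  tdist (lift_along e) om (core Omega j) (mesh j) = (\int[leb]_x integrand om j (e, x))%E.
Proof.
rewrite /tdist integral_mkcond; apply: eq_integral => x _; rewrite patchE /integrand/= indicE.
by case: (x \in _); rewrite ?mule1 ?mule0.
Qed.

Let integrand_ge0 om j z : (0 <= integrand om j z)%E.
Proof. by rewrite mule_ge0// lee_fin frob_ge0. Qed.

Let mcore j : measurable (core Omega j : set bN).
Proof. by apply: open_borel; exact: core_open. Qed.

Let measurable_integrand j :
  measurable_fun setT (fun z : (bd * bN) * bN => integrand z.1.2 j (z.1.1, z.2)).
Proof.
apply: emeasurable_funM; last first.
  apply/measurable_EFinP; apply: (measurableT_comp _ measurable_snd); exact: measurable_indic.
apply/measurable_EFinP; apply: measurable_frob => i k; rewrite (ord1 i).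
under eq_fun do rewrite !mxE; apply: measurable_funB.
  apply: measurable_lift_comp; first exact: (measurableT_comp measurable_fst measurable_fst).
  apply: measurable_rowP => l; under eq_fun do rewrite !mxE.
  apply: measurable_funD; first exact: (measurableT_comp (@measurable_coord R N l) measurable_snd).
  apply: measurable_funM => //.
  apply: (measurableT_comp (@measurable_coord R N l)).
  exact: (measurableT_comp measurable_snd measurable_fst).
apply: measurable_lift_comp; last exact: measurable_snd.
exact: (measurableT_comp measurable_fst measurable_fst).
Qed.

Let measurable_quotient j : measurable_fun setT (fun z : bd * bN =>
  (mesh j)^-1%:E * tdist (lift_along z.1) z.2 (core Omega j) (mesh j))%E.
Proof.
apply: measurable_funeM; rewrite (_ : (fun _ => _) =
    fubini_F leb (fun z : (bd * bN) * bN => integrand z.1.2 j (z.1.1, z.2))).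
  by apply: measurable_fun_fubini_tonelli_F => // z; exact: integrand_ge0.
by apply/funext => z; rewrite tdistE.
Qed.

Let measurable_energy : measurable_fun setT (fun z : bd * bN => lift_energy z.1 z.2).
Proof.
apply: measurableT_comp => //; apply: measurable_fun_limn_esup => j.
by apply: measurableT_comp => //; exact: measurable_quotient.
Qed.

Lemma measurable_lift_energyl om : measurable_fun setT (fun e : bd => lift_energy e om).
Proof. exact: (measurableT_comp measurable_energy (measurable_pair2 (om : bN))). Qed.

Lemma measurable_lift_energyr e : measurable_fun setT (fun om : bN => lift_energy e om).
Proof. exact: (measurableT_comp measurable_energy (measurable_pair1 (e : bd))). Qed.

Lemma lift_energy_ge0 e om : (0 <= lift_energy e om)%E.
Proof.
apply: (@le_limn_einf _ _ _ 0%N) => j _; rewrite mule_ge0//.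
  by rewrite lee_fin invr_ge0 ltW// mesh_gt0.
by apply: integral_ge0 => x _; rewrite lee_fin frob_ge0.
Qed.

Let tv om := Defs.total_variation (directional mu om) Omega.

Let K : R := 1 + 2 / pi.

Let K0 : 0 <= K. Proof. by rewrite addr_ge0// divr_ge0// pi_ge0. Qed.

Let wfrob x : frob (w x) <= Num.sqrt (2^-1 * (1 ^+ 2) ^+ 2).
Proof. by have [a a1 <-] := wRP x; rewrite frobE mxdot_rp_embed mxdotAA a1. Qed.

(** The unit norm of [om] bounds its sup norm by 1, so the shift respects the margin required by
    [tdist_le]. The bound obtained at each [n] is the same, hence passes to the lower limit. *)
Lemma average_lift_energy om : frob om = 1 ->
  (\int[beta]_e lift_energy e om <= (ballM R d)%:E * (K%:E * tv om))%E.
Proof.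
move=> om1; set c := (_ * (_ * tv om))%E.
have q0 j (e : bd) : (0 <= (mesh j)^-1%:E * tdist (lift_along e) om (core Omega j) (mesh j))%E.
  rewrite mule_ge0//; first by rewrite lee_fin invr_ge0 ltW// mesh_gt0.
  by apply: integral_ge0 => x _; rewrite lee_fin frob_ge0.
have mq j : measurable_fun setT (fun e : bd =>
    (mesh j)^-1%:E * tdist (lift_along e) om (core Omega j) (mesh j))%E.
  exact: (measurableT_comp (measurable_quotient j) (measurable_pair2 (om : bN))).
apply: (le_trans (@fatou _ _ _ beta setT measurableT
  (fun j (e : bd) => (mesh j)^-1%:E * tdist (lift_along e) om (core Omega j) (mesh j))%E mq _)).
  by move=> j e _; exact: q0.
rewrite limn_einf_lim; apply: lime_le; first exact: is_cvg_einfs.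
apply: nearW => n.
apply: (@le_trans _ _ (\int[beta]_e
    ((mesh n)^-1%:E * tdist (lift_along e) om (core Omega n) (mesh n)))%E).
  by apply: ereal_inf_lbound; exists n => /=.
have mint : measurable_fun setT (fun z : bd * bN => integrand om n z).
  have mp : measurable_fun setT (fun z : bd * bN => ((z.1, om : bN), z.2)).
    apply/measurable_fun_pairP; split; rewrite /comp/=; last exact: measurable_snd.
    by apply/measurable_fun_pairP; split; rewrite /comp/=; [exact: measurable_fst|exact: measurable_cst].
  have := measurableT_comp (measurable_integrand n) mp.
  by congr measurable_fun; apply/funext => -[].
under eq_integral do rewrite tdistE.
have mI : measurable_fun setT (fun e : bd => \int[leb]_x integrand om n (e, x))%E.
  exact: (measurable_fun_fubini_tonelli_F (m2 := leb) _ mint (integrand_ge0 om n)).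
rewrite ge0_integralZl//; last 2 first.
- by move=> e _; apply: integral_ge0.
- by rewrite lee_fin invr_ge0 ltW// mesh_gt0.
rewrite (fubini_tonelli (m1 := beta) (m2 := leb) _ mint (integrand_ge0 om n)).
(* At fixed [x] the average over [e] concerns just two lines, [w x] and [w y] with [y] the shifted
   point. *)
have inner_le x : (\int[beta]_e integrand om n (e, x) <=
    (ballM R d * K)%:E * ((frob (w ((x : 'rV_N) + mesh n *: om)%R - w x))%:E
      * (\1_(core Omega n) x)%:E))%E.
  pose y : bN := (x : 'rV_N) + mesh n *: om.
  rewrite muleA [leLHS](_ : _ = (\int[beta]_e ((frob (lift_along e y - lift_along e x)%R)%:E
    * (\1_(core Omega n) x)%:E))%E)// ge0_integralZr//; last 2 first.
  - apply/measurable_EFinP; apply: measurable_frob => i k; rewrite (ord1 i).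
    under eq_fun do rewrite !mxE; apply: measurable_funB;
      apply: (measurableT_comp (@measurable_coord R d k)); exact: measurable_unit_of_mul.
  - by move=> e _; rewrite lee_fin frob_ge0.
  apply: lee_wpmul2r => //.
  rewrite (@ge0_integral_restriction _ _ _ beta (Defs.leb R d) (fball R d))//; last 3 first.
  - exact: fball_measurable.
  - apply/measurable_EFinP; apply: measurable_frob => i k; rewrite (ord1 i).
    under eq_fun do rewrite !mxE; apply: measurable_funB;
      apply: (measurableT_comp (@measurable_coord R d k)); exact: measurable_unit_of_mul.
  - by move=> e; rewrite lee_fin frob_ge0.
  rewrite /lift_along /=; have [a a1 <-] := wRP x.
  have [b b1 <-] := wRP y.
  by rewrite -EFinM -mulrA; exact: average_dist_le.
have mwd : measurable_fun setT (fun x : bN => (frob (w ((x : 'rV_N) + mesh n *: om)%R - w x))%:E).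
  apply/measurable_EFinP; apply: measurable_frob.
  have := mxmeasurableB (b := w) (a := fun x : bN => w ((x : 'rV_N) + mesh n *: om)).
  by apply => // i' j'; apply: (@measurable_translate _ _ (fun x => w x i' j')); exact: mw.
have mwdi : measurable_fun setT (fun x : bN => ((frob (w ((x : 'rV_N) + mesh n *: om)%R - w x))%:E
      * (\1_(core Omega n) x)%:E)%E).
  by apply: emeasurable_funM => //; apply/measurable_EFinP; exact: measurable_indic.
apply: (@le_trans _ _ ((mesh n)^-1%:E * ((ballM R d * K)%:E * tdist w om (core Omega n) (mesh n)))%E).
  apply: lee_wpmul2l; first by rewrite lee_fin invr_ge0 ltW// mesh_gt0.
  have -> : tdist w om (core Omega n) (mesh n) =
      (\int[leb]_x ((frob (w ((x : 'rV_N) + mesh n *: om)%R - w x))%:E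
      * (\1_(core Omega n) x)%:E))%E.
    rewrite /tdist integral_mkcond; apply: eq_integral => x _; rewrite patchE/= indicE.
    by case: (x \in _); rewrite ?mule1 ?mule0.
  rewrite -ge0_integralZl//; last 2 first.
  - by move=> x _; rewrite mule_ge0// lee_fin frob_ge0.
  - by rewrite lee_fin mulr_ge0// ltW// ballM_gt0.
  apply: ge0_le_integral => //.
  - by move=> x _; apply: integral_ge0.
  - exact: (measurable_fun_fubini_tonelli_G (m1 := beta) _ mint (integrand_ge0 om n)).
  - exact: measurable_funeM.
have rearrange (a b k : R) (y : \bar R) :
    (a%:E * ((b * k)%:E * y) = b%:E * (k%:E * (a%:E * y)))%E.
  by rewrite EFinM -muleA [LHS]muleCA; congr (_ * _)%E; exact: muleCA.
rewrite rearrange /c; apply: lee_wpmul2l; first by rewrite lee_fin ltW// ballM_gt0.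
apply: lee_wpmul2l; first by rewrite lee_fin.
rewrite lee_pdivrMl ?mesh_gt0//; apply: (tdist_le mw wfrob oO Dw (mesh_gt0 n)).
rewrite (@le_lt_trans _ _ (mesh n))// ?ler_piMr ?(ltW (mesh_gt0 n)) ?(le_trans (normr_le_frob _)) ?om1//.
by rewrite /mesh ltf_pV2 ?posrE ?mulr_gt0 ?ltr0n// ltr_pMl ?ltr0n// ltr1n.
Qed.

(** For fixed [x] the bad [e] form a hyperplane, which is null; exchanging the integrals, almost
    every [e] is bad only on a null set of [x]. *)
Let kernel_null : {ae beta, forall e, leb [set x | (e : 'rV_d) *m w x = 0] = 0%E}.
Proof.
pose A : set (bd * bN) := [set z | (z.1 : 'rV_d) *m w z.2 = 0].
have mA : measurable A.
  rewrite (_ : A = (fun z => frob ((z.1 : 'rV_d) *m w z.2)) @^-1` [set 0]); last first.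
    by apply/seteqP; split => z /= => [->|/eqP]; [rewrite frob0|rewrite frob_eq0 => /eqP].
  apply: measurable_preimageT => //; apply: measurable_frob => i j; under eq_fun do rewrite mxE.
  apply: measurable_sum => k; apply: measurable_funM.
    rewrite (ord1 i); exact: (measurableT_comp (@measurable_coord R d k) measurable_fst).
  exact: (measurableT_comp (mw k j) measurable_snd).
have xsE e : xsection A e = [set x | (e : 'rV_d) *m w x = 0].
  by apply/seteqP; split => x; rewrite /xsection/= ?inE.
have i0 : (\int[beta]_e leb (xsection A e) = 0)%E.
  rewrite integral_section_swap//; apply: integral0_eq => x _.
  apply/eqP; rewrite -measure_le0; have [a a1 aw] := wRP x.
  rewrite -[leRHS](leb_hyperplane a1) [leLHS](betaE (ysection A x)); apply: le_measure; rewrite ?inE.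
  - by apply: measurableI; [exact: measurable_ysection|exact: fball_measurable].
  - exact: hyperplane_measurable.
  move=> e [+ _]; rewrite /ysection/= inE /A/= -aw mulmx_rp_embed => /eqP.
  rewrite scaler_eq0 -[a == 0]frob_eq0 a1 oner_eq0 orbF mulf_eq0 invr_eq0 sqrtr_eq0.
  by rewrite leNgt ltr0n/= => /eqP.
have : ae_eq beta setT (fun e => leb (xsection A e)) (cst 0%E).
  apply/ae_eq_integral_abs => //; first exact: measurable_fun_xsection.
  by rewrite -[RHS]i0; apply: eq_integral => e _; rewrite gee0_abs.
by move=> [Z [mZ Z0 HZ]]; exists Z; split => // e ne; apply: HZ => /= H; apply: ne; have := H I; rewrite xsE.
Qed.

(** Each of the [N] coordinate energies is integrable over [e], since [Du] has finite total
    variation, hence finite almost everywhere. *)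
Let energy_finite : {ae beta, forall e, forall k, (lift_energy e (delta_mx ord0 k) < +oo)%E}.
Proof.
(* Coordinates are quantified as natural numbers below [N], so that a countable intersection of
   almost sure events applies. *)
have : {ae beta, forall (e : bd) (n : nat) (nN : (n < N)%N),
    (lift_energy e (delta_mx ord0 (Ordinal nN)) < +oo)%E}.
  apply: ae_foralln => n; have [nN|nN] := pselect (n < N)%N; last by apply: aeW => e nN'.
  have ig : beta.-integrable setT (fun e : bd => lift_energy e (delta_mx ord0 (Ordinal nN))).
    apply/integrableP; split; first exact: measurable_lift_energyl.
    under eq_integral do rewrite gee0_abs ?lift_energy_ge0//.
    apply: (le_lt_trans (average_lift_energy (frob_delta _ _))).
    have := total_variation_lty oO mu (delta_mx ord0 (Ordinal nN)); rewrite -/(tv _).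
    have : (0 <= tv (delta_mx ord0 (Ordinal nN)))%E by apply: total_variation_ge0; exact: open_borel.
    by case: (tv _) => [r| |]// _ _; rewrite -!EFinM ltry.
  have [Z [mZ Z0 HZ]] := integrable_ae measurableT ig; exists Z; split => // e ne.
  apply: HZ => /= H; apply: ne => nN'; rewrite (bool_irrelevance nN' nN).
  by have := H I; rewrite ge0_fin_numE ?lift_energy_ge0.
move=> [Z [mZ Z0 HZ]]; exists Z; split => // e ne; apply: HZ => /= H; apply: ne => -[k kN].
exact: H.
Qed.

(** [m] stands for the surface measure of the sphere. The first two properties hold for almost every
    [e], and the third is satisfied by the average over [e]. *)
Lemma exists_good_direction (m : {finite_measure set bN -> \bar R}) :
  m (~` (@unit_sphere R N : set bN)) = 0%E ->
  exists e, [/\ forall k, (lift_energy e (delta_mx ord0 k) < +oo)%E,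
    leb [set x | e *m w x = 0] = 0%E &
    (\int[m]_om lift_energy e om <= K%:E * \int[m]_om tv om)%E].
Proof.
move=> mS; have mtv : measurable_fun setT (tv : bN -> \bar R) by exact: measurable_total_variation.
have tv0 om : (0 <= tv om)%E by apply: total_variation_ge0; exact: open_borel.
have mKtv : measurable_fun setT (fun om : bN => K%:E * tv om)%E by exact: measurable_funeM.
have avg : (\int[beta]_e \int[m]_om lift_energy e om <=
    (ballM R d)%:E * (K%:E * \int[m]_om tv om))%E.
  rewrite (fubini_tonelli (m1 := beta) (m2 := m) _ measurable_energy); last first.
    by move=> z; exact: lift_energy_ge0.
  have M0 : 0 <= ballM R d by rewrite ltW// ballM_gt0.
  have K0e : (0 <= K%:E)%E by rewrite lee_fin.
  rewrite -(@ge0_integralZl _ _ _ m setT measurableT tv mtv K%:E (fun om _ => tv0 om) K0e).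
  rewrite -(@ge0_integralZl _ _ _ m setT measurableT (fun om => K%:E * tv om)%E mKtv (ballM R d)%:E); last 2 first.
  - by move=> om _; rewrite mule_ge0// lee_fin.
  - by rewrite lee_fin.
  apply: ae_ge0_le_integral => //.
  - by move=> om _; apply: integral_ge0 => e _; exact: lift_energy_ge0.
  - have := measurable_fun_fubini_tonelli_G (m1 := beta) _ measurable_energy.
    by apply => z; exact: lift_energy_ge0.
  - by move=> om _; rewrite !mule_ge0// lee_fin// ltW// ballM_gt0.
  - exact: measurable_funeM.
  exists (~` (@unit_sphere R N : set bN)); split => //.
    by apply: measurableC; exact: measurable_unit_sphere.
  by move=> om /= nom; apply: contra_not nom => om1 _; exact: average_lift_energy.
have mi : measurable_fun setT (fun e : bd => \int[m]_om lift_energy e om)%E.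
  have := measurable_fun_fubini_tonelli_F (m2 := m) _ measurable_energy.
  by apply => z; exact: lift_energy_ge0.
have KI0 : (0 <= K%:E * \int[m]_om tv om)%E by rewrite mule_ge0 ?lee_fin// integral_ge0.
have I0 e : (0 <= \int[m]_om lift_energy e om)%E.
  by apply: integral_ge0 => om _; exact: lift_energy_ge0.
have good : {ae beta, forall e, (forall k, (lift_energy e (delta_mx ord0 k) < +oo)%E) /\
    leb [set x | (e : 'rV_d) *m w x = 0] = 0%E}.
  by apply: negligibleS (negligibleU energy_finite kernel_null) => e /= /not_andP.
have [e [He1 He2] Hle] := exists_le_average betaT (@ballM_gt0 R d) KI0 mi I0 avg good.
by exists e.
Qed.

End averaging.

(** * The surface measure and the conclusion *)

Section sphere_measure.
Context {R : realType} {N s : nat}.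
Local Notation bN := (borel R N).
Let H := hausdorff_measure R N s.
Let S := @unit_sphere R N : set (caratheodory_type (hausdorff R N s)).

(** The Hausdorff measure lives on its Caratheodory sets. Borel sets are among them, so when [H S]
    is finite its restriction to the sphere can be read as a finite Borel measure, to which
    Tonelli's theorem applies. *)
Lemma sphere_measure : exists m : {finite_measure set bN -> \bar R},
  m (~` (@unit_sphere R N : set bN)) = 0%E /\
  ((H S < +oo)%E -> forall f : bN -> \bar R, measurable_fun setT f -> (forall x, 0 <= f x)%E ->
    (\int[H]_(x in S) f x = \int[m]_x f x)%E).
Proof.
have mS : measurable S by apply: borel_hausdorff; exact: measurable_unit_sphere.
have mCS : measurable (~` (@unit_sphere R N : set bN)).
  by apply: measurableC; exact: measurable_unit_sphere.
(* If [H S] is infinite, only the first clause has content and the zero measure satisfies it. *)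
have [Hoo|Hoo] := pselect (H S < +oo)%E; last first.
  have z0 : ((@mzero _ bN R) setT < +oo)%E by rewrite /mzero ltry.
  by exists (mfrestr measurableT z0); split.
have mid : measurable_fun setT (fun x : caratheodory_type (hausdorff R N s) => x : bN).
  by move=> _ A mA; rewrite setTI; exact: borel_hausdorff.
pose m1 : {measure set (caratheodory_type (hausdorff R N s)) -> \bar R} := mrestr H mS.
have [m2 m2E] : {m2 : {measure set bN -> \bar R} | forall A, m2 A = m1 A}.
  by unshelve eexists (pushforward m1 (mfun_of mid)).
have m2oo : (m2 setT < +oo)%E by rewrite m2E [ltLHS]/=/mrestr setTI.
exists (mfrestr measurableT m2oo); split.
  transitivity (m2 (~` (@unit_sphere R N : set bN) `&` setT)); first by [].
  rewrite setIT m2E; transitivity (H (~` S `&` S)); first by [].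
  by rewrite setICl; exact: measure0.
move=> _ f mf f0.
have mfid := measurableT_comp mf mid.
rewrite -(@ge0_integral_restriction _ _ _ m1 H S f mS (fun A _ => erefl) mfid f0).
have -> : (\int[mfrestr measurableT m2oo]_x f x = \int[m2]_x f x)%E.
  by apply: eq_measure_integral => A mA _; transitivity (m2 (A `&` setT)); [|rewrite setIT].
have -> : (\int[m2]_x f x = \int[pushforward m1 (mfun_of mid)]_x f x)%E.
  by apply: eq_measure_integral => A mA _; rewrite m2E.
by rewrite ge0_integral_pushforward.
Qed.

End sphere_measure.

Theorem proposition4p3 (R : realType) (d N : nat) (hd : (2 <= d)%N)
    (hN : (1 <= N)%N) (Omega : set 'rV[R]_N) (hOmega : open Omega)
    (u : 'rV[R]_N -> 'M[R]_d) (hu : BV Omega (@RP R d) u) :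
  exists n : 'rV[R]_N -> 'rV[R]_d,
    [/\ BV Omega (@unit_sphere R d) n,
        {ae leb R N, forall x, Omega x -> u x = rp_embed (n x)} &
        (bv_seminorm Omega n <= (1 + 2 / pi)%:E * bv_seminorm Omega u)%E].
Proof.
have [Lu uRP exDu] := hu.
(* An arbitrary unit vector: the default of [unit_of] and, through [rp_embed], the value of the
   modified map off its good set. *)
pose v0 : 'rV[R]_d := delta_mx ord0 (Ordinal (ltnW hd)).
have v01 : frob v0 = 1 by exact: frob_delta.
have RPv0 : RP (rp_embed v0) by exists v0.
have [w [mw wRP uw]] := bounded_modification hOmega Lu RPv0 uRP.
have Dw := is_Du_ae hOmega Lu mw uw (DuP exDu).
have [m [mS mint]] := @sphere_measure R N N.-1.
have [e [efin enull ele]] := exists_good_direction v0 hOmega mw wRP Dw mS.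
pose n := lift_along w v0 e; exists n.
have mn : mxmeasurable n by exact: mxmeasurable_lift.
have n1 x : frob (n x) <= 1 by rewrite frob_lift_along.
have exDn : exists mu, is_Du Omega n mu.
  exact: (exists_Du mn n1 hOmega (@mesh_gt0 R) (@mesh_cvg0 R) efin).
split.
- split => //; first exact: bounded_L1loc n1.
  by apply: aeW => x _; exact: frob_lift_along.
(* Where [e *m w x] vanishes, the default [v0] need not represent the line [w x]; the choice of [e]
   makes this set null. *)
- have mker : measurable [set x : borel R N | e *m w x = 0].
    rewrite (_ : [set _ | _] = (fun x : borel R N => frob (e *m w x)) @^-1` [set 0]); last first.
      by apply/seteqP; split => x /= => [->|/eqP]; [rewrite frob0|rewrite frob_eq0 => /eqP].
    apply: measurable_preimageT => //; apply: measurable_frob => i j; under eq_fun do rewrite mxE.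
    by apply: measurable_sum => k; apply: measurable_funM => //; exact: mw.
  have ker_negl : (leb R N).-negligible [set x : borel R N | e *m w x = 0].
    by apply/negligibleP.
  apply: negligibleS (negligibleU uw ker_negl) => x /= nx.
  have [e0|e0] := eqVneq (e *m w x) 0; [by right|left => H; apply: nx => Ox].
  rewrite H// /n /lift_along; have [a a1 aw] := wRP x.
  rewrite -aw rp_embed_unit_of//; apply: contra_neq e0 => ea.
  by rewrite -aw mulmx_rp_embed ea mulr0 scale0r.
rewrite /bv_seminorm.
set H := hausdorff_measure R N N.-1; set S := @unit_sphere R N.
(* For infinite [H S], [fine (H S)] is 0 and so is its inverse, and both seminorms vanish. Otherwise
   [m] represents the surface integral. *)
have [Hoo|Hoo] := pselect (H S < +oo)%E; last first.
  have -> : fine (H S) = 0.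
    by have -> : H S = +oo%E by apply/eqP; rewrite -leye_eq leNgt; apply/negP.
  by rewrite invr0 !mul0e mule0.
have tvm q (nu : @matrix_charge R N q d) : measurable_fun setT
    (fun om : borel R N => Defs.total_variation (directional nu om) Omega).
  exact: measurable_total_variation.
have tv0 q (nu : @matrix_charge R N q d) om :
    (0 <= Defs.total_variation (directional nu om) Omega)%E.
  by apply: total_variation_ge0; exact: open_borel.
rewrite muleCA; apply: lee_wpmul2l; first by rewrite lee_fin invr_ge0 fine_ge0.
rewrite (mint Hoo _ (tvm _ _) (tv0 _ _)) (mint Hoo _ (tvm _ _) (tv0 _ _)).
apply: le_trans ele; apply: ge0_le_integral => //.
  exact: measurable_lift_energyr.
move=> om _; exact: (total_variation_le_liminf mn n1 om hOmega (DuP exDn) (@mesh_gt0 R) (@mesh_cvg0 R)).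
Qed.
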